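(* Let $J$ be a profile set and $\bm\alpha\in\mathbb{R}_+^J$ satisfy Assumption 1 with vector $\bm\beta$. For each $n$ with $\bm\alpha$ $n$-feasible, let $\lambda$ be chosen uniformly at random from $\mathcal P(\mathbf N(\bm\alpha,n))$. Then $\phi_{\lambda,n}\to\phi_\infty$ in distribution (in the topology of uniform convergence on compact subsets of $(0,\infty)$); concretely, for every $0<t_1<t_2<\infty$ and $\varepsilon>0$, $$\lim_{n\to\infty}\mathbb P\Big(\max_{t\in[t_1,t_2]}|\phi_{\lambda,n}(t)-\phi_\infty(t)|\ge\varepsilon\Big)=0,$$ the limit being along $n$ for which $\bm\alpha$ is $n$-feasible.
   Context: A profile set $J$ is a finite set of non-negative integers containing at least one positive integer. A partition is a finite multiset of positive integers; $\mathcal P(\mathbf N)$ is the set of partitions $\lambda$ with $\sum_{x\in\lambda}x^j=\mathbf N_j$ for all $j\in J$. $\mathbf N(\bm\alpha,n)=(\lfloor\bm\alpha_jn^{(j+1)/2}\rfloor)_{j\in J}$. $\mathcal Q_J$ is the set of polynomials $\sum_{j\in J}t_jx^j$ with $t_j\in(-1/2,1/2]$ taking integer values on $\mathbb Z$; $\mathsf{NT}=\{(m_j)\in\mathbb Z^J: \sum_j a_jm_j\in\mathbb Z\ \forall \sum_ja_jx^j\in\mathcal Q_J\}$; $\bm\alpha$ is $n$-feasible if $\mathbf N(\bm\alpha,n)\in\mathsf{NT}$. Assumption 1: there exists $\bm\beta\in(\mathbb{R}\setminus\{0\})^J$ with $\int_0^\infty \frac{x^j}{\exp(\sum_{\ell\in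 J}\bm\beta_\ell x^\ell)-1}dx=\bm\alpha_j$ (convergent) for all $j\in J$. For a partition $\lambda$, $\phi_{\lambda,n}(t)=n^{-1/2}|\{a\in\lambda: a\ge t\sqrt n\}|$ (parts counted with multiplicity), and $\phi_\infty(t)=\int_t^\infty\frac{ds}{\exp(\sum_{j\in J}\bm\beta_js^j)-1}$. *)

(* Defs.v *)
From HB Require Import structures.
From mathcomp Require Import all_boot all_order all_algebra finmap.
From mathcomp Require Import all_classical all_reals all_analysis.
Set Implicit Arguments. Unset Strict Implicit. Unset Printing Implicit Defensive.
Import Order.TTheory GRing.Theory Num.Theory.
Local Open Scope classical_set_scope.
Local Open Scope ring_scope.

Definition profile_set (J : {fset nat}) : Prop := exists2 j, j \in J & (0 < j)%N.

Definition is_partition (s : seq nat) : Prop :=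
  sorted geq s /\ all (fun x => 0 < x)%N s.

Definition partitions (J : {fset nat}) (N : nat -> int) : set (seq nat) :=
  [set s | is_partition s /\ forall j, j \in J -> (sumn [seq (x ^ j)%N | x <- s])%:Z = N j].

Definition Nvec (R : realType) (alpha : nat -> R) (n : nat) : nat -> int :=
  fun j => Num.floor (alpha j * Num.sqrt (n%:R : R) ^+ j.+1).

Definition in_QJ (R : realType) (J : {fset nat}) (t : nat -> R) : Prop :=
  (forall j, j \in J -> -(2^-1) < t j <= 2^-1) /\
  forall z : int, exists k : int, \sum_(j <- J) t j * (z%:~R) ^+ j = k%:~R.

Definition in_NT (R : realType) (J : {fset nat}) (m : nat -> int) : Prop :=
  forall a : nat -> R, in_QJ J a ->
    exists k : int, \sum_(j <- J) a j * (m j)%:~R = k%:~R.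

Definition feasible (R : realType) (J : {fset nat}) (alpha : nat -> R) (n : nat) : Prop :=
  in_NT R J (Nvec alpha n).

Definition bose (R : realType) (J : {fset nat}) (beta : nat -> R) (j : nat) (x : R) : R :=
  x ^+ j / (expR (\sum_(l <- J) beta l * x ^+ l) - 1).

Definition assumption1 (R : realType) (J : {fset nat}) (alpha beta : nat -> R) : Prop :=
  (forall j, j \in J -> beta j != 0) /\
  forall j, j \in J ->
    (@lebesgue_measure R).-integrable `]0%R, +oo[ (fun x => (bose J beta j x)%:E) /\
    (\int[@lebesgue_measure R]_(x in `]0%R, +oo[) (bose J beta j x)%:E = (alpha j)%:E)%E.

Definition phi_n (R : realType) (s : seq nat) (n : nat) (t : R) : R :=
  (count (fun a => t * Num.sqrt (n%:R : R) <= a%:R) s)%:R / Num.sqrt (n%:R).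

Definition phi_inf (R : realType) (J : {fset nat}) (beta : nat -> R) (t : R) : R :=
  fine (\int[@lebesgue_measure R]_(s in `[t, +oo[) (bose J beta 0 s)%:E)%E.

Definition unif_prob (R : realType) (P E : set (seq nat)) : R :=
  (#|` fset_set (P `&` E)|)%:R / (#|` fset_set P|)%:R.

Definition sup_dev (R : realType) (J : {fset nat}) (beta : nat -> R)
  (t1 t2 : R) (s : seq nat) (n : nat) : R :=
  sup [set `|phi_n s n t - phi_inf J beta t| | t in `[t1, t2]].

(* Main.v *)
Require Import Defs.
From HB Require Import structures.
From mathcomp Require Import all_boot all_order all_algebra finmap.
From mathcomp Require Import all_classical all_reals all_analysis.
From mathcomp Require Import measurable_realfun zify ring lra.
Import Order.TTheory GRing.Theory Num.Theory.
Import numFieldNormedType.Exports.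
Local Open Scope classical_set_scope.
Local Open Scope ring_scope.

(** Write Q(s) for the polynomial sum_j beta_j s^j. Under the Boltzmann law, where the part x
    has a geometric multiplicity with ratio exp(- Q(x / sqrt n)) independently of the
    other parts, all partitions of N have the same weight, so the uniform law on them is the
    Boltzmann law conditioned on the power sums being N. By Chernoff bounds the profile
    deviates from its limit with Boltzmann probability at most exp(- c sqrt n). It is therefore
    enough that the conditioning event, if not empty, has probability exp(- o(sqrt n)).

    For that, forbid the parts lying in short blocks of length L = delta sqrt n after
    M, 2M, ..., (D+1)M, where M is about sqrt n and D = max J; this costs a factor
    exp(O(delta sqrt n)). A typical configuration then misses N by an amount close to the
    expected contribution of the blocks, i.e. to the power sums of about w_i L copies of
    each part iM. A vector in the lattice spanned by the (x^j) close to such a center is the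
    vector of power sums of a genuine multiset: with M = H^(D+1), finite differences of order
    k on the progressions H^q, 2H^q, ..., (k+1)H^q realise it by integer coefficients, and the
    ones of the scales q <= D are small enough to be absorbed in a base multiset.
    Adjoining that multiset, chosen by pigeonhole on the power sums of the
    configuration, is an injection into the partitions of N. *)

(** * Integer combinations of power vectors *)

(** Adjoining parts can only increase power sums, so a configuration fluctuating on both sides of N
    could not be completed. Emptying the blocks creates a deficit of order delta sqrt n at every
    node, far above the fluctuation eta' sqrt n left by concentration; delta is fixed first, then
    eta', then n grows. The blocks are D+1 in number because differences of order up to D use D+1
    nodes, each of which must have copies to give away.

    Why powers of H: the k-th difference with step H^q has k-th moment k! H^(qk). A multiple of k!
    is therefore expanded in base H^k, one digit for each scale q = 0, ..., D+1. Step M alone would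
    reach only multiples of k! M^k, and step 1 alone would need coefficients of order M^k. With all
    scales, every digit but the top one is at most H^D = M/H, negligible against L.

    No local limit theorem is involved: membership in the lattice is witnessed by any one partition
    of N, and polynomial losses are harmless at the scale exp(- o(sqrt n)). Cutting parts at X and
    multiplicities at K makes every probability a finite sum. *)

Definition psum (s : seq nat) (j : nat) : int := \sum_(x <- s) (x%:Z) ^+ j.

Lemma Posz_exp (m k : nat) : (m ^ k)%N%:Z = m%:Z ^+ k.
Proof. by elim: k => [|k IH] //; rewrite expnS PoszM IH exprS. Qed.

Fixpoint fdiff (k : nat) (f : nat -> int) (x : nat) : int :=
  if k is k'.+1 then fdiff k' f x.+1 - fdiff k' f x else f x.

Lemma fdiff_ext k f g : f =1 g -> fdiff k f =1 fdiff k g.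
Proof. by move=> fg; elim: k => [|k IH] x //=; rewrite !IH. Qed.

Lemma fdiffS k f x : fdiff k.+1 f x = fdiff k (fun y => f y.+1 - f y) x.
Proof.
elim: k x => [|k IH] x //.
by rewrite -[LHS]/(fdiff k.+1 f x.+1 - fdiff k.+1 f x) !IH.
Qed.

Lemma fdiff_sum k (I : Type) (r : seq I) (a : I -> int) (F : I -> nat -> int) x :
  fdiff k (fun y => \sum_(i <- r) a i * F i y) x = \sum_(i <- r) a i * fdiff k (F i) x.
Proof.
elim: k x => [|k IH] x //=.
by rewrite !IH -sumrB; apply: eq_bigr => i _; rewrite mulrBr.
Qed.

Lemma fdiff_pow k j x : (j <= k)%N ->
  fdiff k (fun y => (y%:Z) ^+ j) x = if j == k then (k`!)%:Z else 0.
Proof.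
elim: k j x => [|k IH] j x; first by rewrite leqn0 => /eqP ->.
move=> jk; rewrite fdiffS.
rewrite (@fdiff_ext k _ (fun y => \sum_(0 <= i < j) 'C(j, i)%:Z * (y%:Z) ^+ i)); last first.
  move=> y; rewrite -addn1 PoszD exprD1n big_ord_recr /= binn mulr1n addrK.
  rewrite big_mkord.
  by apply: eq_bigr => i _; rewrite -mulr_natl natz.
rewrite (fdiff_sum k _ _ _ (fun i (y : nat) => (y%:Z) ^+ i)).
rewrite big_mkord.
case: eqP => [->|jk'].
  rewrite big_ord_recr /= big1 ?add0r; last first.
    by move=> i _; rewrite IH ?(ltnW (ltn_ord i)) // (ltn_eqF (ltn_ord i)) mulr0.
  by rewrite IH // eqxx binSn factS PoszM.
rewrite big1 // => i _; have := ltn_ord i => ij.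
by rewrite IH; [case: eqP => [|_]; [lia|rewrite mulr0]|lia].
Qed.

Lemma fdiff_coef k : exists c : nat -> int,
  (forall i, `|c i| <= (2 ^ k)%:Z) /\
  forall f x, fdiff k f x = \sum_(i < k.+1) c i * f (x + i)%N.
Proof.
elim: k => [|k [c [cb cE]]].
  exists (fun _ => 1); split=> // f x.
  by rewrite big_ord1 mul1r addn0.
exists (fun i => (if i == 0%N then 0 else c i.-1) - (if i == k.+1 then 0 else c i)).
split=> [i|f x].
  rewrite (le_trans (ler_normB _ _)) // expnS mul2n -addnn PoszD lerD //.
    by case: ifP => // _; rewrite normr0.
  by case: ifP => // _; rewrite normr0.
rewrite /= !cE.
under [RHS]eq_bigr do rewrite mulrBl.
rewrite sumrB; congr (_ - _).
  rewrite [RHS]big_ord_recl /= mul0r add0r; apply: eq_bigr => i _ /=.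
  by rewrite /bump /= add1n addSnnS.
rewrite [RHS]big_ord_recr /= eqxx mul0r addr0; apply: eq_bigr => i _.
by rewrite (ltn_eqF (ltn_ord i)).
Qed.

(** The lattice generated by the vectors (x^j) with j at most D: [s1] and [s2] list the nodes with
    positive and with negative coefficients. In this form the difference of two multisets of parts
    belongs to it by definition. *)
Definition in_span (D : nat) (p : nat -> int) : Prop :=
  exists s1 s2, forall j, (j <= D)%N -> p j = psum s1 j - psum s2 j.

Lemma psum_cat s t j : psum (s ++ t) j = psum s j + psum t j.
Proof. exact: big_cat. Qed.

Lemma in_spanB D p q : in_span D p -> in_span D q -> in_span D (fun j => p j - q j).
Proof.
move=> [s1 [s2 ps]] [t1 [t2 qt]]; exists (s1 ++ t2), (s2 ++ t1) => j jD.
by rewrite ps // qt // !psum_cat; ring.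
Qed.

Lemma in_span0 D : in_span D (fun _ => 0).
Proof. by exists [::], [::] => j _; rewrite subrr. Qed.

Lemma in_spanN D p : in_span D p -> in_span D (fun j => - p j).
Proof.
move=> /(in_spanB _ _ _ (in_span0 D)) [s1 [s2 ps]].
by exists s1, s2 => j jD; rewrite -ps // sub0r.
Qed.

Lemma in_spanD D p q : in_span D p -> in_span D q -> in_span D (fun j => p j + q j).
Proof.
move=> ps /in_spanN qs; have [s1 [s2 H]] := in_spanB _ _ _ ps qs.
by exists s1, s2 => j jD; rewrite -H // opprK.
Qed.

Lemma in_span_ext D p q : (forall j, (j <= D)%N -> p j = q j) -> in_span D p -> in_span D q.
Proof. by move=> pq [s1 [s2 H]]; exists s1, s2 => j jD; rewrite -pq ?H. Qed.

Lemma in_spanZ D (a : int) p : in_span D p -> in_span D (fun j => a * p j).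
Proof.
move=> ps.
have H (n : nat) : in_span D (fun j => n%:Z * p j).
  elim: n => [|n IH]; first by apply: in_span_ext (in_span0 D) => j _; rewrite mul0r.
  by apply: in_span_ext (in_spanD _ _ _ ps IH) => j _; rewrite -addn1 PoszD; ring.
case: a => n //; rewrite NegzE.
by apply: in_span_ext (in_spanN _ _ (H n.+1)) => j _; rewrite mulNr.
Qed.

Lemma in_span1 D x : in_span D (fun j => (x%:Z) ^+ j).
Proof.
by exists [:: x], [::] => j _; rewrite /psum big_seq1 big_nil subr0.
Qed.

Lemma in_span_sum D (I : Type) (r : seq I) (F : I -> nat -> int) :
  (forall i, in_span D (F i)) -> in_span D (fun j => \sum_(i <- r) F i j).
Proof.
move=> FD; elim: r => [|i r IH].
  by apply: in_span_ext (in_span0 D) => j _; rewrite big_nil.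
by apply: in_span_ext (in_spanD _ _ _ (FD i) IH) => j _; rewrite big_cons.
Qed.

(* Modulo lower powers, x^k is the falling factorial k! * C(x, k). *)
Lemma in_span_fact_dvd D p k : in_span D p -> (k <= D)%N ->
  (forall j, (j < k)%N -> p j = 0) -> exists g : int, p k = (k`!)%:Z * g.
Proof.
move=> [s1 [s2 H]] kD p0.
pose P : {poly int} := \prod_(i < k) ('X - (i%:Z)%:P).
have PE (x : nat) : P.[x%:Z] = (k`!)%:Z * ('C(x, k))%:Z.
  rewrite -PoszM mulnC bin_ffact /P horner_prod.
  have [xk|kx] := ltnP x k.
    rewrite ffact_small // (bigD1 (Ordinal xk)) //= hornerXsubC subrr mul0r.
    by [].
  rewrite ffact_prod (big_morph Posz PoszM (erefl _)).
  apply: eq_bigr => i _; rewrite hornerXsubC -subzn //.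
  exact: leq_trans (ltnW (ltn_ord i)) kx.
have sP : size P = k.+1.
  by rewrite size_prod_XsubC /index_enum -enumT size_enum_ord.
have lP : P`_k = 1.
  have /monicP : P \is monic by apply: monic_prod => i _; exact: monicXsubC.
  by rewrite lead_coefE sP.
have sumP s : \sum_(x <- s) P.[x%:Z] = \sum_(i < k.+1) P`_i * psum s i.
  under eq_bigr do rewrite horner_coef sP.
  by rewrite exchange_big /=; apply: eq_bigr => i _; rewrite mulr_sumr.
have E : p k = \sum_(i < k.+1) P`_i * p i.
  rewrite big_ord_recr /= lP mul1r big1 ?add0r // => i _.
  by rewrite p0 // mulr0.
exists (\sum_(x <- s1) ('C(x, k))%:Z - \sum_(x <- s2) ('C(x, k))%:Z).
rewrite E mulrBr !mulr_sumr.
under [X in _ = X - _]eq_bigr do rewrite -PE.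
under [X in _ = _ - X]eq_bigr do rewrite -PE.
rewrite !sumP -sumrB; apply: eq_bigr => i _.
by rewrite H ?mulrBr // -ltnS (leq_trans (ltn_ord i)).
Qed.

(** The expansion stops at [Q] and leaves the remaining quotient as top digit. The lower digits are
    bounded by the base whatever the size of [g]; only the top one, later the coefficient at scale
    M, feels that size. *)
Lemma digits_nat (b Q g : nat) : (0 < b)%N -> exists d : nat -> nat,
  [/\ g = (\sum_(q < Q.+1) d q * b ^ q)%N, forall q, (q < Q)%N -> (d q <= b)%N
    & (d Q * b ^ Q <= g)%N].
Proof.
move=> b0; elim: Q g => [|Q IH] g.
  by exists (fun _ => g); split; rewrite ?big_ord1 ?muln1.
have [d [dE db dQ]] := IH (g %/ b)%N.
exists (fun q => if q is q'.+1 then d q' else g %% b)%N; split.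
- rewrite big_ord_recl /= muln1 {1}(divn_eq g b) addnC; congr (_ + _)%N.
  rewrite {1}dE big_distrl /=; apply: eq_bigr => i _.
  by rewrite /bump /= add1n expnS mulnCA mulnC.
- by case=> [_|q /db //]; rewrite ltnW // ltn_mod.
- rewrite expnS mulnCA mulnC.
  by rewrite (leq_trans (leq_mul dQ (leqnn b))) // leq_trunc_div.
Qed.

Lemma digits_int (b Q : nat) (g : int) : (0 < b)%N -> exists d : nat -> int,
  [/\ g = \sum_(q < Q.+1) d q * (b%:Z) ^+ q,
      forall q, (q < Q)%N -> `|d q| <= b%:Z
    & `|d Q| * (b%:Z) ^+ Q <= `|g|].
Proof.
move=> b0; have [d [dE db dQ]] := digits_nat b Q (absz g) b0.
exists (fun q => sgz g * (d q)%:Z); split.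
- rewrite {1}[g]intEsg dE.
  rewrite (big_morph Posz PoszD (erefl _)) mulr_sumr; apply: eq_bigr => i _.
  by rewrite PoszM -rmorphXn mulrA.
- move=> q /db dq; rewrite normrM normr_sgz.
  by case: (g != 0); rewrite ?mul1r ?mul0r // ler_nat.
- have -> : `|g| = (absz g)%:Z by [].
  rewrite normrM normr_sgz -[ `|(d Q)%:Z|]/((d Q)%:Z).
  case: (g != 0); rewrite ?mul1r ?mul0r //.
  by rewrite -natz -[b%:Z]natz -natrX -natrM -[(absz g)%:Z]natz ler_nat.
Qed.
(** A k-th difference based at 1 and dilated by [h]: the dilation multiplies the moment of order k
    by h^k and leaves the lower ones zero. Starting at 1 keeps the nodes [i.+1 * h] positive for
    positive [h], as parts must be. *)
Lemma fdiff_scale k : exists c : nat -> int,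
  (forall i, `|c i| <= (2 ^ k)%:Z) /\
  forall h j, (j <= k)%N ->
    \sum_(i < k.+1) c i * ((i.+1 * h)%N%:Z) ^+ j = if j == k then (k`!)%:Z * (h%:Z) ^+ k else 0.
Proof.
have [c [cb cE]] := fdiff_coef k; exists c; split=> // h j jk.
have := fdiff_pow k j 1 jk; rewrite cE => E.
transitivity ((\sum_(i < k.+1) c i * (1 + i)%N%:Z ^+ j) * (h%:Z) ^+ j).
  rewrite mulr_suml; apply: eq_bigr => i _.
  by rewrite -mulrA -exprMn -PoszM add1n.
by rewrite E; case: eqP => [->|_]; rewrite ?mul0r.
Qed.

(* The geometric scales H^q (q <= D) carry small corrections, the top scale M = H^(D+1)
   absorbs the bulk: since a digit in base H^k is at most H^D, the lower scales
   only perturb the residual by O(H^D M^j). *)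
Lemma small_coef_rep (D : nat) : exists C0 : nat, forall (H B : nat) (p : nat -> int),
  (0 < H)%N -> in_span D p ->
  (forall j, (j <= D)%N -> `|p j| <= B%:Z * ((H ^ D.+1)%N%:Z) ^+ j) ->
  exists e : nat -> nat -> int,
  [/\ forall i q, (q <= D)%N -> `|e i q| <= (C0 * H ^ D)%N%:Z,
      forall i, `|e i D.+1| <= (C0 * (B + H ^ D))%N%:Z
    & forall j, (j <= D)%N ->
      p j = \sum_(i < D.+1) \sum_(q < D.+2) e i q * ((i.+1 * H ^ q)%N%:Z) ^+ j].
Proof.
(* The orders 0, ..., D are matched from the bottom, [d] counting the top orders that may still be
   nonzero. Matching one order disturbs only higher ones, at the price of a larger constant. *)
suff main d : (d <= D.+1)%N -> exists C0 : nat, forall (H B : nat) (p : nat -> int),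
  (0 < H)%N -> in_span D p -> (forall j, (j < D.+1 - d)%N -> p j = 0) ->
  (forall j, (j <= D)%N -> `|p j| <= B%:Z * ((H ^ D.+1)%N%:Z) ^+ j) ->
  exists e : nat -> nat -> int,
  [/\ forall i q, (q <= D)%N -> `|e i q| <= (C0 * H ^ D)%N%:Z,
      forall i, `|e i D.+1| <= (C0 * (B + H ^ D))%N%:Z
    & forall j, (j <= D)%N ->
      p j = \sum_(i < D.+1) \sum_(q < D.+2) e i q * ((i.+1 * H ^ q)%N%:Z) ^+ j].
  have [C0 HC] := main D.+1 (leqnn _); exists C0 => H B p H0 ps pb.
  by apply: HC => // j; rewrite subnn.
elim: d => [_|d IH dD].
  exists 0%N => H B p H0 ps p0 pb; exists (fun _ _ => 0); split => // j jD.
  rewrite p0 ?subn0 //; rewrite big1 // => i _; rewrite big1 // => q _.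
  by rewrite mul0r.
have [C' HC'] := IH (ltnW dD).
set k := (D.+1 - d.+1)%N.
have kD : (k <= D)%N by rewrite /k; lia.
have k1 : (D.+1 - d)%N = k.+1 by rewrite /k; lia.
have [c [cb cE]] := fdiff_scale k.
(* [K1] bounds the correction [t] in units of (B + H^D) M^j: at most (D+2)(D+1) terms, difference
   coefficients at most 2^D, nodes at most (D+1)M. The residual then has K1+1 times B + H^D in place
   of B, whence K1+2 below; 2^D covers the coefficients added at this order. *)
pose K1 := (D.+2 * (D.+1 * (2 ^ D * D.+1 ^ D)))%N.
exists (C' * K1.+2 + 2 ^ D)%N => H B p H0 ps p0 pb.
have [g gE] := in_span_fact_dvd _ _ _ ps kD p0.
have Hk0 : (0 < H ^ k)%N by rewrite expn_gt0 H0.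
(* The difference at scale H^q has moment k! (H^k)^q, so the digits of [g] in base H^k are the
   multiples needed at the successive scales. *)
have [d' [dE db dQ]] := digits_int (H ^ k) D.+1 g Hk0.
have HkD : (H ^ k <= H ^ D)%N by rewrite leq_pexp2l.
have kf : (0 < k`!)%N := fact_gt0 k.
(* Since (H^k)^(D+1) = M^k, the bound B M^k on [p k] leaves at most B for the top digit. *)
have dtop : `|d' D.+1| <= B%:Z.
  have M0 : 0 < ((H ^ D.+1)%N%:Z) ^+ k :> int by rewrite exprn_gt0 // ltz_nat expn_gt0 H0.
  rewrite -(ler_pM2r M0).
  have -> : ((H ^ D.+1)%N%:Z) ^+ k = ((H ^ k)%N%:Z) ^+ D.+1 :> int.
    by rewrite -!Posz_exp -!expnM mulnC.
  apply: le_trans dQ _.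
  have := pb k kD; rewrite -!Posz_exp -!expnM [(k * _)%N]mulnC => pk.
  apply: le_trans pk; rewrite gE normrM ler_peMl //.
have dlow q : (q <= D)%N -> `|d' q| <= (H ^ D)%N%:Z.
  by move=> qD; rewrite (le_trans (db _ _)) // lez_nat.
pose t j := \sum_(i < k.+1) \sum_(q < D.+2) d' q * c i * ((i.+1 * H ^ q)%N%:Z) ^+ j.
have tE j : (j <= k)%N -> t j = if j == k then p k else 0.
  move=> jk; rewrite /t exchange_big /=.
  under eq_bigr => q _.
    under eq_bigr => i _ do rewrite -mulrA.
    rewrite -mulr_sumr cE //; over.
  case: eqP => _; last by rewrite big1 // => i _; rewrite mulr0.
  rewrite gE dE mulr_sumr; apply: eq_bigr => q _.
  by rewrite mulrCA -!Posz_exp -!expnM mulnC.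
have nodeb i q j : (i <= D)%N -> (q <= D.+1)%N -> (j <= D)%N ->
    ((i.+1 * H ^ q)%N%:Z) ^+ j <= (D.+1 ^ D)%N%:Z * ((H ^ D.+1)%N%:Z) ^+ j.
  move=> iD qD jD; rewrite -!Posz_exp -PoszM lez_nat expnMn leq_mul //.
    apply: (@leq_trans (D.+1 ^ j)%N); last by rewrite leq_pexp2l.
    by have [->//|j0] := posnP j; rewrite leq_exp2r.
  have [->//|j0] := posnP j.
  by rewrite leq_exp2r // leq_pexp2l.
have tb j : (j <= D)%N -> `|t j| <= (K1 * (B + H ^ D))%N%:Z * ((H ^ D.+1)%N%:Z) ^+ j.
  move=> jD; rewrite /t.
  set X := ((H ^ D.+1)%N%:Z) ^+ j.
  have X0 : 0 <= X by rewrite exprn_ge0.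
  have each (i : 'I_k.+1) (q : 'I_D.+2) : `|d' q * c i * ((i.+1 * H ^ q)%N%:Z) ^+ j|
     <= (B + H ^ D)%N%:Z * ((2 ^ D * D.+1 ^ D)%N%:Z * X).
    rewrite -mulrA normrM ler_pM //.
      have [qD|] := leqP q D; first by rewrite (le_trans (dlow _ qD)) // lez_nat leq_addl.
      move=> qD; have -> : (q : nat) = D.+1 by apply/eqP; rewrite eqn_leq qD -ltnS ltn_ord.
      by rewrite (le_trans dtop) // lez_nat leq_addr.
    rewrite normrM [(2 ^ D * _)%N%:Z]PoszM -[X in _ <= X]mulrA ler_pM //.
      by rewrite (le_trans (cb _)) // lez_nat leq_pexp2l.
    rewrite ger0_norm ?exprn_ge0 //; apply: nodeb => //; last by rewrite -ltnS.
    by rewrite -ltnS (leq_trans (ltn_ord i)).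
  apply: le_trans (ler_norm_sum _ _ _) _.
  apply: (@le_trans _ _ (\sum_(i < k.+1) \sum_(q < D.+2)
      ((B + H ^ D)%N%:Z * ((2 ^ D * D.+1 ^ D)%N%:Z * X)))).
    apply: ler_sum => i _; apply: le_trans (ler_norm_sum _ _ _) _.
    by apply: ler_sum => q _.
  rewrite !sumr_const !card_ord -mulrnA -mulr_natl natz.
  have -> : (K1 * (B + H ^ D))%N%:Z * X =
    (D.+2 * D.+1)%N%:Z * ((B + H ^ D)%N%:Z * ((2 ^ D * D.+1 ^ D)%N%:Z * X)).
    by rewrite /K1 !PoszM; ring.
  apply: ler_wpM2r; last by rewrite lez_nat leq_mul.
  by rewrite !mulr_ge0.
have B'b j : (j <= D)%N ->
   `|p j - t j| <= (K1.+1 * (B + H ^ D))%N%:Z * ((H ^ D.+1)%N%:Z) ^+ j.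
  move=> jD; rewrite (le_trans (ler_normB _ _)) //.
  rewrite (le_trans (lerD (pb _ jD) (tb _ jD))) // -mulrDl ler_wpM2r ?exprn_ge0 //.
  by rewrite -PoszD lez_nat mulSn leq_add2r leq_addr.
have [||e [e1 e2 e3]] := HC' H _ (fun j => p j - t j) H0 _ _ B'b.
- apply: in_spanB => //; do 2! apply: in_span_sum => ?.
  by apply: in_spanZ; apply: in_span1.
- move=> j; rewrite k1 ltnS => jk; rewrite tE //.
  by case: eqP => [->|/eqP jk']; rewrite ?subrr // p0 ?subr0 // ltn_neqAle jk'.
have cdb i q : `|if (i < k.+1)%N then d' q * c i else 0| <= `|d' q| * (2 ^ D)%N%:Z.
  case: ifP => _; last by rewrite normr0 mulr_ge0.
  rewrite normrM ler_wpM2l // (le_trans (cb _)) // lez_nat leq_pexp2l //.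
exists (fun i q => e i q + if (i < k.+1)%N then d' q * c i else 0); split.
- move=> i q qD; rewrite (le_trans (ler_normD _ _)) //.
  rewrite mulnDl PoszD lerD //.
    by rewrite (le_trans (e1 _ _ qD)) // lez_nat leq_mul2r leq_pmulr ?orbT.
  by rewrite (le_trans (cdb _ _)) // mulrC PoszM ler_wpM2l // dlow.
- move=> i; rewrite (le_trans (ler_normD _ _)) //.
  rewrite mulnDl PoszD lerD //.
    rewrite (le_trans (e2 _)) // lez_nat -mulnA leq_mul //.
    by rewrite -[K1.+2]addn1 mulnDl leq_add2l mul1n leq_addl.
  rewrite (le_trans (cdb _ _)) // mulrC PoszM ler_wpM2l //.
  by rewrite (le_trans dtop) // lez_nat leq_addr.
- move=> j jD.
  have -> : p j = (p j - t j) + t j by rewrite subrK.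
  rewrite e3 // /t.
  under [RHS]eq_bigr do (under eq_bigr do rewrite mulrDl; rewrite big_split).
  rewrite big_split /=; congr (_ + _).
  rewrite (bigID (fun i : 'I_D.+1 => (i < k.+1)%N)) /= [X in _ = _ + X]big1 ?addr0; last first.
    by move=> i /negbTE ->; rewrite big1 // => q _; rewrite mul0r.
  rewrite (big_ord_widen_cond D.+1 xpredT
    (fun i => \sum_(q < D.+2) d' q * c i * (i.+1 * H ^ q)%N%:Z ^+ j)) //=.
  by apply: eq_bigr => i ->.
Qed.

(** For the Vandermonde matrix V of the nodes 1, ..., D+1, the identity V adj(V) = det(V) exhibits
    det(V) times each unit vector as an integer combination of power vectors. These serve to reduce
    the coordinates outside [J], on which nothing is imposed, modulo a fixed integer. *)
Lemma scaled_delta_in_span (D : nat) : exists (q : int) (rho : nat -> nat -> int),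
  [/\ q != 0, forall l, in_span D (rho l)
    & forall l j, (l <= D)%N -> (j <= D)%N -> rho l j = if j == l then q else 0].
Proof.
pose V : 'M[int]_D.+1 := Vandermonde D.+1 (\row_i (i.+1)%:Z).
exists (\det V), (fun l j => \sum_(i < D.+1) (\adj V) i (inord l) * (i.+1%:Z) ^+ j); split.
- rewrite det_Vandermonde; apply/prodf_neq0 => i _; apply/prodf_neq0 => j ij.
  by rewrite !mxE subr_eq0 eqz_nat eqSS gtn_eqF.
- move=> l; apply: in_span_sum => i; apply: in_spanZ; exact: in_span1.
move=> l j lD jD.
have := congr1 (fun A : 'M[int]_D.+1 => A (inord j) (inord l)) (mul_mx_adj V).
have VE i : V (inord j) i = (i.+1%:Z) ^+ j by rewrite !mxE inordK.
rewrite [LHS]mxE [RHS]mxE -val_eqE /= !inordK //.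
under eq_bigr => i _ do rewrite VE mulrC.
move=> ->; by case: (j == l).
Qed.

Lemma psum_nseq a x j : psum (nseq a x) j = a%:Z * (x%:Z) ^+ j.
Proof.
rewrite /psum; elim: a => [|a IH]; first by rewrite big_nil mul0r.
by rewrite /= big_cons IH -addn1 PoszD; ring.
Qed.

Lemma psum_multiplicities (n m : nat) (a node : nat -> nat -> nat) j :
  psum (flatten [seq flatten [seq nseq (a i q) (node i q) | q <- index_iota 0 m]
                | i <- index_iota 0 n]) j =
  \sum_(i < n) \sum_(q < m) (a i q)%:Z * ((node i q)%:Z) ^+ j.
Proof.
rewrite /psum big_flatten big_map big_mkord; apply: eq_bigr => i _.
rewrite big_flatten big_map big_mkord; apply: eq_bigr => q _.
exact: psum_nseq.
Qed.

(** The base multiset has [W i] copies of (i+1)M and C1 H^D copies of every node of lower scale. The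
    residual of [m] against it lies in the lattice and is small, so its integer coefficients are
    dominated by the base multiplicities and the sums stay nonnegative. *)
Lemma power_sum_rep (D : nat) (J : pred nat) : exists C0 : nat,
  forall (H B : nat) (W : nat -> nat) (m : nat -> int) (s1 s2 : seq nat),
  (0 < H)%N -> (forall j, J j -> (j <= D)%N) ->
  (forall i, (i <= D)%N -> (C0 * (B + H ^ D) <= W i)%N) ->
  (forall j, J j -> m j = psum s1 j - psum s2 j) ->
  (forall j, J j ->
     `|m j - \sum_(i < D.+1) (W i)%:Z * ((i.+1 * H ^ D.+1)%N%:Z) ^+ j|
       <= B%:Z * ((H ^ D.+1)%N%:Z) ^+ j) ->
  exists2 s, all (fun x => 0 < x)%N s & forall j, J j -> psum s j = m j.
Proof.
have [C1 core] := small_coef_rep D.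
have [d [rho [d0 rhoS rhoE]]] := scaled_delta_in_span D.
pose C2 := (D.+1 * (D.+1 * (C1 * D.+1 ^ D)))%N.
(* The residual has radius B + C2 H^D + |d|: C2 H^D comes from the lower nodes of the base, |d| from
   the remainders outside [J]. Together with H^D this is at most (C2 + |d| + 2)(B + H^D). *)
exists (C1 * (C2 + absz d).+2)%N => H B W m s1 s2 H0 JD HW mE mb.
pose M := (H ^ D.+1)%N.
have M0 : (0 < M)%N by rewrite expn_gt0 H0.
pose low j := \sum_(i < D.+1) \sum_(q < D.+1) (C1 * H ^ D)%N%:Z * ((i.+1 * H ^ q)%N%:Z) ^+ j.
pose top j := \sum_(i < D.+1) (W i)%:Z * ((i.+1 * M)%N%:Z) ^+ j.
pose a j := (psum s1 j - psum s2 j) - (top j + low j).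
have aS : in_span D a.
  apply: in_spanB; first by exists s1, s2.
  apply: in_spanD; apply: in_span_sum => i; last apply: in_span_sum => q;
  by apply: in_spanZ; exact: in_span1.
(* Coordinates in [J] must not move; the others are replaced by their remainder modulo [d]. *)
pose z l := if J l then 0 else (a l %/ d)%Z.
pose p j := a j - \sum_(l < D.+1) z l * rho l j.
have pE j : (j <= D)%N -> p j = if J j then a j else (a j %% d)%Z.
  move=> jD; have jD' : (j < D.+1)%N by [].
  rewrite /p (bigD1 (Ordinal jD')) //= rhoE // eqxx big1 ?addr0; last first.
    move=> l; rewrite -val_eqE /= eq_sym => /negbTE lj; rewrite rhoE // ?lj ?mulr0 //.
    by rewrite -ltnS.
  rewrite /z; case: (J j); first by rewrite mul0r subr0.
  by rewrite {1}(divz_eq (a j) d); ring.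
have pS : in_span D p.
  apply: in_spanB => //; apply: in_span_sum => l; exact: in_spanZ.
have lowb j : (j <= D)%N -> `|low j| <= (C2 * H ^ D)%N%:Z * (M%:Z) ^+ j.
  move=> jD.
  rewrite ger0_norm; last by do 2! apply: sumr_ge0 => ? _; rewrite mulr_ge0 ?exprn_ge0.
  apply: (@le_trans _ _ (\sum_(i < D.+1) \sum_(q < D.+1)
            ((C1 * H ^ D)%N%:Z * ((D.+1 ^ D)%N%:Z * (M%:Z) ^+ j)))).
    apply: ler_sum => i _; apply: ler_sum => q _; apply: ler_wpM2l => //.
    rewrite -!Posz_exp -PoszM lez_nat expnMn leq_mul //.
      apply: (@leq_trans (D.+1 ^ j)%N); last by rewrite leq_pexp2l.
      by have [->//|j0] := posnP j; rewrite leq_exp2r.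
    have [->//|j0] := posnP j.
    by rewrite leq_exp2r // leq_pexp2l // ltnW // ltnS ltnW.
  rewrite !sumr_const !card_ord -mulrnA -mulr_natl natz /C2 !PoszM.
  by rewrite le_eqVlt; apply/orP; left; apply/eqP; ring.
pose B' := (B + C2 * H ^ D + absz d)%N.
have pb j : (j <= D)%N -> `|p j| <= B'%:Z * (M%:Z) ^+ j.
  move=> jD; rewrite pE //.
  have Mj : 1 <= (M%:Z) ^+ j by rewrite -Posz_exp lez_nat expn_gt0 M0.
  have Mj0 : 0 <= (M%:Z) ^+ j by rewrite exprn_ge0.
  case: ifP => Jj.
    rewrite /a opprD addrA -mE //.
    apply: le_trans (ler_normB _ _) _.
    apply: le_trans (lerD (mb _ Jj) (lowb _ jD)) _.
    by rewrite -mulrDl ler_wpM2r // -PoszD lez_nat leq_addr.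
  rewrite ger0_norm ?modz_ge0 //.
  apply: (@le_trans _ _ `|d|); first by rewrite ltW // ltz_mod.
  rewrite -(mulr1 `|d|) -abszE; apply: ler_pM => //.
  by rewrite lez_nat leq_addl.
have [e [e1 e2 e3]] := core H B' p H0 pS pb.
pose mult i q := if (q == D.+1) then (W i)%:Z + e i q else (C1 * H ^ D)%N%:Z + e i q.
have mult0 i q : (i <= D)%N -> (q <= D.+1)%N -> 0 <= mult i q.
  move=> iD qD; rewrite /mult; case: eqP => [->|/eqP qD'].
    have := e2 i; rewrite ler_norml => /andP[+ _].
    have := HW i iD; rewrite -lez_nat => W1 e4.
    rewrite -(subrr (W i)%:Z) lerD2l (le_trans _ e4) // lerN2.
    apply: le_trans W1; rewrite lez_nat -mulnA leq_mul2l; apply/orP; right.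
    have gen (b c dd h : nat) : (0 < h)%N ->
      (b + c * h + dd + h <= (c + dd).+2 * (b + h))%N by move=> h0; nia.
    by apply: gen; rewrite expn_gt0 H0.
  have := e1 i q; rewrite ler_norml -ltnS ltn_neqAle qD' => /(_ qD)/andP[+ _].
  by rewrite -subr_ge0 opprK addrC.
exists (flatten [seq flatten [seq nseq (absz (mult i q)) (i.+1 * H ^ q)%N
     | q <- index_iota 0 D.+2] | i <- index_iota 0 D.+1]).
  apply/allP => x /flattenP[s /mapP[i _ ->]] /flattenP[t /mapP[q _ ->]].
  by rewrite mem_nseq => /andP[_ /eqP ->]; rewrite muln_gt0 expn_gt0 H0.
move=> j Jj; have jD := JD j Jj.
rewrite (psum_multiplicities _ _ (fun i q => absz (mult i q)) (fun i q => i.+1 * H ^ q)%N).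
have -> : m j = p j + (top j + low j) by rewrite pE // Jj /a subrK mE.
rewrite e3 // /top /low -!big_split /=; apply: eq_bigr => i _.
rewrite big_ord_recr [\sum_(q < D.+2) e i q * _]big_ord_recr /=.
have iD : (i <= D)%N by rewrite -ltnS.
rewrite gez0_abs ?mult0 // {2}/mult eqxx.
rewrite -/M.
have -> : \sum_(q < D.+1) (absz (mult i q))%:Z * ((i.+1 * H ^ q)%N%:Z) ^+ j =
  \sum_(q < D.+1) e i q * ((i.+1 * H ^ q)%N%:Z) ^+ j +
  \sum_(q < D.+1) (C1 * H ^ D)%N%:Z * ((i.+1 * H ^ q)%N%:Z) ^+ j.
  rewrite -big_split /=; apply: eq_bigr => q _.
  rewrite gez0_abs ?mult0 // 1?ltnW // /mult (ltn_eqF (ltn_ord q)).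
  by ring.
by ring.
Qed.

(** * Chernoff bounds for geometric multiplicities *)

Section Chernoff.
Variable R : realType.
Implicit Types q y v : R.

Lemma inv_sub1_le_expR v : v <= 2^-1 -> (1 - v)^-1 <= expR (v + 2 * v ^+ 2).
Proof.
move=> v2; have v1 : 0 < 1 - v by lra.
rewrite -[_^-1]mul1r ler_pdivrMr //.
apply: (@le_trans _ _ ((1 + (v + 2 * v ^+ 2)) * (1 - v))); last first.
  by rewrite ler_pM2r // expR_ge1Dx.
have -> : (1 + (v + 2 * v ^+ 2)) * (1 - v) = 1 + v ^+ 2 * (1 - 2 * v) by ring.
by rewrite lerDl mulr_ge0 ?sqr_ge0 //; lra.
Qed.

Lemma expRB1_le y : expR y - 1 <= y * expR y.
Proof.
have := expR_ge1Dx (- y); rewrite expRN => H.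
have e0 := expR_gt0 y.
have : (1 - y) * expR y <= 1 by rewrite -ler_pdivlMr // mul1r.
lra.
Qed.

Lemma expRB1_abs y : `|expR y - 1| <= `|y| * expR `|y|.
Proof.
rewrite ler_norml; have e0 := expR_gt0 y; have e1 := expR_gt0 `|y|.
have n0 := normr_ge0 y; have ey : expR y <= expR `|y| by rewrite ler_expR ler_norm.
apply/andP; split.
  have := expR_ge1Dx y; have : 1 <= expR `|y| by rewrite -expR0 ler_expR.
  have := ler_norm (- y); rewrite normrN => *; nra.
apply: le_trans (expRB1_le y) _.
by apply: (@le_trans _ _ (`|y| * expR y)); rewrite ?ler_wpM2r ?ler_wpM2l ?ler_norm // ltW.
Qed.

Lemma expRB1B_le y : expR y - 1 - y <= y ^+ 2 * expR `|y|.
Proof.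
have e0 := expR_gt0 y; have e1 := expR_gt0 `|y|.
have [y0|y0] := leP 0 y.
  have := expRB1_le y; rewrite ger0_norm // => H.
  have : y * (expR y - 1) <= y * (y * expR y) by rewrite ler_wpM2l.
  by rewrite expr2; lra.
have := expRB1_le y => H.
have : 1 <= expR `|y| by rewrite -expR0 ler_expR.
have := expR_ge1Dx y => H1 H2.
have : y * expR y - y <= y ^+ 2 by nra.
have : y ^+ 2 <= y ^+ 2 * expR `|y| by rewrite ler_peMr // sqr_ge0.
by lra.
Qed.

(** With E = e^(q/2) this says q <= 2(E - 1/E), which follows from E >= 1 + q/2 and 1/E <= 1. It
    tames the pole of the geometric mean 1/(e^q - 1) at q = 0 while keeping exponential decay. *)
Lemma mul_bose_le q : 0 < q -> q / (expR q - 1) <= 2 * expR (- (q / 2)).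
Proof.
move=> q0; have e1 : 0 < expR q - 1 by rewrite subr_gt0 expR_gt1.
rewrite ler_pdivrMr //.
have -> : expR q = expR (q / 2) * expR (q / 2) by rewrite -expRD -splitr.
rewrite expRN; have := expR_ge1Dx (q / 2); have := expR_gt0 (q / 2).
set E := expR _ => E0 E1.
have -> : 2 * E^-1 * (E * E - 1) = 2 * (E - E^-1) by field; exact: lt0r_neq0.
have : E^-1 <= 1 by rewrite invf_le1 //; lra.
lra.
Qed.

(** Second-order bound for the logarithmic moment generating function of a geometric variable of
    ratio e^(-q), whose mean is 1/(e^q - 1). The generating function is 1/(1 - v) with v = (e^y -
    1)/(e^q - 1). Measuring y against q rather than against 1 makes the error uniform as q tends to
    0. The constant 24 is 16 from v - y/(e^q - 1) plus twice 4 from 2 v^2. *)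
Lemma tilt_ratio_le q y (k : R) : 0 < q -> 0 <= k -> k <= 4^-1 -> `|y| <= k * q ->
  (1 - expR (y - q))^-1 <=
  (1 - expR (- q))^-1 * expR (y / (expR q - 1) + 24 * k ^+ 2 * expR (- (q / 8))).
Proof.
move=> q0 k0 k4 yk.
have e1 : 0 < expR q - 1 by rewrite subr_gt0 expR_gt1.
have e0 : 0 < expR (q / 2) by exact: expR_gt0.
pose b := (expR q - 1)^-1; have b0 : 0 < b by rewrite invr_gt0.
pose v := (expR y - 1) * b.
have qb : q * b <= 2 * expR (- (q / 2)) by exact: mul_bose_le.
have yq : `|y| <= q / 4 by apply: le_trans yk _; rewrite mulrC ler_wpM2l // ltW.
have v2 : v <= 2^-1.
  have : expR y <= expR (q / 2) by rewrite ler_expR (le_trans (ler_norm _)) //; lra.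
  have Eq : expR q = expR (q / 2) * expR (q / 2) by rewrite -expRD -splitr.
  rewrite /v ler_pdivrMr // Eq => H.
  have := expR_ge1Dx (q / 2) => H5.
  have := sqr_ge0 (expR (q / 2) - 1); lra.
have -> : (1 - expR (y - q)) = (1 - expR (- q)) * (1 - v).
  rewrite /v /b expRD !expRN; have := expR_gt0 q; move: e1.
  set E := expR q => E1 E0; field; apply/andP; split; exact: lt0r_neq0.
have q1 : 0 < 1 - expR (- q) by rewrite subr_gt0 expR_lt1 oppr_lt0.
rewrite invfM ler_wpM2l ?invr_ge0 ?(ltW q1) //.
apply: le_trans (inv_sub1_le_expR _ v2) _; rewrite ler_expR.
have ey : expR `|y| <= expR (q / 4) by rewrite ler_expR.
have ey0 := expR_gt0 `|y|.
have H1 : v - y * b <= y ^+ 2 * expR (q / 4) * b.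
  rewrite /v -mulrBl ler_wpM2r ?(ltW b0) //.
  apply: le_trans (expRB1B_le y) _; by rewrite ler_wpM2l ?sqr_ge0.
have H2 : v ^+ 2 <= y ^+ 2 * expR (q / 2) * b ^+ 2.
  rewrite /v exprMn ler_wpM2r ?sqr_ge0 // -real_normK ?num_real //.
  apply: (@le_trans _ _ ((`|y| * expR `|y|) ^+ 2)).
    by rewrite ler_sqr ?nnegrE ?expRB1_abs // mulr_ge0 // ltW.
  rewrite exprMn real_normK ?num_real // ler_wpM2l ?sqr_ge0 //.
  rewrite (_ : q / 2 = q / 4 + q / 4); last by field.
  by rewrite expRD -expr2 ler_sqr ?nnegrE ?expR_ge0.
have y2 : y ^+ 2 <= (k * q) ^+ 2.
  by rewrite -real_normK ?num_real // ler_sqr ?nnegrE // mulr_ge0 // ltW.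
have E8 : 0 < expR (- (q / 8)) := expR_gt0 _.
have H3 : y ^+ 2 * expR (q / 4) * b <= 16 * k ^+ 2 * expR (- (q / 8)).
  apply: (@le_trans _ _ ((k * q) ^+ 2 * expR (q / 4) * b)).
    by rewrite ler_wpM2r ?(ltW b0) // ler_wpM2r ?expR_ge0.
  have -> : (k * q) ^+ 2 * expR (q / 4) * b = k ^+ 2 * (q * expR (q / 4)) * (q * b) by ring.
  apply: (@le_trans _ _ (k ^+ 2 * (q * expR (q / 4)) * (2 * expR (- (q / 2))))).
    by rewrite ler_wpM2l // !mulr_ge0 ?sqr_ge0 ?expR_ge0 // ltW.
  have q8 : q <= 8 * expR (q / 8) by have := expR_ge1Dx (q / 8); lra.
  have -> : expR (- (q / 8)) = expR (q / 8) * expR (q / 4) * expR (- (q / 2)).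
    by rewrite -!expRD; congr expR; field.
  have P : 0 <= k ^+ 2 * expR (q / 4) * expR (- (q / 2)) by rewrite !mulr_ge0 ?sqr_ge0 ?expR_ge0.
  nra.
have H4 : y ^+ 2 * expR (q / 2) * b ^+ 2 <= 4 * k ^+ 2 * expR (- (q / 8)).
  apply: (@le_trans _ _ ((k * q) ^+ 2 * expR (q / 2) * b ^+ 2)).
    by rewrite ler_wpM2r ?sqr_ge0 // ler_wpM2r ?expR_ge0.
  have -> : (k * q) ^+ 2 * expR (q / 2) * b ^+ 2 = k ^+ 2 * expR (q / 2) * (q * b) ^+ 2 by ring.
  apply: (@le_trans _ _ (k ^+ 2 * expR (q / 2) * (2 * expR (- (q / 2))) ^+ 2)).
    rewrite ler_wpM2l ?mulr_ge0 ?sqr_ge0 ?expR_ge0 //.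
    by rewrite ler_sqr ?nnegrE ?mulr_ge0 ?expR_ge0 // ltW.
  have -> : k ^+ 2 * expR (q / 2) * (2 * expR (- (q / 2))) ^+ 2 = 4 * k ^+ 2 * expR (- (q / 2)).
    by rewrite expRN; field; exact: lt0r_neq0.
  by rewrite ler_wpM2l ?mulr_ge0 ?sqr_ge0 // ler_expR; lra.
rewrite -/b; lra.
Qed.

Lemma geometric_sum_le (r : R) (n : nat) : 0 <= r -> r < 1 ->
  \sum_(i < n) r ^+ i <= (1 - r)^-1.
Proof.
move=> r0 r1; have r1' : 0 < 1 - r by rewrite subr_gt0.
rewrite -[X in _ <= X]mul1r ler_pdivlMr // mulrC -(opprB r 1) mulNr -subrX1 opprB.
by rewrite gerBl exprn_ge0.
Qed.

Lemma geometric_sumE (r : R) (n : nat) : r < 1 ->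
  \sum_(i < n) r ^+ i = (1 - r ^+ n) * (1 - r)^-1.
Proof.
move=> r1; have r1' : 1 - r != 0 by rewrite lt0r_neq0 // subr_gt0.
apply: (mulIf r1'); rewrite mulfVK // mulrC -(opprB r 1) mulNr -subrX1 opprB.
by [].
Qed.

Section Product.
Variables (X K : nat) (A : pred 'I_X) (q : 'I_X -> R).
Hypothesis q_gt0 : forall x, 0 < q x.

(** A part outside [A] has ratio 0; as 0^0 = 1, its multiplicity 0 keeps weight 1 and all others get
    0. The laws with and without forbidden parts thus share one configuration space. *)
Definition tilt (x : 'I_X) : R := if A x then expR (- q x) else 0.

Definition weight (z : 'I_X -> R) (k : {ffun 'I_X -> 'I_K.+1}) : R := \prod_x z x ^+ k x.

Lemma tilt_ge0 x : 0 <= tilt x.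
Proof. by rewrite /tilt; case: (A x); rewrite ?expR_ge0. Qed.

Lemma tilt_lt1 x : tilt x < 1.
Proof. by rewrite /tilt; case: (A x); rewrite ?ltr01 // expR_lt1 oppr_lt0. Qed.

(** Exponential Markov inequality: the indicator of a <= S is at most e^(S - a), after which the sum
    factorises over the parts. Weights are not normalised; truncation at [K] only shortens the
    geometric series, so the untruncated normalisation is an upper bound. *)
Lemma chernoff (g : 'I_X -> R) (k a : R) : 0 <= k -> k <= 4^-1 ->
  (forall x, `|g x| <= k * q x) ->
  \sum_(f : {ffun 'I_X -> 'I_K.+1} | a <= \sum_x (f x)%:R * g x) weight tilt f <=
  (\prod_x (1 - tilt x)^-1) *
  expR (\sum_(x | A x) (g x / (expR (q x) - 1) + 24 * k ^+ 2 * expR (- (q x / 8))) - a).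
Proof.
move=> k0 k4 gk.
apply: (@le_trans _ _ (\sum_(f : {ffun 'I_X -> 'I_K.+1})
   (weight tilt f * expR (\sum_x (f x)%:R * g x)) * expR (- a))).
  rewrite [X in _ <= X](bigID (fun f : {ffun 'I_X -> 'I_K.+1} => a <= \sum_x (f x)%:R * g x)) /=.
  rewrite -[X in X <= _]addr0 lerD //.
    apply: ler_sum => f af; rewrite -mulrA -expRD ler_peMr //.
      by apply: prodr_ge0 => x _; rewrite exprn_ge0 ?tilt_ge0.
    by have := expR_ge1Dx (\sum_x (f x)%:R * g x - a); lra.
  apply: sumr_ge0 => f _; rewrite !mulr_ge0 ?expR_ge0 //.
  by apply: prodr_ge0 => x _; rewrite exprn_ge0 ?tilt_ge0.
rewrite -mulr_suml expRD mulrA ler_wpM2r ?expR_ge0 //.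
have -> : \sum_(f : {ffun 'I_X -> 'I_K.+1}) (weight tilt f * expR (\sum_x (f x)%:R * g x)) =
   \prod_x \sum_(l : 'I_K.+1) (tilt x * expR (g x)) ^+ l.
  rewrite bigA_distr_bigA; apply: eq_bigr => f _.
  rewrite expR_sum /weight -big_split /=; apply: eq_bigr => x _.
  by rewrite exprMn -expRM_natl.
rewrite expR_sum [X in _ <= _ * X]big_mkcond -big_split /=.
apply: ler_prod => x _; apply/andP; split.
  by apply: sumr_ge0 => l _; rewrite exprn_ge0 // mulr_ge0 ?tilt_ge0 ?expR_ge0.
rewrite /tilt; case: ifP => Ax.
  have gx : g x < q x.
    apply: le_lt_trans (ler_norm _) _; apply: le_lt_trans (gk x) _.
    by have := q_gt0 x; nra.
  rewrite -expRD addrC; apply: le_trans (tilt_ratio_le _ _ _ (q_gt0 x) k0 k4 (gk x)).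
  by apply: geometric_sum_le; rewrite ?expR_ge0 // expR_lt1 subr_lt0.
by rewrite mul0r subr0 invr1 mulr1; apply: le_trans (geometric_sum_le _ _ _ _) _;
   rewrite ?ltr01 // subr0 invr1.
Qed.

Lemma prodB_ge (I : Type) (r : seq I) (a : I -> R) :
  (forall i, 0 <= a i <= 1) -> 1 - \sum_(i <- r) a i <= \prod_(i <- r) (1 - a i).
Proof.
move=> a01; elim: r => [|i r IH]; first by rewrite !big_nil subr0.
rewrite !big_cons; have /andP[a0 a1] := a01 i.
apply: (@le_trans _ _ ((1 - a i) * (1 - \sum_(j <- r) a j))).
  have : 0 <= \sum_(j <- r) a j by apply: sumr_ge0 => j _; case/andP: (a01 j).
  nra.
by rewrite ler_wpM2l // subr_ge0.
Qed.

(** Truncating the multiplicities loses at most half of the mass: the relative loss is at most the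
    sum of the geometric tails, and e^(-(K+1)q) <= 1/((K+1)q). *)
Lemma total_weight_ge : 2 * \sum_x (q x)^-1 <= K.+1%:R ->
  2^-1 * \prod_x (1 - tilt x)^-1 <= \sum_f weight tilt f.
Proof.
move=> HK.
have -> : \sum_f weight tilt f = \prod_x \sum_(l : 'I_K.+1) tilt x ^+ l.
  by rewrite bigA_distr_bigA.
under [X in _ <= X]eq_bigr => x _ do rewrite geometric_sumE ?tilt_lt1 //.
rewrite big_split /= ler_wpM2r //.
  by apply: prodr_ge0 => x _; rewrite invr_ge0 subr_ge0 ltW ?tilt_lt1.
apply: (@le_trans _ _ (1 - \sum_x tilt x ^+ K.+1)); last first.
  by apply: prodB_ge => x; rewrite exprn_ge0 ?tilt_ge0 //= exprn_ile1 ?tilt_ge0 // ltW ?tilt_lt1.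
have K0 : 0 < K.+1%:R :> R by rewrite ltr0n.
suff : \sum_x tilt x ^+ K.+1 <= (\sum_x (q x)^-1) / K.+1%:R.
  move=> H; have H' : (\sum_x (q x)^-1) / K.+1%:R <= 2^-1.
    by rewrite ler_pdivrMr //; lra.
  rewrite lerBrDr -lerBrDl; apply: le_trans H _; apply: le_trans H' _; lra.
rewrite mulr_suml; apply: ler_sum => x _; rewrite /tilt; case: ifP => _; last first.
  by rewrite expr0n /= divr_ge0 // invr_ge0 ltW.
rewrite -expRM_natl mulrN expRN -invfM [q x * _]mulrC lef_pV2 ?posrE ?expR_gt0 ?mulr_gt0 //.
by have := expR_ge1Dx (K.+1%:R * q x); lra.
Qed.

End Product.
End Chernoff.

(** * Riemann sums *)

Section Riemann.
Variable R : realType.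
Local Notation mu := (@lebesgue_measure R).
Implicit Types (f : R -> R) (s : R).

(** The intervals may overlap, so besides Riemann sums this covers stacks of layers under a pole. *)
Definition step_fun (m : nat) (a l r : nat -> R) s : R :=
  \sum_(i < m) a i * \1_(`]l i, r i]%classic : set R) s.

Lemma integrable_step_fun_term (a l r : R) :
  mu.-integrable `]0%R, +oo[ (fun s => (a * \1_(`]l, r]%classic : set R) s)%:E).
Proof.
have -> : (fun s => (a * \1_(`]l, r]%classic : set R) s)%:E) =
          (fun s => (a%:E * (EFin \o (\1_(`]l, r]%classic : set R) : R -> R)) s)%E).
  by apply/funext => s; rewrite EFinM.
apply: integrableZl; first exact: measurable_itv.
apply: (@integrableS _ _ _ _ setT) => //.
exact: integrable_indic_itv.
Qed.

Lemma step_fun_EFin m a l r :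
  (fun s => (step_fun m a l r s)%:E) =
  (fun s => \sum_(i < m) (a i * \1_(`]l i, r i]%classic : set R) s)%:E)%R.
Proof. by apply/funext => s; rewrite /step_fun sumEFin. Qed.

Lemma integrable_step_fun m a l r :
  mu.-integrable `]0%R, +oo[ (fun s => (step_fun m a l r s)%:E).
Proof.
rewrite step_fun_EFin; apply: integrable_sum => // i _.
exact: integrable_step_fun_term.
Qed.

Lemma integral_step_fun m a l r : (forall i, 0 <= l i) -> (forall i, l i <= r i) ->
  (\int[mu]_(s in `]0%R, +oo[) (step_fun m a l r s)%:E =
   (\sum_(i < m) a i * (r i - l i))%:E)%E.
Proof.
move=> l0 lr; rewrite step_fun_EFin integral_sum //; last first.
  by move=> i; exact: integrable_step_fun_term.
rewrite -sumEFin; apply: eq_bigr => i _.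
under eq_integral do rewrite EFinM.
rewrite integralZl //; last first.
  apply: (@integrableS _ _ _ _ setT) => //; exact: integrable_indic_itv.
rewrite integral_indic // (_ : _ `&` _ = `]l i, r i]%classic); last first.
  apply/seteqP; split => [x [] //|x /=]; rewrite !in_itv /= andbT => /andP[lx xr].
  by rewrite lx xr; split => //; apply: le_lt_trans lx.
rewrite /= lebesgue_measure_itv /= lte_fin; case: ltP => [lri|rli].
  by rewrite -EFinB -EFinM.
by rewrite mule0 (_ : r i = l i) ?subrr ?mulr0 //; apply/eqP; rewrite eq_le lr rli.
Qed.

Lemma integrable_expR_decay (C c : R) : 0 < c ->
  mu.-integrable `]0%R, +oo[ (fun s => (C * expR (- c * s))%:E).
Proof.
move=> c0.
apply: eq_integrable; first exact: measurable_itv; last first.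
  apply: (integrableZl _ (C / c)); first exact: measurable_itv.
  apply: (@integrableS _ _ _ _ setT) => //.
  exact: (integrable_exponential_pdf c0).
move=> s; rewrite inE /= in_itv /= andbT => s0.
by rewrite exponential_pdfE ?ltW // -EFinM mulrA divfK // lt0r_neq0.
Qed.

Lemma cell_index (y : R) : 0 < y -> exists i : nat, i%:R < y /\ y <= i.+1%:R.
Proof.
move=> y0; have ex : exists n : nat, y <= n%:R.
  by exists (Num.bound y); apply/ltW/archi_boundP/ltW.
have [m ym mmin] := ex_minnP ex.
case: m ym mmin => [|m] ym mmin; first by rewrite leNgt y0 in ym.
exists m; split=> //; rewrite ltNge; apply/negP => /mmin; by rewrite ltnn.
Qed.

Lemma step_cell f (m n : nat) s : (0 < n)%N -> 0 < s ->
  exists (i : nat) (y : R), [/\ s <= y, y < s + (Num.sqrt n%:R)^-1, i%:R < s * Num.sqrt n%:R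
    & step_fun m (fun i => f (i.+1%:R / Num.sqrt n%:R)) (fun i => i%:R / Num.sqrt n%:R)
        (fun i => i.+1%:R / Num.sqrt n%:R) s = if (i < m)%N then f y else 0].
Proof.
move=> n0 s0; set w := Num.sqrt n%:R.
have w0 : 0 < w by rewrite sqrtr_gt0 ltr0n.
have [i [iy yi]] := cell_index (s * w) (mulr_gt0 s0 w0).
exists i, (i.+1%:R / w); split=> //.
- by rewrite ler_pdivlMr.
- rewrite ltr_pdivrMr // mulrDl mulVf ?lt0r_neq0 // -natr1.
  by rewrite ltrD2r.
have indE (k : nat) : \1_(`]k%:R / w, k.+1%:R / w]%classic : set R) s = (k == i)%:R.
  rewrite indicE; congr (nat_of_bool _)%:R; apply/idP/idP.
    rewrite inE /= in_itv /= ltr_pdivrMr // ler_pdivlMr // => /andP[ks sk].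
    have := lt_le_trans ks yi; have := lt_le_trans iy sk.
    by rewrite !ltr_nat !ltnS => *; apply/eqP/anti_leq/andP.
  by move=> /eqP ->; rewrite inE /= in_itv /= ltr_pdivrMr // ler_pdivlMr // iy yi.
rewrite /step_fun; under eq_bigr do rewrite indE.
case: ltnP => im.
  rewrite (bigD1 (Ordinal im)) //= eqxx mulr1 big1 ?addr0 // => j.
  by rewrite -val_eqE /= => /negbTE ->; rewrite mulr0.
rewrite big1 // => j _; rewrite (ltn_eqF (leq_trans (ltn_ord j) im)) mulr0 //.
Qed.

(* Cells are sampled at their right end, so right-continuity of f is enough. *)
Lemma riemann_sum_cvg f (C c : R) (X : nat -> nat) :
  0 < c -> (forall s, 0 < s -> `|f s| <= C * expR (- c * s)) ->
  (forall (s e : R), 0 < s -> 0 < e -> exists2 d : R, 0 < d &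
     forall y, s <= y -> y < s + d -> `|f y - f s| <= e) ->
  (forall n, (n <= X n)%N) ->
  mu.-integrable `]0%R, +oo[ (fun s => (f s)%:E) /\
  (\sum_(i < X n) f (i.+1%:R / Num.sqrt n%:R) / Num.sqrt n%:R) @[n --> \oo] -->
  fine (\int[mu]_(s in `]0%R, +oo[) (f s)%:E)%E.
Proof.
move=> c0 fb frc nX.
pose w n : R := Num.sqrt n%:R.
pose g n := step_fun (X n) (fun i => f (i.+1%:R / w n)) (fun i => i%:R / w n)
        (fun i => i.+1%:R / w n).
have wge n : 0 <= w n by exact: sqrtr_ge0.
have intg n : (\int[mu]_(s in `]0%R, +oo[) (g n s)%:E =
    (\sum_(i < X n) f (i.+1%:R / w n) / w n)%:E)%E.
  rewrite integral_step_fun; first last.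
  - by move=> i; rewrite ler_wpM2r ?invr_ge0 // ler_nat.
  - by move=> i; rewrite divr_ge0.
  congr (_%:E); apply: eq_bigr => i _; congr (_ * _).
  by rewrite -mulrBl -natr1 addrAC subrr add0r mul1r.
have C0 : 0 <= C.
  have := fb 1 ltr01; have := expR_gt0 (- c * 1) => E0 H.
  by rewrite -(pmulr_lge0 _ E0) (le_trans _ H).
(* Sampling to the right of s can only decrease the envelope, so one exponential dominates all the
   step functions. *)
have gb n s : `]0%R, +oo[%classic s -> (`|(g n s)%:E| <= (C * expR (- c * s))%:E)%E.
  rewrite /= in_itv /= andbT => s0; rewrite lee_fin.
  have E0 : 0 <= C * expR (- c * s) by rewrite mulr_ge0 ?expR_ge0.
  (* For n = 0 the mesh is the inverse of 0, which is 0, and all cells are empty. *)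
  have [n0|n0] := posnP n.
    have w0 : w n = 0 by rewrite /w n0 sqrtr0.
    rewrite /g /step_fun big1 ?normr0 // => i _.
    rewrite w0 invr0 !mulr0 indicE (_ : _ \in _ = false) ?mulr0 //.
    apply/negbTE/negP; rewrite inE /= in_itv /= => /andP[H1 H2].
    by have := lt_le_trans H1 H2; rewrite ltxx.
  have [i [y [sy _ _]]] := step_cell f (X n) n s n0 s0; rewrite -/(w n) -/(g n s) => ->.
  case: ifP => _; last by rewrite normr0.
  apply: le_trans (fb y (lt_le_trans s0 sy)) _; rewrite ler_wpM2l // ler_expR.
  by rewrite !mulNr lerN2 ler_wpM2l // ltW.
have cvgg s : `]0%R, +oo[%classic s -> (g n s)%:E @[n --> \oo] --> (f s)%:E.
  rewrite /= in_itv /= andbT => s0; apply: cvg_EFin; first by apply: nearW.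
  apply/cvgrPdist_le => e e0.
  have [d d0 fd] := frc s e s0 e0.
  near=> n.
  have n0 : (0 < n)%N by near: n; exists 1%N.
  have w0 : 0 < w n by rewrite sqrtr_gt0 ltr0n.
  have [i [y [sy yw isw]]] := step_cell f (X n) n s n0 s0; rewrite -/(w n) -/(g n s) /= => ->.
  (* sqrt n > s puts s among the first X n cells, since s sqrt n < n <= X n; sqrt n > 1/d makes the
     mesh finer than d. *)
  have nbig : (s + d^-1) ^+ 2 < n%:R.
    near: n; exists (Num.bound ((s + d^-1) ^+ 2)) => // n /= Hn.
    by apply: lt_le_trans (archi_boundP (sqr_ge0 _)) _; rewrite ler_nat.
  have wbig : s + d^-1 < w n.
    by rewrite -(@ltr_pXn2r _ 2) ?nnegrE ?addr_ge0 ?invr_ge0 ?ltW // sqr_sqrtr // ltW.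
  have dV : 0 < d^-1 by rewrite invr_gt0.
  have iX : (i < X n)%N.
    rewrite (leq_trans _ (nX n)) // -(ltr_nat R) (lt_trans isw) //.
    have nw : n%:R = w n * w n by rewrite -expr2 sqr_sqrtr.
    rewrite -/(w n) nw ltr_pM2r //.
    by apply: le_lt_trans wbig; rewrite lerDl ltW.
  rewrite iX distrC; apply: fd => //; apply: lt_le_trans yw _; rewrite lerD2l.
  rewrite -[d]invrK lef_pV2 ?posrE //.
  by apply: ltW; apply: le_lt_trans wbig; rewrite lerDr ltW.
have ig := integrable_expR_decay C c c0.
have cv : ((\int[mu]_(s in `]0%R, +oo[) (g n s)%:E)%E @[n --> \oo] -->
           (\int[mu]_(s in `]0%R, +oo[) (f s)%:E)%E).
  apply: (@dominated_cvg _ _ _ mu _ _ _ _ (fun s => (C * expR (- c * s))%:E)).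
  - exact: measurable_itv.
  - by move=> n; have /integrableP[] := integrable_step_fun (X n)
      (fun i => f (i.+1%:R / w n)) (fun i => i%:R / w n) (fun i => i.+1%:R / w n).
  - exact: cvgg.
  - by [].
  - exact: ig.
  - exact: gb.
have fi : mu.-integrable `]0%R, +oo[ (fun s => (f s)%:E).
  apply: le_integrable ig; first exact: measurable_itv.
    apply: (emeasurable_fun_cvg (fun n s => (g n s)%:E)) => [n|s s0]; last exact: cvgg.
    by have /integrableP[] := integrable_step_fun (X n)
      (fun i => f (i.+1%:R / w n)) (fun i => i%:R / w n) (fun i => i.+1%:R / w n).
  move=> s /=; rewrite in_itv /= andbT => s0.
  by rewrite lee_fin (le_trans (fb s s0)) // ler_norm.
split=> //.
have fin : (\int[mu]_(s in `]0%R, +oo[) (f s)%:E)%E \is a fin_num.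
  by apply: integrable_fin_num; first exact: measurable_itv.
move: cv; rewrite -(fineK fin) => /fine_cvgP[_].
apply: cvg_trans; apply: near_eq_cvg; apply: nearW => n /=.
by rewrite intg.
Unshelve. all: by end_near.
Qed.

(** Uniformity in X: for each n pick an X violating the bound, if there is one, and apply the
    convergence along that choice. *)
Lemma riemann_sum_unif f (C c : R) :
  0 < c -> (forall s, 0 < s -> `|f s| <= C * expR (- c * s)) ->
  (forall (s e : R), 0 < s -> 0 < e -> exists2 d : R, 0 < d &
     forall y, s <= y -> y < s + d -> `|f y - f s| <= e) ->
  forall e, 0 < e -> exists n0, forall n X, (n0 <= n)%N -> (n <= X)%N ->
  `|\sum_(i < X) f (i.+1%:R / Num.sqrt n%:R) / Num.sqrt n%:R -
    fine (\int[mu]_(s in `]0%R, +oo[) (f s)%:E)%E| <= e.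
Proof.
move=> c0 fb frc e e0.
pose good n X := `|\sum_(i < X) f (i.+1%:R / Num.sqrt n%:R) / Num.sqrt n%:R -
    fine (\int[mu]_(s in `]0%R, +oo[) (f s)%:E)%E| <= e.
have ex n : exists x, (n <= x)%N /\ (good n x -> forall Y, (n <= Y)%N -> good n Y).
  have [H|/existsNP[Y /not_implyP[nY bY]]] := pselect (forall Y, (n <= Y)%N -> good n Y).
    by exists n.
  by exists Y.
have [X HX] := choice ex.
have [_ /cvgrPdist_le /(_ e e0) [n0 _ H]] := riemann_sum_cvg f C c X c0 fb frc (fun n => (HX n).1).
exists n0 => n Y n0n nY; apply: (HX n).2 => //.
by rewrite /good distrC; apply: H.
Qed.

End Riemann.

(** * The energy polynomial *)

Section Energy.
Variable R : realType.
Implicit Types (f : R -> R) (s : R) (p : {poly R}).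
Local Notation mu := (@lebesgue_measure R).

Lemma continuous_dist f s : {for s, continuous f} -> forall e : R, 0 < e ->
  exists2 d : R, 0 < d & forall y, `|y - s| < d -> `|f y - f s| < e.
Proof.
move=> cf e e0; have /cvgrPdist_lt /(_ e e0) := cf.
move=> /nbhs_ballP[d /= d0 H]; exists d => // y yd.
by rewrite distrC; apply: H; rewrite /ball /= distrC.
Qed.

Lemma horner_bound p (B : R) : exists2 L : R, 0 < L & forall s, `|s| <= B -> `|p.[s]| <= L.
Proof.
exists (1 + \sum_(i < size p) `|p`_i| * `|B| ^+ i).
  by rewrite ltr_pwDl // sumr_ge0 // => i _; rewrite mulr_ge0 // exprn_ge0.
move=> s sB; rewrite horner_coef; apply: le_trans (ler_norm_sum _ _ _) _.
rewrite ler_wpDl //; apply: ler_sum => i _; rewrite normrM ler_wpM2l // normrX.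
by rewrite lerXn2r ?nnegrE // (le_trans sB) // ler_norm.
Qed.

(** The tool for refuting integrability: it suffices to place below |f| step functions of
    arbitrarily large mass. The bound [I] is the L1 norm of f. *)
Lemma step_fun_mass_bound f : mu.-integrable `]0%R, +oo[ (fun s => (f s)%:E) ->
  exists I : R, forall m a l r, (forall i, 0 <= l i) -> (forall i, l i <= r i) ->
    (forall s, 0 < s -> 0 <= step_fun R m a l r s <= `|f s|) ->
    \sum_(i < m) a i * (r i - l i) <= I.
Proof.
move=> fi.
have nfi := integrable_abse fi.
have fin : (\int[mu]_(s in `]0%R, +oo[) (abse \o (fun s => (f s)%:E)) s)%E \is a fin_num.
  by apply: integrable_fin_num => //; exact: measurable_itv.
exists (fine (\int[mu]_(s in `]0%R, +oo[) (abse \o (fun s => (f s)%:E)) s)%E).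
move=> m a l r l0 lr H; rewrite -lee_fin fineK // -integral_step_fun //.
apply: ge0_le_integral; first exact: measurable_itv.
- by move=> s /=; rewrite in_itv /= andbT => /H /andP[H1 _]; rewrite lee_fin.
- by have /integrableP[] := integrable_step_fun R m a l r.
- by have /integrableP[] := nfi.
- by move=> s /=; rewrite in_itv /= andbT => /H /andP[_ H1]; rewrite lee_fin.
Qed.

(** Layer i has height 2^i on a set of length 2^(-i), hence mass 1: m layers have mass m yet stay
    below 2/u. This is the divergence of the integral of 1/u at 0. *)
Lemma dyadic_layers (m : nat) (u : R) : 0 < u ->
  \sum_(i < m) (if u <= 2 ^- i then (2 : R) ^+ i else 0) <= 2 / u.
Proof.
move=> u0; elim: m => [|m IH]; first by rewrite big_ord0 divr_ge0 // ltW.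
rewrite big_ord_recr /=; case: ifP => um; last by rewrite addr0.
apply: (@le_trans _ _ (2 * 2 ^+ m)); last first.
  by rewrite ler_wpM2l // -[X in X <= _]invrK lef_pV2 ?posrE ?invr_gt0 ?exprn_gt0.
rewrite mulr2n mulrDl !mul1r lerD2r.
apply: (@le_trans _ _ (\sum_(i < m) (2 : R) ^+ i)).
  by apply: ler_sum => i _; case: ifP => // _; rewrite exprn_ge0.
have := subrX1 (2 : R) m; rewrite (_ : 2 - 1 = 1 :> R) ?mul1r; last by ring.
by move=> <-; rewrite gerBl.
Qed.

Variables (J : {fset nat}) (alpha beta : nat -> R).
Hypothesis JP : profile_set J.
Hypothesis HA : assumption1 J alpha beta.

Definition energy s : R := \sum_(l <- J) beta l * s ^+ l.

Lemma energy_horner s : energy s = (\sum_(l <- J) beta l *: 'X^l).[s].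
Proof.
rewrite horner_sum; apply: eq_bigr => l _.
by rewrite hornerZ hornerXn.
Qed.

Lemma continuous_energy : continuous energy.
Proof.
have -> : energy = horner (\sum_(l <- J) beta l *: 'X^l).
  by apply/funext => s; rewrite energy_horner.
exact: continuous_horner.
Qed.

Lemma max_degree : exists D : nat, [/\ (0 < D)%N, D \in J & forall j, j \in J -> (j <= D)%N].
Proof.
have [j0 j0J j00] := JP.
have ex : exists j, j \in J by exists j0.
have ub j : j \in J -> (j <= \sum_(i <- J) i)%N.
  by move=> jJ; rewrite (big_rem j jJ) /= leq_addr.
have [D DJ DM] := ex_maxnP ex ub; exists D; split => //.
by apply: leq_trans j00 _; exact: DM.
Qed.

Lemma min_degree : exists2 j0 : nat, j0 \in J & forall j, j \in J -> (j0 <= j)%N.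
Proof.
have [j jJ _] := JP; have ex : exists j, j \in J by exists j.
by have [j0 j0J jm] := ex_minnP ex; exists j0.
Qed.

Lemma energy_leading D : (0 < D)%N -> D \in J -> (forall j, j \in J -> (j <= D)%N) ->
  exists2 A : R, 1 <= A & forall s, A <= s -> `|energy s - beta D * s ^+ D| <= `|beta D| / 2 * s ^+ D.
Proof.
move=> D0 DJ Dmax; have b0 : 0 < `|beta D| by rewrite normr_gt0; apply: HA.1.
pose S := \sum_(l <- J) `|beta l|.
have S0 : 0 <= S by apply: sumr_ge0.
exists (1 + 2 * S / `|beta D|); first by rewrite lerDl divr_ge0 ?mulr_ge0.
move=> s sA; have s1 : 1 <= s.
  by apply: le_trans sA; rewrite lerDl divr_ge0 ?mulr_ge0.
have s0 : 0 <= s by apply: le_trans s1.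
have -> : energy s - beta D * s ^+ D = \sum_(l <- rem D J) beta l * s ^+ l.
  by rewrite /energy (big_rem D DJ) /= addrAC subrr add0r.
apply: (@le_trans _ _ (S * s ^+ D.-1)).
  apply: le_trans (ler_norm_sum _ _ _) _.
  apply: (@le_trans _ _ (\sum_(l <- rem D J) `|beta l| * s ^+ D.-1)).
    rewrite big_seq [X in _ <= X]big_seq; apply: ler_sum => l lJ.
    rewrite normrM normrX (ger0_norm s0) ler_wpM2l // ler_weXn2l //.
    have := Dmax l (mem_rem lJ); rewrite leq_eqVlt => /orP[/eqP lD|lD].
      by move: lJ; rewrite lD mem_rem_uniqF // fset_uniq.
    by rewrite -ltnS prednK.
  rewrite -mulr_suml ler_wpM2r ?exprn_ge0 // /S (big_rem D DJ) /= lerDr //.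
have -> : s ^+ D = s * s ^+ D.-1 by rewrite -exprS prednK.
rewrite mulrA ler_wpM2r ?exprn_ge0 //.
have : 2 * S / `|beta D| <= s by apply: le_trans sA; rewrite lerDr.
by rewrite ler_pdivrMr //; lra.
Qed.

(** Convergence of the integral of exponent D = max J forces positivity. A negative leading
    coefficient would make the integrand at least 1 in absolute value near infinity, and a last
    point t > 0 with Q(t) <= 0 would be a zero of Q, hence a non-integrable pole of the
    integrand. *)
Lemma energy_pos s : 0 < s -> 0 < energy s.
Proof.
have [D [D0 DJ Dmax]] := max_degree.
have [A A1 HAs] := energy_leading D D0 DJ Dmax.
have A0 : 0 < A by apply: lt_le_trans A1.
have [I HI] := step_fun_mass_bound _ (HA.2 D DJ).1.
have bD : 0 < beta D.
  rewrite lt_neqAle eq_sym HA.1 //= leNgt; apply/negP => bD.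
  have neg s' : A <= s' -> energy s' < 0.
    move=> As; have := HAs _ As; rewrite ler_norml (ltr0_norm bD) => /andP[_ H].
    have : 0 < s' ^+ D by rewrite exprn_gt0 // (lt_le_trans A0).
    by move: H; set x := s' ^+ D; nra.
  pose m := Num.bound `|I|.
  have mI : I < m%:R.
    exact: le_lt_trans (ler_norm _) (archi_boundP (normr_ge0 _)).
  suff : \sum_(i < 1) 1 * ((A + m%:R) - A) <= I.
    by rewrite big_ord1 mul1r addrAC subrr add0r leNgt mI.
  apply: (HI 1%N (fun _ => 1) (fun _ => A) (fun _ => A + m%:R));
    [by move=> _; exact: ltW|by move=> _; rewrite lerDl|].
  move=> s' s'0; rewrite /step_fun big_ord1 mul1r indicE.
  case: (boolP (_ \in _)) => /=; last by rewrite lexx normr_ge0.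
  rewrite inE /= in_itv /= => /andP[As _]; rewrite ler01 /=.
  have E1 : expR (energy s') < 1 by rewrite expR_lt1; apply/neg/ltW.
  have E0 := expR_gt0 (energy s').
  rewrite /bose -/(energy s') normrM normfV (@ltr0_norm _ (_ - 1)) ?subr_lt0 // opprB.
  rewrite ler_pdivlMr ?subr_gt0 // mul1r ger0_norm ?exprn_ge0 ?(ltW s'0) //.
  apply: (@le_trans _ _ 1); first by rewrite gerBl ltW.
  by apply: exprn_ege1; apply: le_trans A1 _; exact: ltW.
move=> s0'; rewrite ltNge; apply/negP => sneg.
pose S := [set y : R | 0 < y /\ energy y <= 0].
have Ss : S s by [].
have ubS : ubound S A.
  move=> y [y0 yneg]; rewrite leNgt; apply/negP => Ay.
  have := HAs _ (ltW Ay); rewrite ler_norml (gtr0_norm bD) => /andP[H _].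
  have : 0 < y ^+ D by rewrite exprn_gt0.
  by move: H; set x := y ^+ D; nra.
have hS : has_sup S by split; [exists s|exists A].
(* The last point where Q <= 0: to its right Q is positive, and Q(t) = 0 by continuity. *)
pose t := sup S.
have st : s <= t by apply: sup_upper_bound.
have t0 : 0 < t by apply: lt_le_trans st.
have pos y : t < y -> 0 < energy y.
  move=> ty; rewrite ltNge; apply/negP => yneg.
  have : y <= t by apply: sup_upper_bound => //; split=> //; apply: lt_trans ty.
  by rewrite leNgt ty.
have Et : energy t = 0.
  apply/eqP; rewrite eq_le; apply/andP; split; rewrite leNgt; apply/negP => Et.
    have [d d0 Hd] := continuous_dist _ _ (continuous_energy t) _ Et.
    have [y [y0 yneg] yt] := sup_adherent d0 hS.
    have yt' : y <= t by apply: sup_upper_bound.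
    have : `|energy y - energy t| < energy t.
      by rewrite -/t in yt; apply: Hd; rewrite ler0_norm ?subr_le0 //; lra.
    by rewrite ltr_norml => /andP[H _]; lra.
  have nEt : 0 < - energy t by lra.
  have [d d0 Hd] := continuous_dist _ _ (continuous_energy t) _ nEt.
  have : `|energy (t + d / 2) - energy t| < - energy t.
    by apply: Hd; rewrite addrAC subrr add0r ger0_norm; lra.
  rewrite ltr_norml => /andP[_ H].
  have : 0 < energy (t + d / 2) by apply: pos; lra.
  by lra.
have /factor_theorem [p2 Hp2] : root (\sum_(l <- J) beta l *: 'X^l) t.
  by rewrite /root -energy_horner Et eqxx.
have [L L0 HL] := horner_bound p2 (t + 1).
have Elip y : t < y -> y <= t + 1 -> energy y <= L * (y - t).
  move=> ty yt; rewrite energy_horner Hp2 hornerM hornerXsubC.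
  rewrite ler_wpM2r ?subr_ge0 ?(ltW ty) // (le_trans (ler_norm _)) // HL //.
  by rewrite ger0_norm // ltW // (lt_trans t0).
(* For t < y <= t + 1 one has Q(y) <= L(y - t) <= L and e^Q - 1 <= Q e^Q, so y^D/(e^Q - 1) is at
   least c/(y - t). *)
pose c := t ^+ D / (L * expR L).
have c0 : 0 < c by rewrite divr_gt0 ?exprn_gt0 ?mulr_gt0 ?expR_gt0.
have boseb y : t < y -> y <= t + 1 -> c / (y - t) <= bose J beta D y.
  move=> ty yt; have Ey := pos y ty; have u0 : 0 < y - t by rewrite subr_gt0.
  have e1 : 0 < expR (energy y) - 1 by rewrite subr_gt0 expR_gt1.
  rewrite /bose -/(energy y) /c -mulrA -invfM.
  apply: ler_pM.
  - by rewrite exprn_ge0 // ltW.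
  - by rewrite invr_ge0 !mulr_ge0 ?expR_ge0 // ltW.
  - by apply: lerXn2r; rewrite ?nnegrE; apply: ltW => //; apply: lt_trans ty.
  rewrite lef_pV2 ?posrE ?mulr_gt0 ?expR_gt0 //.
  apply: le_trans (expRB1_le R _) _.
  rewrite mulrAC ler_pM ?expR_ge0 ?(ltW Ey) ?Elip // ler_expR.
  apply: le_trans (Elip _ ty yt) _; rewrite ler_piMr ?(ltW L0) //; lra.
pose m := Num.bound `|2 * I / c|.
have mI : 2 * I / c < m%:R.
  exact: le_lt_trans (ler_norm _) (archi_boundP (normr_ge0 _)).
suff : \sum_(i < m) c / 2 * 2 ^+ i * ((t + 2 ^- i) - t) <= I.
  rewrite (eq_bigr (fun _ => c / 2)); last first.
    by move=> i _; rewrite addrAC subrr add0r mulfK // expf_neq0.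
  rewrite sumr_const card_ord -mulr_natr.
  by move: mI; rewrite ltr_pdivrMr // => ? ?; lra.
apply: (HI m (fun i => c / 2 * 2 ^+ i) (fun _ => t) (fun i => t + 2 ^- i)) => [_|i|y y0].
  exact: ltW.
  by rewrite lerDl invr_ge0 exprn_ge0.
have -> : step_fun R m (fun i => c / 2 * 2 ^+ i) (fun _ => t) (fun i => t + 2 ^- i) y =
   c / 2 * \sum_(i < m) (if (t < y) && (y - t <= 2 ^- i) then 2 ^+ i else 0).
  rewrite /step_fun mulr_sumr; apply: eq_bigr => i _.
  rewrite -[LHS]mulrA; congr (_ * _). rewrite indicE (_ : _ \in _ = (t < y) && (y - t <= 2 ^- i)).
    by case: ifP; rewrite ?mulr1 ?mulr0.
  apply/idP/idP; first by rewrite inE /= in_itv /= lerBlDl.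
  by rewrite inE /= in_itv /= lerBlDl.
apply/andP; split.
  apply: mulr_ge0; first by rewrite divr_ge0 // ltW.
  by apply: sumr_ge0 => i _; case: ifP; rewrite ?exprn_ge0.
have [yt|ty] := leP y t.
  by rewrite big1 ?mulr0.
have [yt|yt] := leP y (t + 1).
  apply: (@le_trans _ _ (c / (y - t))); last first.
    by rewrite (le_trans (boseb _ ty yt)) // ler_norm.
  have := dyadic_layers m (y - t); rewrite subr_gt0 => /(_ ty) /=.
  have c2 : 0 < c / 2 by apply: divr_gt0.
  by rewrite -(ler_pM2l c2) => /le_trans; apply; rewrite mulrA divfK.
rewrite big1 ?mulr0 // => i _; rewrite ifF //; apply/negbTE.
rewrite -ltNge; apply: (@le_lt_trans _ _ 1); last by lra.
by rewrite invf_le1 ?exprn_gt0 // exprn_ege1 // ler1n.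
Qed.


(** Q(s) = s^j0 p(s) with j0 = min J, and p is positive on the compact [0, A]; beyond A the leading
    term dominates. The bounds by s^j make the power sums admissible for Chernoff estimates, the
    linear one gives exponential decay. *)
Lemma energy_lower : exists2 c : R, 0 < c &
  (forall s j, 0 <= s -> j \in J -> c * s ^+ j <= energy s) /\
  (forall s, 0 <= s -> c * (s - 1) <= energy s).
Proof.
have [D [D0 DJ Dmax]] := max_degree.
have [j0 j0J j0min] := min_degree.
have [A A1 HAs] := energy_leading D D0 DJ Dmax.
have A0 : 0 < A by apply: lt_le_trans A1.
have bD : 0 < beta D.
  have AD : 0 < A ^+ D by rewrite exprn_gt0.
  rewrite lt_neqAle eq_sym HA.1 //= leNgt; apply/negP => bD.
  have := HAs A (lexx A); rewrite ler_norml (ltr0_norm bD) => /andP[_ H].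
  by have := energy_pos A A0; move: H AD; set x := A ^+ D => *; nra.
pose p : {poly R} := \sum_(l <- J) beta l *: 'X^(l - j0).
have pE s : energy s = s ^+ j0 * p.[s].
  rewrite /p horner_sum mulr_sumr /energy big_seq [RHS]big_seq.
  apply: eq_bigr => l lJ; rewrite hornerZ hornerXn mulrCA -exprD subnKC //.
  exact: j0min.
have ppos s : 0 < s -> 0 < p.[s].
  by move=> s0; have := energy_pos s s0; rewrite pE pmulr_rgt0 // exprn_gt0.
have p00 : p.[0] = beta j0.
  rewrite /p horner_sum (big_rem j0 j0J) /= subnn hornerZ hornerXn expr0 mulr1.
  rewrite big_seq big1 ?addr0 // => l lJ; rewrite hornerZ hornerXn expr0n.
  have := j0min l (mem_rem lJ); rewrite leq_eqVlt => /orP[/eqP lj|lj].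
    by move: lJ; rewrite -lj mem_rem_uniqF // fset_uniq.
  by rewrite subn_eq0 leqNgt lj mulr0.
(* p(0) is the lowest coefficient, nonzero by [assumption1], and it cannot be negative as a limit of
   positive values. *)
have p0 : 0 < p.[0].
  rewrite lt_neqAle eq_sym p00 HA.1 //= leNgt -p00; apply/negP => bj.
  have nb : 0 < - p.[0] by rewrite oppr_gt0.
  have [d d0 Hd] := continuous_dist _ _ (@continuous_horner _ p 0) _ nb.
  have : `|p.[d / 2] - p.[0]| < - p.[0].
    by apply: Hd; rewrite subr0 ger0_norm; lra.
  rewrite ltr_norml => /andP[_ H]; have : 0 < p.[d / 2] by apply: ppos; lra.
  by lra.
have [t /= tA tmin] := EVT_min (ltW A0) (continuous_subspaceT (@continuous_horner _ p)).
have c1 : 0 < p.[t].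
  move: tA; rewrite in_itv /= => /andP[+ _]; rewrite le_eqVlt => /orP[/eqP <-//|].
  exact: ppos.
have AD : 0 < A ^+ D by rewrite exprn_gt0.
pose c := Num.min (p.[t] / A ^+ D) (beta D / 2).
have c0 : 0 < c by rewrite lt_min !divr_gt0.
have main s j : 0 <= s -> j \in J -> c * s ^+ j <= energy s.
  move=> s0 jJ; have [As|sA] := leP A s.
    have s1 : 1 <= s by apply: le_trans As.
    have := HAs s As; rewrite ler_norml (gtr0_norm bD) => /andP[H _].
    apply: (@le_trans _ _ (beta D / 2 * s ^+ D)); last by lra.
    apply: ler_pM; rewrite ?exprn_ge0 ?(ltW c0) //.
      by rewrite /c ge_min lexx orbT.
    by apply: ler_weXn2l => //; apply: Dmax.
  have pt : p.[t] <= p.[s] by apply: tmin; rewrite in_itv /= s0 ltW.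
  have AD1 : 1 <= A ^+ D by rewrite exprn_ege1.
  have cp : c * A ^+ D <= p.[s].
    apply: le_trans pt; rewrite -ler_pdivlMr //.
    by rewrite /c ge_min lexx.
  rewrite pE -(subnK (j0min j jJ)) exprD mulrA [X in _ <= X]mulrC.
  rewrite ler_wpM2r ?exprn_ge0 //.
  apply: le_trans cp; rewrite ler_wpM2l ?(ltW c0) //.
  have [s1|s1] := leP s 1.
    by apply: le_trans AD1; rewrite exprn_ile1.
  apply: (@le_trans _ _ (A ^+ (j - j0))).
    by rewrite lerXn2r ?nnegrE ?(ltW A0) // ltW.
  by apply: ler_weXn2l => //; rewrite (leq_trans (leq_subr _ _)) // Dmax.
exists c => //; split=> // s s0.
have [s1|s1] := leP s 1.
  apply: (@le_trans _ _ 0); first by rewrite mulr_ge0_le0 ?(ltW c0) // subr_le0.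
  by move: s0; rewrite le_eqVlt => /orP[/eqP <-|/energy_pos/ltW //];
    apply: le_trans (main 0 D (lexx 0) DJ); rewrite mulr_ge0 ?exprn_ge0 ?(ltW c0).
apply: le_trans (main s D s0 DJ); rewrite ler_wpM2l ?(ltW c0) //.
rewrite (@le_trans _ _ s) ?gerBl //.
by rewrite -{1}[s]expr1 ler_weXn2l // ltW.
Qed.

Lemma bose_ge0 j s : 0 < s -> 0 <= bose J beta j s.
Proof.
move=> s0; rewrite /bose divr_ge0 ?exprn_ge0 ?(ltW s0) //.
by rewrite subr_ge0 ltW // expR_gt1 energy_pos.
Qed.

Lemma continuous_bose j s : 0 < s -> {for s, continuous (bose J beta j)}.
Proof.
move=> s0.
have e0 : expR (energy s) - 1 != 0 by rewrite lt0r_neq0 // subr_gt0 expR_gt1 energy_pos.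
have -> : bose J beta j = (fun x => x ^+ j * (expR (energy x) - 1)^-1) by [].
apply: cvgM; first exact: exprn_continuous.
apply: cvgV => //; apply: cvgB; last exact: cvg_cst.
apply: continuous_comp; [exact: continuous_energy|exact: continuous_expR].
Qed.

(** Write s^j/(e^Q - 1) as s^j/Q times Q/(e^Q - 1): the first factor is bounded by [energy_lower],
    the second decays like e^(-Q/2). For exponent 0 the claim is restricted to s away from 0, where
    Q may vanish. *)
Lemma bose_decay : exists2 c : R, 0 < c &
  (forall j, j \in J -> exists C : R, forall s, 0 < s -> bose J beta j s <= C * expR (- c * s)) /\
  (forall tau : R, 0 < tau -> exists C : R, forall s, tau <= s ->
     bose J beta 0 s <= C * expR (- c * s)).
Proof.
have [c c0 [cJ clin]] := energy_lower.
have [D [D0 DJ Dmax]] := max_degree.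
have key (k : R) j s : 0 < s -> 0 < k -> k * s ^+ j <= energy s ->
    bose J beta j s <= (2 / k * expR (c / 2)) * expR (- (c / 2) * s).
  move=> s0 k0 ks; have q0 := energy_pos s s0.
  have e1 : 0 < expR (energy s) - 1 by rewrite subr_gt0 expR_gt1.
  apply: (@le_trans _ _ (k^-1 * (energy s / (expR (energy s) - 1)))).
    rewrite mulrA ler_wpM2r ?invr_ge0 ?(ltW e1) // ler_pdivlMl //.
  apply: (@le_trans _ _ (k^-1 * (2 * expR (- (energy s / 2))))).
    by rewrite ler_wpM2l ?invr_ge0 ?(ltW k0) // mul_bose_le.
  rewrite -!mulrA [2 * (k^-1 * _)]mulrCA ler_wpM2l ?invr_ge0 ?(ltW k0) //.
  rewrite ler_wpM2l // -expRD ler_expR.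
  by have := clin s (ltW s0); lra.
exists (c / 2); first by rewrite divr_gt0.
split=> [j jJ|tau tau0].
  by exists (2 / c * expR (c / 2)) => s s0; apply: key => //; apply: cJ => //; apply: ltW.
have tD : 0 < tau ^+ D by rewrite exprn_gt0.
exists (2 / (c * tau ^+ D) * expR (c / 2)) => s ts.
have s0 : 0 < s by apply: lt_le_trans ts.
apply: key => //; first by rewrite mulr_gt0.
rewrite expr0 mulr1; apply: le_trans (cJ s D (ltW s0) DJ).
by rewrite ler_wpM2l ?(ltW c0) // lerXn2r // ?nnegrE ltW.
Qed.


Lemma bose_right_continuous j s (e : R) : 0 < s -> 0 < e ->
  exists2 d : R, 0 < d & forall y, s <= y -> y < s + d ->
    `|bose J beta j y - bose J beta j s| <= e.
Proof.
move=> s0 e0; have [d d0 H] := continuous_dist _ _ (continuous_bose j s s0) _ e0.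
by exists d => // y sy yd; apply/ltW/H; rewrite ger0_norm ?subr_ge0 // ltrBlDl.
Qed.

Lemma riemann_bose j (e : R) : j \in J -> 0 < e -> exists n0, forall n X, (n0 <= n)%N -> (n <= X)%N ->
  `|\sum_(i < X) bose J beta j (i.+1%:R / Num.sqrt n%:R) / Num.sqrt n%:R - alpha j| <= e.
Proof.
move=> jJ e0; have [c c0 [H _]] := bose_decay.
have [C HC] := H j jJ.
have -> : alpha j = fine (\int[mu]_(s in `]0%R, +oo[) (bose J beta j s)%:E)%E.
  by rewrite (HA.2 j jJ).2.
apply: (riemann_sum_unif R (bose J beta j) C c) => //.
  by move=> s s0; rewrite ger0_norm ?HC // bose_ge0.
by move=> s e'; apply: bose_right_continuous.
Qed.

(** The cut keeps [tau] itself, so the jump is right-continuous and the Riemann sums, which sample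
    on the right, still converge. *)
Definition bose_tail (tau s : R) : R := if tau <= s then bose J beta 0 s else 0.

Lemma bose_tail_right_continuous (tau s e : R) : 0 < s -> 0 < e ->
  exists2 d : R, 0 < d & forall y, s <= y -> y < s + d ->
    `|bose_tail tau y - bose_tail tau s| <= e.
Proof.
move=> s0 e0; rewrite /bose_tail; have [ts|st] := leP tau s.
  have [d d0 H] := bose_right_continuous 0 s e s0 e0.
  by exists d => // y sy yd; rewrite (le_trans ts sy) H.
exists (tau - s) => [|y sy yd]; first by rewrite subr_gt0.
by rewrite [tau <= y]leNgt (_ : y < tau) ?subrr ?normr0 ?(ltW e0) //; lra.
Qed.

Lemma bose_tail_decay tau : 0 < tau -> exists2 c : R, 0 < c & exists C : R,
  forall s, 0 < s -> `|bose_tail tau s| <= C * expR (- c * s).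
Proof.
move=> tau0; have [c c0 [_ H]] := bose_decay.
have [C HC] := H tau tau0; exists c => //; exists C => s s0.
rewrite /bose_tail; case: (leP tau s) => ts; first by rewrite ger0_norm ?HC // bose_ge0.
have : 0 <= C * expR (- c * tau).
  by apply: le_trans (HC tau (lexx _)); apply: bose_ge0.
rewrite pmulr_lge0 ?expR_gt0 // => C0.
by rewrite normr0 mulr_ge0 ?expR_ge0.
Qed.

Lemma phi_inf_bose_tail tau : 0 < tau ->
  phi_inf J beta tau = fine (\int[mu]_(s in `]0%R, +oo[) (bose_tail tau s)%:E)%E.
Proof.
move=> tau0; rewrite /phi_inf integral_mkcond [in RHS]integral_mkcond.
congr fine; apply: eq_integral => s _; rewrite /patch /bose_tail.
have -> : (s \in (`[tau, +oo[%classic : set R)) = (tau <= s).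
  by apply/idP/idP; rewrite inE /= in_itv /= andbT.
have -> : (s \in (`]0, +oo[%classic : set R)) = (0 < s).
  by apply/idP/idP; rewrite inE /= in_itv /= andbT.
case: (leP tau s) => ts; first by rewrite (lt_le_trans tau0).
by case: ifP.
Qed.

Lemma riemann_phi tau (e : R) : 0 < tau -> 0 < e -> exists n0, forall n X, (n0 <= n)%N -> (n <= X)%N ->
  `|\sum_(i < X) bose_tail tau (i.+1%:R / Num.sqrt n%:R) / Num.sqrt n%:R - phi_inf J beta tau| <= e.
Proof.
move=> tau0 e0; have [c c0 [C HC]] := bose_tail_decay tau tau0.
rewrite phi_inf_bose_tail //.
apply: (riemann_sum_unif R (bose_tail tau) C c) => //.
by move=> s e'; apply: bose_tail_right_continuous.
Qed.

Lemma integrable_bose_tail tau : 0 < tau ->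
  mu.-integrable `[tau, +oo[ (fun s => (bose J beta 0 s)%:E).
Proof.
move=> tau0; have [c c0 [C HC]] := bose_tail_decay tau tau0.
have [fi _] := riemann_sum_cvg R (bose_tail tau) C c id c0 HC
  (bose_tail_right_continuous tau) (fun n => leqnn n).
apply: eq_integrable; first exact: measurable_itv; last first.
  apply: (integrableS _ _ _ fi); try exact: measurable_itv.
  by move=> s /=; rewrite !in_itv /= !andbT; apply: lt_le_trans.
by move=> s; rewrite inE /= in_itv /= andbT /bose_tail => ->.
Qed.

Lemma phi_inf_lipschitz t1 : 0 < t1 -> exists C : R, forall a b : R, t1 <= a -> a <= b ->
  phi_inf J beta b <= phi_inf J beta a <= phi_inf J beta b + C * (b - a).
Proof.
move=> t10; have [c c0 [_ H]] := bose_decay; have [C HC] := H t1 t10.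
have C0 : 0 <= C.
  have : 0 <= C * expR (- c * t1) by apply: le_trans (HC t1 (lexx _)); apply: bose_ge0.
  by rewrite pmulr_lge0 ?expR_gt0.
exists C => a b ta ab.
have a0 : 0 < a by apply: lt_le_trans ta.
have b0 : 0 < b by apply: lt_le_trans ab.
have ia := integrable_bose_tail a a0; have ib := integrable_bose_tail b b0.
have iab : mu.-integrable `[a, b[ (fun s => (bose J beta 0 s)%:E).
  apply: (integrableS _ _ _ ia); try exact: measurable_itv.
  by move=> s /=; rewrite !in_itv /= andbT => /andP[].
have sU : `[a, +oo[%classic = `[a, b[%classic `|` `[b, +oo[%classic :> set R.
  apply/seteqP; split => s /=; rewrite !in_itv /= !andbT.
    by move=> as_; rewrite as_ /=; have [|] := ltP s b; [left|right].
  by case=> [/andP[]//|]; apply: le_trans.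
have E : (\int[mu]_(s in `[a, +oo[) (bose J beta 0 s)%:E =
    \int[mu]_(s in `[a, b[) (bose J beta 0 s)%:E + \int[mu]_(s in `[b, +oo[) (bose J beta 0 s)%:E)%E.
  rewrite sU integral_setU //.
  - by have /integrableP[+ _] := ia; rewrite sU.
  - apply/disj_setPS => s /= [] /=; rewrite !in_itv /= andbT => /andP[_ sb] bs.
    by have := lt_le_trans sb bs; rewrite ltxx.
have fab : (\int[mu]_(s in `[a, b[) (bose J beta 0 s)%:E)%E \is a fin_num.
  by apply: integrable_fin_num; first exact: measurable_itv.
have fb : (\int[mu]_(s in `[b, +oo[) (bose J beta 0 s)%:E)%E \is a fin_num.
  by apply: integrable_fin_num; first exact: measurable_itv.
have fE := congr1 fine E; rewrite (fineD fab fb) in fE.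
rewrite /phi_inf fE lerDr [X in _ && (X <= _)]addrC lerD2l; apply/andP; split.
  apply/fine_ge0/integral_ge0 => s /=; rewrite in_itv /= => /andP[as_ _].
  by rewrite lee_fin bose_ge0 // (lt_le_trans a0).
rewrite -lee_fin fineK //.
apply: (@le_trans _ _ (\int[mu]_(s in `[a, b[) (cst C%:E s))%E).
  apply: ge0_le_integral; first exact: measurable_itv.
  - by move=> s /=; rewrite in_itv /= => /andP[as_ _]; rewrite lee_fin bose_ge0 // (lt_le_trans a0).
  - by have /integrableP[] := iab.
  - exact: measurable_cst.
  move=> s /=; rewrite in_itv /= => /andP[as_ _]; rewrite lee_fin.
  have ts := le_trans ta as_.
  apply: le_trans (HC s ts) _; rewrite ler_piMr // -expR0 ler_expR mulNr oppr_le0.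
  by rewrite mulr_ge0 ?(ltW c0) // (le_trans (ltW t10)).
rewrite integral_cst; last exact: measurable_itv.
rewrite /= lebesgue_measure_itv /= lte_fin; case: ltP => _.
  by rewrite -EFinB -EFinM.
by rewrite mule0 lee_fin mulr_ge0 // subr_ge0.
Qed.

End Energy.

(** * Partitions as multiplicity functions *)

Section Encoding.
Variables X K : nat.
Local Notation config := {ffun 'I_X -> 'I_K.+1}.

(** Index x stands for the part x + 1, so parts are positive; sorting yields the one representative
    of the multiset that [is_partition] accepts. *)
Definition part_of (f : config) : seq nat :=
  sort geq (flatten [seq nseq (f x) x.+1 | x <- enum 'I_X]).

Lemma geq_total : total geq.
Proof. by move=> x y; exact: leq_total. Qed.

Lemma geq_trans : transitive geq.
Proof. by move=> y x z /= xy yz; exact: leq_trans yz xy. Qed.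

Lemma geq_anti : antisymmetric geq.
Proof. by move=> x y /= xy; apply: anti_leq; rewrite andbC. Qed.

Lemma big_part_of (V : nmodType) (F : nat -> V) (f : config) :
  \sum_(a <- part_of f) F a = \sum_(x < X) F x.+1 *+ f x.
Proof.
have -> : \sum_(a <- part_of f) F a =
    \sum_(a <- flatten [seq nseq (f x) x.+1 | x <- enum 'I_X]) F a.
  by apply: perm_big; rewrite perm_sort.
rewrite big_flatten big_map big_enum /=; apply: eq_bigr => x _.
elim: (nat_of_ord (f x)) => [|n IH]; first by rewrite big_nil mulr0n.
by rewrite /= big_cons IH mulrS.
Qed.

Lemma count_part_of (p : pred nat) (f : config) :
  count p (part_of f) = (\sum_(x < X) p x.+1 * f x)%N.
Proof.
rewrite -sum1_count big_mkcond (big_part_of _ (fun a => if p a then 1%N else 0%N)).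
by apply: eq_bigr => x _; case: (p x.+1); [rewrite mul1n; exact: natn|rewrite mul0n; exact: mul0rn].
Qed.

Lemma count_mem_part_of (f : config) (x : 'I_X) : count_mem x.+1 (part_of f) = f x.
Proof.
rewrite count_part_of (bigD1 x) //= eqxx mul1n big1 ?addn0 // => y yx.
by rewrite eqSS val_eqE (negbTE yx).
Qed.

Lemma part_of_inj : injective part_of.
Proof.
move=> f g fg; apply/ffunP => x; apply: val_inj => /=.
by rewrite -!count_mem_part_of fg.
Qed.

Lemma mem_part_of (f : config) a : a \in part_of f -> exists2 x : 'I_X, a = x.+1 & (0 < f x)%N.
Proof.
rewrite mem_sort => /flattenP[s /mapP[x _ ->]].
by rewrite mem_nseq => /andP[fx /eqP ->]; exists x.
Qed.

Lemma part_of_partition (f : config) : is_partition (part_of f).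
Proof.
split; first by apply: sort_sorted; exact: geq_total.
by apply/allP => a /mem_part_of [x -> _].
Qed.

Lemma part_of_surj s : is_partition s -> all (fun a => a <= X)%N s -> (size s <= K)%N ->
  exists f, part_of f = s.
Proof.
move=> [ss s0] sX sK.
exists [ffun x : 'I_X => inord (count_mem x.+1 s)].
have sK' a : (count_mem a s <= K)%N by rewrite (leq_trans (count_size _ _)).
apply: (sorted_eq geq_trans geq_anti) => //; first exact: (part_of_partition _).1.
set f := [ffun _ => _].
have fE (x : 'I_X) : f x = count_mem x.+1 s :> nat by rewrite ffunE inordK // ltnS.
apply/allP => a _ /=; apply/eqP.
case: (posnP a) => [->|a0].
  rewrite (count_memPn _) ?(count_memPn _) //; apply/negP.
    by move=> /(allP s0).
  by move=> /mem_part_of[].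
have [aX|Xa] := leqP a X.
  have aX' : (a.-1 < X)%N by rewrite prednK.
  have -> : a = (Ordinal aX').+1 by rewrite /= prednK.
  by rewrite count_mem_part_of fE.
rewrite (count_memPn _) ?(count_memPn _) //; apply/negP.
  by move=> /(allP sX); rewrite leqNgt Xa.
by move=> /mem_part_of[x aE _]; move: Xa; rewrite aE ltnNge ltn_ord.
Qed.

(** The hypothesis also makes [P] finite: [fset_set] of an infinite set would be empty by
    default. *)
Lemma card_partitions (P : set (seq nat)) :
  (forall s, P s -> exists f, part_of f = s) ->
  #|` fset_set P| = #|[pred f : config | part_of f \in P]|.
Proof.
move=> Psurj; pose l := [seq part_of f | f <- enum [pred f : config | part_of f \in P]].
have PE : P = [set` [fset x in l]%fset].
  apply/seteqP; split => s /=.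
    move=> Ps; have [f fs] := Psurj s Ps.
    rewrite in_fset /= -fs; apply/mapP; exists f => //.
    by rewrite mem_enum unfold_in /= fs; apply/mem_set.
  by rewrite in_fset /= => /mapP[f]; rewrite mem_enum !inE => Pf ->.
rewrite [in LHS]PE set_fsetK card_fseq undup_id ?size_map -?cardE //.
rewrite map_inj_uniq ?enum_uniq //; exact: part_of_inj.
Qed.

End Encoding.

(** A positive exponent makes x^j at least x and at least 1, so one power sum bounds both the
    largest part and the number of parts. This is where the positive element of the profile set
    enters. *)
Lemma partition_bounds (s : seq nat) j : all (fun x => 0 < x)%N s -> (0 < j)%N ->
  all (fun a => a <= sumn [seq x ^ j | x <- s])%N s /\ (size s <= sumn [seq x ^ j | x <- s])%N.
Proof.
move=> + j0; elim: s => [//|x s IH] /= /andP[x0 s0].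
have [IH1 IH2] := IH s0; split.
  apply/andP; split.
    by rewrite (leq_trans _ (leq_addr _ _)) // -{1}[x]expn1 leq_pexp2l.
  by apply: sub_all IH1 => a; move=> /leq_trans; apply; rewrite leq_addl.
by rewrite -add1n leq_add // expn_gt0 x0.
Qed.

(** * Concentration of linear statistics *)

Section Concentration.
Variables (R : realType) (J : {fset nat}) (alpha beta : nat -> R).
Hypothesis JP : profile_set J.
Hypothesis HA : assumption1 J alpha beta.
Local Notation energy := (energy R J beta).
Local Notation root n := (Num.sqrt (n%:R : R)).

Definition scaled (n X : nat) (x : 'I_X) : R := x.+1%:R / root n.
Definition cost (n X : nat) (x : 'I_X) : R := energy (scaled n X x).

Lemma root_gt0 n : (0 < n)%N -> 0 < root n.
Proof. by move=> n0; rewrite sqrtr_gt0 ltr0n. Qed.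

Lemma scaled_gt0 n X x : (0 < n)%N -> 0 < scaled n X x.
Proof. by move=> n0; rewrite divr_gt0 ?ltr0n ?root_gt0. Qed.

Lemma cost_gt0 n X x : (0 < n)%N -> 0 < cost n X x.
Proof. by move=> n0; apply: (energy_pos _ _ _ _ JP HA); exact: scaled_gt0. Qed.

Lemma sum_expR_scaled_le (a : R) n X : 0 < a -> (0 < n)%N ->
  \sum_(x < X) expR (- (a * scaled n X x)) <= root n / a.
Proof.
move=> a0 n0; have w0 := root_gt0 n n0.
pose r := expR (- (a / root n)).
have aw : 0 < a / root n by rewrite divr_gt0.
have r0 : 0 <= r := expR_ge0 _.
have r1 : r < 1 by rewrite expR_lt1 oppr_lt0.
rewrite (eq_bigr (fun x : 'I_X => r * r ^+ x)); last first.
  move=> x _; rewrite -exprS -expRM_natl /scaled; congr expR.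
  by rewrite mulrN [a * _]mulrCA.
rewrite -mulr_sumr; apply: (@le_trans _ _ (r * (1 - r)^-1)).
  by rewrite ler_wpM2l // geometric_sum_le.
rewrite ler_pdivrMr ?subr_gt0 // -[root n / a]invf_div.
have := expR_ge1Dx (a / root n); rewrite -[expR _]invrK -expRN -/r => H.
have rp : 0 < r := expR_gt0 _.
rewrite ler_pdivlMl // mulrC.
have : (1 + a / root n) * r <= 1 by rewrite -ler_pdivlMr // mul1r.
lra.
Qed.

(** Only O(sqrt n) parts matter, whatever the cutoff [X]; the quadratic errors in the Chernoff
    exponent therefore add up to O(k^2 sqrt n). *)
Lemma sum_expR_cost_le : exists2 C : R, 0 < C & forall n X, (0 < n)%N ->
  \sum_(x < X) expR (- (cost n X x / 8)) <= C * root n.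
Proof.
have [c c0 [_ clin]] := energy_lower _ _ _ _ JP HA.
exists (expR (c / 8) * (8 / c)); first by rewrite mulr_gt0 ?expR_gt0 ?divr_gt0.
move=> n X n0; apply: (@le_trans _ _ (\sum_(x < X) expR (c / 8) * expR (- (c / 8 * scaled n X x)))).
  apply: ler_sum => x _; rewrite -expRD ler_expR /cost.
  by have := clin _ (ltW (scaled_gt0 n X x n0)); lra.
rewrite -mulr_sumr -mulrA ler_wpM2l ?expR_ge0 //.
apply: le_trans (sum_expR_scaled_le (c / 8) n X _ n0) _; first by rewrite divr_gt0.
by rewrite invf_div mulrC.
Qed.

Definition linstat (n X K : nat) (F : R -> R) (f : {ffun 'I_X -> 'I_K.+1}) : R :=
  \sum_x (f x)%:R * F (scaled n X x).

(** 1/(e^q - 1) is the mean of a geometric law of ratio e^(-q): this is the expectation of [linstat]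
    when multiplicities are not truncated at K. *)
Definition linmean (n X : nat) (A : pred 'I_X) (F : R -> R) : R :=
  \sum_(x | A x) F (scaled n X x) / (expR (cost n X x) - 1).

Local Notation partfun X t := (\prod_(x < X) (1 - t x)^-1).

(** The condition |F| <= Q/c makes k c F an admissible exponent, even near 0 where Q is small. The
    rate [c'] depends on [c] and [eta] only, so one rate serves all test functions and all sets of
    allowed parts. *)
Lemma upper_concentration (c eta : R) : 0 < c -> 0 < eta ->
  exists2 c' : R, 0 < c' & forall (F : R -> R) n X K (A : pred 'I_X), (0 < n)%N ->
  (forall s, 0 < s -> `|F s| <= energy s / c) ->
  \sum_(f : {ffun 'I_X -> 'I_K.+1} |
        linmean n X A F + eta * root n <= linstat n X K F f)
     weight R X K (tilt R X A (cost n X)) f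
  <= partfun X (tilt R X A (cost n X)) * expR (- (c' * root n)).
Proof.
move=> c0 eta0; have [C C0 HC] := sum_expR_cost_le.
(* With 48 C k <= c eta, the quadratic error 24 k^2 C sqrt n costs at most half of the gain k c eta
   sqrt n. *)
pose k := Num.min 4^-1 (c * eta / (48 * C)).
have k0 : 0 < k by rewrite lt_min invr_gt0 ltr0n /= divr_gt0 ?mulr_gt0.
have k4 : k <= 4^-1 by rewrite /k ge_min lexx.
have kC : k * (48 * C) <= c * eta.
  by rewrite -ler_pdivlMr ?mulr_gt0 // /k ge_min lexx orbT.
exists (k * c * eta / 2); first by rewrite divr_gt0 ?mulr_gt0.
move=> F n X K A n0 Fb; have w0 := root_gt0 n n0.
have kc : 0 < k * c by apply: mulr_gt0.
pose g x := k * c * F (scaled n X x).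
have gb x : `|g x| <= k * cost n X x.
  rewrite /g normrM (ger0_norm (ltW kc)) -mulrA ler_wpM2l ?(ltW k0) //.
  have := Fb _ (scaled_gt0 n X x n0).
  by rewrite ler_pdivlMr // mulrC.
have := chernoff R X K A (cost n X) (fun x => cost_gt0 n X x n0) g k
  (k * c * (linmean n X A F + eta * root n)) (ltW k0) k4 gb.
have -> : \sum_(f : {ffun 'I_X -> 'I_K.+1} |
    k * c * (linmean n X A F + eta * root n) <= \sum_x (f x)%:R * g x)
     weight R X K (tilt R X A (cost n X)) f =
  \sum_(f : {ffun 'I_X -> 'I_K.+1} |
        linmean n X A F + eta * root n <= linstat n X K F f)
     weight R X K (tilt R X A (cost n X)) f.
  apply: eq_bigl => f; rewrite -[RHS](ler_pM2l kc) /linstat mulr_sumr.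
  by congr (_ <= _); apply: eq_bigr => x _; rewrite /g mulrCA.
move/le_trans; apply; rewrite ler_wpM2l //.
  by apply: prodr_ge0 => x _; rewrite invr_ge0 subr_ge0 ltW // tilt_lt1 // => y; apply: cost_gt0.
rewrite ler_expR big_split /= -mulr_sumr.
have -> : \sum_(x | A x) g x / (expR (cost n X x) - 1) = k * c * linmean n X A F.
  by rewrite /linmean mulr_sumr; apply: eq_bigr => x _; rewrite /g mulrA.
have : \sum_(x | A x) expR (- (cost n X x / 8)) <= C * root n.
  apply: le_trans (HC n X n0); rewrite big_mkcond; apply: ler_sum => x _.
  by case: (A x); rewrite ?expR_ge0.
set S := \sum_(x | A x) _ => HS.
have : 24 * k ^+ 2 * S <= 24 * k ^+ 2 * (C * root n) by rewrite ler_wpM2l // mulr_ge0 // sqr_ge0.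
have : k * (k * (48 * C)) * root n <= k * (c * eta) * root n.
  by rewrite ler_wpM2r ?(ltW w0) // ler_wpM2l // ltW.
rewrite expr2; lra.
Qed.

Lemma concentration (c eta : R) : 0 < c -> 0 < eta ->
  exists2 c' : R, 0 < c' & forall (F : R -> R) n X K (A : pred 'I_X), (0 < n)%N ->
  (forall s, 0 < s -> `|F s| <= energy s / c) ->
  \sum_(f : {ffun 'I_X -> 'I_K.+1} |
        eta * root n <= `|linstat n X K F f - linmean n X A F|)
     weight R X K (tilt R X A (cost n X)) f
  <= 2 * partfun X (tilt R X A (cost n X)) * expR (- (c' * root n)).
Proof.
move=> c0 eta0; have [c' c'0 H] := upper_concentration c eta c0 eta0.
exists c' => // F n X K A n0 Fb.
have W0 (f : {ffun 'I_X -> 'I_K.+1}) : 0 <= weight R X K (tilt R X A (cost n X)) f.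
  by apply: prodr_ge0 => x _; rewrite exprn_ge0 // tilt_ge0.
have H1 := H F n X K A n0 Fb.
have nFb s : 0 < s -> `|- F s| <= energy s / c by move=> /Fb; rewrite normrN.
have := H (fun s => - F s) n X K A n0 nFb.
have -> : linmean n X A (fun s => - F s) = - linmean n X A F.
  by rewrite /linmean -sumrN; apply: eq_bigr => x _; rewrite mulNr.
have statN f : linstat n X K (fun s => - F s) f = - linstat n X K F f.
  by rewrite /linstat -sumrN; apply: eq_bigr => x _; rewrite mulrN.
move=> H2; rewrite -mulrA mulr2n mulrDl mul1r.
apply: le_trans (lerD H1 H2).
rewrite [X in _ <= X + _]big_mkcond [X in _ <= _ + X]big_mkcond -big_split big_mkcond /=.
apply: ler_sum => f _; rewrite statN.
case: ifP => [|_]; last by apply: addr_ge0; case: ifP.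
rewrite ler_normr => /orP[dev|dev].
  rewrite ifT; first by rewrite lerDl; case: ifP.
  by rewrite addrC -lerBrDr.
rewrite [X in _ <= _ + X]ifT; first by rewrite lerDr; case: ifP.
by move: dev; rewrite opprB => dev; lra.
Qed.


Lemma weight_ge0 n X K (A : pred 'I_X) f : 0 <= weight R X K (tilt R X A (cost n X)) f.
Proof. by apply: prodr_ge0 => x _; rewrite exprn_ge0 // tilt_ge0. Qed.

Lemma partfun_ge0 n X (A : pred 'I_X) : (0 < n)%N ->
  0 <= partfun X (tilt R X A (cost n X)).
Proof.
move=> n0; apply: prodr_ge0 => x _; rewrite invr_ge0 subr_ge0 ltW // tilt_lt1 //.
by move=> y; exact: cost_gt0.
Qed.

Definition above (t s : R) : R := if t <= s then 1 else 0.

Lemma phi_n_linstat n X K t (f : {ffun 'I_X -> 'I_K.+1}) : (0 < n)%N ->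
  phi_n (part_of X K f) n t = linstat n X K (above t) f / root n.
Proof.
move=> n0; rewrite /phi_n count_part_of natr_sum; congr (_ / _).
apply: eq_bigr => x _; rewrite natrM mulrC /above /scaled ler_pdivlMr ?root_gt0 //.
by case: ifP.
Qed.

Lemma linmean_above n X t : linmean n X predT (above t) = \sum_(x < X) bose_tail R J beta t (scaled n X x).
Proof.
apply: eq_bigr => x _; rewrite /above /bose_tail /bose expr0.
by case: ifP; rewrite ?mul0r.
Qed.

Lemma eventually_forall_lt (P : nat -> nat -> Prop) (m : nat) :
  (forall i, exists n0, forall n, (n0 <= n)%N -> P i n) ->
  exists n0, forall i n, (i < m)%N -> (n0 <= n)%N -> P i n.
Proof.
move=> HP; elim: m => [|m [n1 H1]]; first by exists 0%N.
have [n2 H2] := HP m; exists (maxn n1 n2) => i n.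
rewrite ltnS leq_eqVlt geq_max => /orP[/eqP ->|im] /andP[h1 h2]; first exact: H2.
exact: H1.
Qed.

Lemma union_bound (I : finType) (W : I -> R) (B : pred I) (m : nat) (Bi : nat -> pred I) :
  (forall f, 0 <= W f) -> (forall f, B f -> exists2 i, (i < m)%N & Bi i f) ->
  \sum_(f | B f) W f <= \sum_(i < m) \sum_(f | Bi i f) W f.
Proof.
move=> W0 HB; under [X in _ <= X]eq_bigr do rewrite big_mkcond.
rewrite exchange_big big_mkcond; apply: ler_sum => f _ /=.
case: ifP => [/HB [i im Bif]|_]; last by apply: sumr_ge0 => i _; case: ifP.
rewrite (bigD1 (Ordinal im)) //= Bif lerDl; apply: sumr_ge0 => j _.
by case: ifP.
Qed.

Lemma grid_cell (t1 t2 t : R) (G : nat) : (0 < G)%N -> t1 < t2 -> t1 <= t <= t2 ->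
  exists2 i : nat, (i < G)%N &
    t1 + i%:R * ((t2 - t1) / G%:R) <= t <= t1 + i.+1%:R * ((t2 - t1) / G%:R).
Proof.
move=> G0 t12 /andP[t1t tt2].
have h0 : 0 < (t2 - t1) / G%:R by rewrite divr_gt0 ?subr_gt0 ?ltr0n.
move: h0; set h := _ / _ => h0.
have Gh : G%:R * h = t2 - t1 by rewrite mulrC divfK // pnatr_eq0 -lt0n.
have [tt1|t1t'] := leP t t1.
  exists 0%N => //; rewrite mul0r addr0 t1t mul1r (le_trans tt1) // lerDl; exact: ltW.
have y0 : 0 < (t - t1) / h by rewrite divr_gt0 // subr_gt0.
have [i [iy yi]] := cell_index _ _ y0.
move: iy yi; rewrite ltr_pdivlMr // ler_pdivrMr // => iy yi.
exists i; last by rewrite -lerBrDl (ltW iy) -lerBlDl.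
rewrite -(ltr_nat R) -(ltr_pM2r h0) Gh; apply: lt_le_trans iy _; lra.
Qed.

(** Both profiles are nonincreasing and the limit is Lipschitz on [t1, oo), so a deviation inside a
    grid cell reappears at one of its endpoints, up to one Lipschitz increment. A uniform deviation
    is thus covered by G + 1 deviations of linear statistics. *)
Lemma deviation_mass (t1 t2 eps : R) : 0 < t1 -> t1 < t2 -> 0 < eps ->
  exists2 c1 : R, 0 < c1 & exists G n0 : nat, forall n X K, (n0 <= n)%N -> (n <= X)%N ->
  \sum_(f : {ffun 'I_X -> 'I_K.+1} |
         part_of X K f \in [set s | eps <= sup_dev J beta t1 t2 s n])
     weight R X K (tilt R X predT (cost n X)) f
  <= G%:R * partfun X (tilt R X predT (cost n X)) * expR (- (c1 * root n)).
Proof.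
move=> t10 t12 eps0.
have [C HC] := phi_inf_lipschitz _ _ _ _ JP HA t1 t10.
pose G := (Num.bound `|4 * (`|C| * (t2 - t1)) / eps|).+1.
have G0 : (0 < G)%N by [].
pose h := (t2 - t1) / G%:R.
have h0 : 0 < h by rewrite divr_gt0 ?subr_gt0 ?ltr0n.
have Ch : C * h <= eps / 4.
  apply: (@le_trans _ _ (`|C| * h)); first by rewrite ler_wpM2r ?ler_norm // ltW.
  rewrite /h mulrA ler_pdivrMr ?ltr0n //.
  have : `|4 * (`|C| * (t2 - t1)) / eps| < G%:R.
    by apply: lt_le_trans (archi_boundP (normr_ge0 _)) _; rewrite ler_nat.
  move/(le_lt_trans (ler_norm _)); rewrite ltr_pdivrMr //; lra.
pose tau i : R := t1 + i%:R * h.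
have tau1 i : t1 <= tau i by rewrite lerDl mulr_ge0 // ltW.
have tau0 i : 0 < tau i by apply: lt_le_trans (tau1 i).
(* A deviation of eps/4 at a grid point is shared between the Riemann sum and the fluctuation of the
   statistic, eps/8 each. *)
have e8 : 0 < eps / 8 by rewrite divr_gt0.
have [c c0 [cJ _]] := energy_lower _ _ _ _ JP HA.
have [D [D0 DJ _]] := max_degree _ JP.
have ct0 : 0 < c * t1 ^+ D by rewrite mulr_gt0 // exprn_gt0.
have [c1 c10 conc] := concentration _ _ ct0 e8.
exists c1 => //.
have [n1 Hn1] := eventually_forall_lt (fun i n => forall X, (n <= X)%N ->
   `|\sum_(x < X) bose_tail R J beta (tau i) (x.+1%:R / root n) / root n - phi_inf J beta (tau i)| <= eps / 8)
   G.+1 (fun i => let: ex_intro n0 H := riemann_phi _ _ _ _ JP HA (tau i) (eps / 8) (tau0 i) e8 in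
      ex_intro _ n0 (fun n h X => H n X h)).
exists (2 * G.+1)%N, (maxn 1 n1) => n X K; rewrite geq_max => /andP[n0 n1n] nX.
have w0 := root_gt0 n n0.
pose Bi i (f : {ffun 'I_X -> 'I_K.+1}) :=
  eps / 8 * root n <= `|linstat n X K (above (tau i)) f - linmean n X predT (above (tau i))|.
have dev_Bi i f : (i <= G)%N ->
    eps / 4 <= `|phi_n (part_of X K f) n (tau i) - phi_inf J beta (tau i)| -> Bi i f.
  move=> iG; rewrite phi_n_linstat // /Bi linmean_above => dev.
  have := Hn1 i n iG n1n X nX; rewrite -mulr_suml.
  rewrite -[\sum_(x < X) _]/(\sum_(x < X) bose_tail R J beta (tau i) (scaled n X x)).
  move: dev; set S := \sum_(x < X) _; set L := linstat _ _ _ _ _; set p := phi_inf _ _ _.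
  move=> dev rie; rewrite -ler_pdivlMr //.
  have -> : `|L - S| / root n = `|L / root n - S / root n|.
    by rewrite -mulrBl normrM normfV (gtr0_norm w0).
  have := ler_normD (L / root n - S / root n) (S / root n - p).
  rewrite addrA subrK; lra.
have bad_grid f : part_of X K f \in [set s | eps <= sup_dev J beta t1 t2 s n] ->
    exists2 i, (i < G.+1)%N & Bi i f.
  rewrite inE /= /sup_dev; set A := [set _ | _ in _] => epsA.
  (* A set without supremum has [sup] equal to 0 by convention, which the positivity of [eps]
     excludes. *)
  have hA : has_sup A.
    apply: contrapT => nA; move: epsA; rewrite sup_out // leNgt eps0 //.
  (* The supremum need not be attained; a point with deviation above eps/2 is enough. *)
  have e2 : 0 < eps / 2 by rewrite divr_gt0.
  have [_ [t tin <-] dev] := sup_adherent e2 hA.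
  have {}dev : eps / 2 < `|phi_n (part_of X K f) n t - phi_inf J beta t|.
    by apply: le_lt_trans dev; lra.
  move: tin; rewrite /= in_itv /= => /(grid_cell _ _ _ _ G0 t12) [i iG].
  rewrite -/h -/(tau i) -/(tau i.+1) => /andP[it ti].
  have mono (a b : R) : a <= b -> phi_n (part_of X K f) n b <= phi_n (part_of X K f) n a.
    move=> ab; rewrite /phi_n ler_wpM2r ?invr_ge0 ?(ltW w0) // ler_nat.
    by apply: sub_count => y /=; apply: le_trans; rewrite ler_wpM2r ?(ltW w0).
  have it1 : t1 <= t by apply: le_trans it.
  have /andP[_ L1] := HC _ _ (tau1 i) (le_trans it ti).
  have /andP[L2 _] := HC _ _ (tau1 i) it.
  have /andP[L3 _] := HC _ _ it1 ti.
  have hE : tau i.+1 - tau i = h by rewrite /tau -natr1; ring.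
  rewrite hE in L1.
  have m1 := mono _ _ it; have m2 := mono _ _ ti.
  move: dev; rewrite ltr_normr => /orP[dev|dev].
    exists i; first by rewrite ltnS ltnW.
    apply: dev_Bi; first exact: ltnW.
    by rewrite ler_normr; apply/orP; left; lra.
  exists i.+1; first by rewrite ltnS.
  apply: dev_Bi => //.
  by rewrite ler_normr; apply/orP; right; lra.
apply: le_trans (union_bound _ _ _ G.+1 Bi (weight_ge0 n X K predT) bad_grid) _.
set Z := partfun X _.
apply: (@le_trans _ _ (\sum_(i < G.+1) 2 * Z * expR (- (c1 * root n)))).
  apply: ler_sum => i _; apply: conc => // s s0; rewrite /above; case: ifP => ts; last first.
    by rewrite normr0 divr_ge0 ?(ltW ct0) // ltW // (energy_pos _ _ _ _ JP HA).
  rewrite normr1 ler_pdivlMr // mul1r.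
  apply: le_trans (cJ s D (ltW s0) DJ); rewrite ler_wpM2l ?(ltW c0) //.
  by rewrite lerXn2r ?nnegrE ?(ltW t10) ?(ltW s0) // (le_trans (tau1 i)).
rewrite sumr_const card_ord -mulr_natl natrM le_eqVlt; apply/orP; left; apply/eqP; ring.
Qed.

End Concentration.

(** * Scales and blocks *)

Section Asymptotics.
Variable R : realType.
Local Notation root n := (Num.sqrt (n%:R : R)).

Lemma root_large (B : R) : exists n0 : nat, forall n, (n0 <= n)%N -> B <= root n.
Proof.
exists (Num.bound (B ^+ 2)) => n Bn.
apply: le_trans (ler_norm _) _; rewrite -sqrtr_sqr ler_sqrt //.
by apply/ltW/(lt_le_trans (archi_boundP (sqr_ge0 _))); rewrite ler_nat.
Qed.

Lemma poly_le_expR (C a : R) (m : nat) : 0 < a ->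
  exists n0 : nat, forall n, (n0 <= n)%N -> C * root n ^+ m <= expR (a * root n).
Proof.
move=> a0; pose b := a / m.+1%:R.
have b0 : 0 < b by rewrite divr_gt0 ?ltr0n.
have [n0 Hn0] := root_large (1 + `|C| * b ^- m.+1).
exists n0 => n nn; have w1 := Hn0 n nn.
have bm : 0 <= b ^- m.+1 by rewrite invr_ge0 exprn_ge0 // ltW.
have w0 : 0 < root n by apply: lt_le_trans w1; rewrite ltr_pwDl // mulr_ge0.
have key : root n ^+ m.+1 <= b ^- m.+1 * expR (a * root n).
  have -> : a * root n = m.+1%:R * (b * root n) by rewrite /b mulrA mulrCA divff ?mulr1 // pnatr_eq0.
  rewrite expRM_natl -exprVn -exprMn lerXn2r ?nnegrE ?(ltW w0) //.
    by rewrite mulr_ge0 ?expR_ge0 // invr_ge0 ltW.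
  by rewrite ler_pdivlMl //; have := expR_ge1Dx (b * root n); lra.
rewrite -(ler_pM2l w0).
have -> : root n * (C * root n ^+ m) = C * root n ^+ m.+1 by rewrite exprS; ring.
apply: (@le_trans _ _ (`|C| * root n ^+ m.+1)).
  by rewrite ler_wpM2r ?ler_norm // exprn_ge0 // ltW.
apply: (@le_trans _ _ (`|C| * (b ^- m.+1 * expR (a * root n)))).
  by rewrite ler_wpM2l.
by rewrite mulrA ler_wpM2r ?expR_ge0 // (le_trans _ w1) // lerDr.
Qed.

Lemma bernoulli_sub (x : R) k : 0 <= x <= 1 -> 1 - k%:R * x <= (1 - x) ^+ k.
Proof.
move=> /andP[x0 x1]; elim: k => [|k IH]; first by rewrite mul0r subr0.
rewrite exprS; apply: (@le_trans _ _ ((1 - x) * (1 - k%:R * x))); last first.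
  by rewrite ler_wpM2l // subr_ge0.
have : 0 <= k%:R * x * x by rewrite !mulr_ge0.
by rewrite -natr1; lra.
Qed.

(** Take the largest H with H^(2(D+1)) <= n. Then sqrt n is at most (H+1)^(D+1), and Bernoulli's
    inequality gives (H/(H+1))^(D+1) >= 1 - (D+1)/(H+1), which is at least 1 - e for large H. *)
Lemma power_scale (D Hmin : nat) (e : R) : 0 < e -> exists n0 : nat, forall n, (n0 <= n)%N ->
  exists H : nat, [/\ (Hmin <= H)%N, (H ^ D.+1)%:R <= root n & (1 - e) * root n <= (H ^ D.+1)%:R].
Proof.
move=> e0; pose H1 := maxn Hmin (Num.bound (D.+1%:R / e)).
exists ((H1 ^ D.+1) ^ 2)%N => n nn.
have ub h : ((h ^ D.+1) ^ 2 <= n)%N -> (h <= n)%N.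
  move=> /(leq_trans _); apply; rewrite -expnM.
  by case: h => // h; rewrite -{1}[h.+1]expn1 leq_pexp2l // muln2.
have [H Hn Hmax] := ex_maxnP (ex_intro _ H1 nn) ub.
have HH := Hmax _ nn.
exists H; split.
- exact: leq_trans (leq_maxl _ _) HH.
- by rewrite -[X in X <= _]ger0_norm // -sqrtr_sqr ler_sqrt // -natrX ler_nat.
have Hlt : root n <= (H.+1 ^ D.+1)%:R.
  rewrite -[X in _ <= X]ger0_norm // -sqrtr_sqr ler_sqrt ?sqr_ge0 // -natrX ler_nat.
  by apply: ltnW; rewrite ltnNge; apply/negP => /Hmax; rewrite ltnn.
have H1p : 0 < H.+1%:R :> R by rewrite ltr0n.
pose x : R := H.+1%:R^-1.
have x0 : 0 <= x by rewrite invr_ge0 ltW.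
have x1 : x <= 1 by rewrite invf_le1 // ler1n.
have HE : H%:R = (1 - x) * H.+1%:R :> R.
  by rewrite mulrBl mul1r mulVf ?lt0r_neq0 // -natr1 addrK.
have De : D.+1%:R * x <= e.
  rewrite ler_pdivrMr // mulrC -ler_pdivrMr //.
  apply: ltW; apply: lt_le_trans (archi_boundP _) _; first by rewrite divr_ge0 // ltW.
  by rewrite ler_nat (leq_trans (leq_maxr Hmin _)) // (leq_trans HH).
have b1 : 1 - e <= (1 - x) ^+ D.+1.
  by apply: le_trans (bernoulli_sub x D.+1 _); [lra|rewrite x0 x1].
rewrite !natrX HE exprMn; apply: (@le_trans _ _ ((1 - x) ^+ D.+1 * root n)).
  by rewrite ler_wpM2r.
by rewrite ler_wpM2l ?exprn_ge0 ?subr_ge0 // -natrX.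
Qed.

Lemma sum_inj_le (I : finType) (S T : pred I) (g : I -> I) (F : I -> R) :
  (forall i, 0 <= F i) -> {in S &, injective g} -> (forall i, S i -> T (g i)) ->
  \sum_(i | S i) F (g i) <= \sum_(i | T i) F i.
Proof.
move=> F0 ginj gT.
have -> : \sum_(i | S i) F (g i) = \sum_(h in [set g i | i in S]%SET) F h.
  by rewrite big_imset.
rewrite big_mkcond [X in _ <= X]big_mkcond; apply: ler_sum => i _.
case: ifP => [/imsetP[k Sk ->]|_]; first by rewrite gT.
by case: ifP.
Qed.

End Asymptotics.

(** Index x is the part x + 1: the forbidden parts are iM + 1, ..., iM + L for i = 1, ..., D + 1. *)
Definition in_blocks (D M L x : nat) : bool := (0 < x %/ M <= D.+1)%N && (x %% M < L)%N.

Lemma sum_in_blocks (V : nmodType) (D M L X : nat) (F : nat -> V) :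
  (0 < M)%N -> (L <= M)%N -> (D.+2 * M <= X)%N ->
  \sum_(x < X | in_blocks D M L x) F x = \sum_(i < D.+1) \sum_(l < L) F (i.+1 * M + l)%N.
Proof.
move=> M0 LM MX.
pose s := [seq (i.+1 * M + l)%N | i <- iota 0 D.+1, l <- iota 0 L].
have divE i l : (l < L)%N -> ((i.+1 * M + l) %/ M = i.+1)%N.
  by move=> lL; rewrite divnMDl // divn_small ?addn0 // (leq_trans lL).
have modE i l : (l < L)%N -> ((i.+1 * M + l) %% M = l)%N.
  by move=> lL; rewrite modnMDl modn_small // (leq_trans lL).
have us : uniq s.
  rewrite /s; move: D.+1 => d.
  apply: allpairs_uniq; rewrite ?iota_uniq // => [[i l] [i' l']].
  move=> /allpairsP[[a b] /= [_ + [-> ->]]]; rewrite mem_iota => /= bL.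
  move=> /allpairsP[[a' b'] /= [_ + [-> ->]]]; rewrite mem_iota => /= bL' E.
  have := congr1 (divn^~ M) E; have := congr1 (modn^~ M) E; rewrite /= !divE // !modE //.
  by move=> -> [->].
rewrite -(big_mkord (in_blocks D M L) F) /index_iota subn0 -big_filter.
have -> : \sum_(x <- [seq x <- iota 0 X | in_blocks D M L x]) F x = \sum_(x <- s) F x.
  apply: perm_big; apply: uniq_perm => //; first by rewrite filter_uniq ?iota_uniq.
  move=> x; rewrite mem_filter mem_iota /= add0n; apply/andP/idP.
    move=> [/andP[/andP[q0 qD] rL] xX]; apply/allpairsP.
    exists ((x %/ M).-1, (x %% M)%N); split.
    - by rewrite mem_iota /= add0n prednK.
    - by rewrite mem_iota.
    - by rewrite /= prednK // -divn_eq.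
  move=> /allpairsP[[i l] []]; rewrite !mem_iota /= !add0n => iD lL ->.
  rewrite /in_blocks divE // modE //; split; first by rewrite iD lL.
  by apply: leq_trans MX; nia.
rewrite /s big_allpairs_dep; have -> : iota 0 D.+1 = index_iota 0 D.+1 by rewrite /index_iota subn0.
rewrite big_mkord.
apply: eq_bigr => i _; have -> : iota 0 L = index_iota 0 L by rewrite /index_iota subn0.
by rewrite big_mkord.
Qed.

(** * Adjoining a multiset *)

Lemma sumn_psum (s : seq nat) j : (sumn [seq (x ^ j)%N | x <- s])%:Z = psum s j.
Proof.
rewrite sumnE big_map (big_morph Posz PoszD (erefl _)).
by apply: eq_bigr => x _; rewrite Posz_exp.
Qed.

Lemma psum_ge0 s j : 0 <= psum s j.
Proof. by apply: sumr_ge0 => x _; rewrite exprn_ge0. Qed.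

Lemma psum_perm s t j : perm_eq s t -> psum s j = psum t j.
Proof. by move=> st; apply: perm_big. Qed.

Section Fibers.
Variables (R : realType) (J : {fset nat}) (beta : nat -> R).
Local Notation root n := (Num.sqrt (n%:R : R)).
Local Notation cost := (cost R J beta).
Local Notation config X K := {ffun 'I_X -> 'I_K.+1}.

Lemma psum_part_of X K (f : config X K) l :
  (psum (part_of X K f) l)%:~R = \sum_x (f x)%:R * (x.+1%:R) ^+ l :> R.
Proof.
rewrite /psum (big_part_of _ _ _ (fun a => (a%:Z) ^+ l)) rmorph_sum /=.
by apply: eq_bigr => x _; rewrite rmorphMn rmorphXn /= mulr_natl.
Qed.

Lemma linstat_pow n X K (f : config X K) j :
  linstat R n X K (fun s => s ^+ j) f = (psum (part_of X K f) j)%:~R / root n ^+ j.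
Proof.
rewrite psum_part_of mulr_suml; apply: eq_bigr => x _.
by rewrite /scaled exprMn exprVn mulrA.
Qed.

(** Exchange of the sums over parts and over exponents: the [beta l] act as Lagrange multipliers,
    and the weight sees only the power sums with exponents in [J]. *)
Lemma weight_predT n X K (f : config X K) :
  weight R X K (tilt R X predT (cost n X)) f =
  expR (- \sum_(l <- J) beta l * ((psum (part_of X K f) l)%:~R / root n ^+ l)).
Proof.
rewrite /weight /tilt /=.
under eq_bigr do rewrite -expRM_natl.
rewrite -expR_sum; congr expR; rewrite -sumrN.
under [RHS]eq_bigr do rewrite -linstat_pow -mulrN -sumrN mulr_sumr.
rewrite exchange_big /=; apply: eq_bigr => x _.
rewrite /cost /energy mulrN -mulrN -sumrN mulr_sumr; apply: eq_bigr => l _.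
by ring.
Qed.

Lemma weight_le_predT n X K (A : pred 'I_X) (f : config X K) :
  weight R X K (tilt R X A (cost n X)) f <= weight R X K (tilt R X predT (cost n X)) f.
Proof.
apply: ler_prod => x _; rewrite exprn_ge0 ?tilt_ge0 //=.
rewrite lerXn2r ?nnegrE ?tilt_ge0 // /tilt /=; case: ifP => // _; exact: expR_ge0.
Qed.

Lemma part_of_in_partitions X K (N : nat -> int) (f : config X K) :
  part_of X K f \in partitions J N <-> forall j, j \in J -> psum (part_of X K f) j = N j.
Proof.
rewrite inE; split=> [[_ H] j jJ|H]; first by rewrite -sumn_psum H.
by split=> [|j jJ]; [exact: part_of_partition|rewrite sumn_psum H].
Qed.

Lemma partitions_part_of X K (N : nat -> int) j1 s : j1 \in J -> (0 < j1)%N ->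
  (absz (N j1) <= X)%N -> (absz (N j1) <= K)%N -> partitions J N s ->
  exists f, part_of X K f = s.
Proof.
move=> j1J j10 NX NK [sP /(_ j1 j1J) sN].
have NE : absz (N j1) = sumn [seq (x ^ j1)%N | x <- s] by rewrite -sN.
have [b1 b2] := partition_bounds s j1 sP.2 j10.
apply: part_of_surj => //; last by rewrite (leq_trans b2) // -NE.
by apply: sub_all b1 => a /= ab; rewrite (leq_trans ab) // -NE.
Qed.

Definition partition_mass n X K N : R :=
  \sum_(f : config X K | part_of X K f \in partitions J N) weight R X K (tilt R X predT (cost n X)) f.

(* Adjoining a fixed multiset mu is an injection into the partitions of N which
   changes the Boltzmann weight by a factor depending on mu only. *)
Lemma fiber_mass n X K (A : pred 'I_X) (S : pred (config X K)) (mu : seq nat) (N : nat -> int) (e : R) j1 :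
  all (fun a => 0 < a)%N mu ->
  (forall f j, S f -> j \in J -> psum (part_of X K f) j + psum mu j = N j) ->
  j1 \in J -> (0 < j1)%N -> (absz (N j1) <= X)%N -> (absz (N j1) <= K)%N ->
  \sum_(l <- J) beta l * ((psum mu l)%:~R / root n ^+ l) <= e ->
  \sum_(f | S f) weight R X K (tilt R X A (cost n X)) f <= expR e * partition_mass n X K N.
Proof.
move=> mu0 SN j1J j10 NX NK mue.
pose lam f := sort geq (part_of X K f ++ mu).
(* The default [f] only makes [g] total: on [S] the enlarged multiset is a partition of N, hence
   encoded by a configuration. *)
pose g f := odflt f [pick f' | part_of X K f' == lam f].
have permlam f : perm_eq (lam f) (part_of X K f ++ mu) by rewrite perm_sort.
have gE f : S f -> part_of X K (g f) = lam f.
  move=> Sf; rewrite /g; case: pickP => [f' /eqP //|none].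
  have lamP : partitions J N (lam f).
    split; last by move=> j jJ; rewrite sumn_psum (psum_perm _ _ _ (permlam f)) psum_cat SN.
    split; first by apply: sort_sorted; exact: geq_total.
    by rewrite (perm_all _ (permlam f)) all_cat mu0 (part_of_partition X K f).2.
  have [f' fE] := partitions_part_of _ _ _ _ _ j1J j10 NX NK lamP.
  by have := none f'; rewrite fE eqxx.
have gP f : S f -> part_of X K (g f) \in partitions J N.
  move=> Sf; apply/part_of_in_partitions => j jJ.
  by rewrite gE // (psum_perm _ _ _ (permlam f)) psum_cat SN.
have ginj : {in S &, injective g}.
  move=> f1 f2 S1 S2 /(congr1 (part_of X K)); rewrite !gE // => E.
  have : perm_eq (part_of X K f1 ++ mu) (part_of X K f2 ++ mu).
    by apply: (@perm_trans _ (lam f1)); [rewrite perm_sym|rewrite E].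
  rewrite perm_cat2r => H; apply: (@part_of_inj X K).
  apply: (sorted_eq geq_trans geq_anti) H; exact: (part_of_partition _ _ _).1.
have W0 f : 0 <= weight R X K (tilt R X predT (cost n X)) f.
  by apply: prodr_ge0 => x _; rewrite exprn_ge0 // tilt_ge0.
apply: (@le_trans _ _ (\sum_(f | S f) expR e * weight R X K (tilt R X predT (cost n X)) (g f))).
  apply: ler_sum => f Sf; apply: le_trans (weight_le_predT _ _ _ _ _) _.
  rewrite !weight_predT -expRD ler_expR.
  suff : \sum_(l <- J) beta l * ((psum (part_of X K (g f)) l)%:~R / root n ^+ l) -
         \sum_(l <- J) beta l * ((psum (part_of X K f) l)%:~R / root n ^+ l) <= e by lra.
  apply: le_trans mue; rewrite le_eqVlt; apply/orP; left; apply/eqP.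
  rewrite -sumrB; apply: eq_bigr => l _; rewrite -mulrBr -mulrBl; congr (_ * (_ / _)).
  by rewrite gE // (psum_perm _ _ _ (permlam f)) psum_cat rmorphD /= addrAC subrr add0r.
by rewrite -mulr_sumr ler_wpM2l ?expR_ge0 // sum_inj_le.
Qed.

(** The completion may be chosen as a function of the power sums with exponents in [J]. These take
    at most (Y+1)^(D+1) values, and within one class a single multiset serves all configurations, as
    [fiber_mass] requires. *)
Lemma typical_mass n X K (A : pred 'I_X) (T : pred (config X K)) (N : nat -> int) (e : R) j1 D Y :
  (forall j, j \in J -> (j <= D)%N) -> (forall j, j \in J -> (absz (N j) <= Y)%N) ->
  (forall f, T f -> exists mu, [/\ all (fun a => 0 < a)%N mu,
     forall j, j \in J -> psum (part_of X K f) j + psum mu j = N j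
     & \sum_(l <- J) beta l * ((psum mu l)%:~R / root n ^+ l) <= e]) ->
  j1 \in J -> (0 < j1)%N -> (absz (N j1) <= X)%N -> (absz (N j1) <= K)%N ->
  \sum_(f | T f) weight R X K (tilt R X A (cost n X)) f <=
  (Y.+1 ^ D.+1)%:R * expR e * partition_mass n X K N.
Proof.
move=> JD NY HT j1J j10 NX NK.
pose nu (f : config X K) : {ffun 'I_D.+1 -> 'I_Y.+1} :=
  [ffun j : 'I_D.+1 => if (j : nat) \in J then inord (absz (psum (part_of X K f) j)) else ord0].
have mass0 : 0 <= partition_mass n X K N.
  by apply: sumr_ge0 => f _; apply: prodr_ge0 => x _; rewrite exprn_ge0 // tilt_ge0.
rewrite (partition_big nu xpredT) //=.
apply: (@le_trans _ _ (\sum_(v : {ffun 'I_D.+1 -> 'I_Y.+1}) expR e * partition_mass n X K N)); last first.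
  by rewrite sumr_const card_ffun !card_ord -[X in X <= _]mulr_natl mulrA.
apply: ler_sum => v _.
case: (pickP (fun f => T f && (nu f == v))) => [f0 /andP[Tf0 /eqP nuf0]|none]; last first.
  by rewrite big_pred0 // mulr_ge0 ?expR_ge0.
(* A completion adds nonnegative amounts, so the power sums of f are at most N j; [inord] therefore
   loses nothing. *)
have psum_le f j : T f -> j \in J -> (absz (psum (part_of X K f) j) < Y.+1)%N.
  move=> Tf jJ; have [mu [_ /(_ j jJ) E _]] := HT f Tf.
  rewrite ltnS (leq_trans _ (NY j jJ)) // -lez_nat !gez0_abs ?psum_ge0 //.
    by rewrite -E lerDl psum_ge0.
  by rewrite -E addr_ge0 ?psum_ge0.
have [mu [mu0 muN mue]] := HT f0 Tf0.
apply: (fiber_mass n X K A _ mu N e j1) => // f j /andP[Tf /eqP nuf] jJ.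
rewrite -muN //; congr (_ + _).
have jD : (j < D.+1)%N by rewrite ltnS JD.
have : nu f (Ordinal jD) = nu f0 (Ordinal jD) by rewrite nuf nuf0.
rewrite !ffunE /= jJ => /(congr1 (@nat_of_ord _)); rewrite !inordK ?psum_le // => E.
by rewrite -[LHS]gez0_abs ?psum_ge0 // E gez0_abs ?psum_ge0.
Qed.

End Fibers.

(** * Lower bound for the mass of the partitions *)

Section Completion.
Variable R : realType.

(** A chain of approximations: N ~ a w wj ~ wj S and P ~ wj (S - T), hence N - P ~ wj T ~ wj L Bj ~
    Mj L Bj ~ Wc. Here w is sqrt n, wj and Mj are the j-th powers of w and M, S and T are the sums
    of [bose] over all parts and over the blocks, and Wc is the center with rounded
    multiplicities. *)
Lemma center_estimate (N P a w wj M Mj L eta' S T Bj Om Wc tau om2 kap : R) :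
  0 < w -> 0 < wj -> 0 <= L -> 0 <= eta' -> 0 <= tau -> om2 <= 1 -> 0 <= Bj <= Om ->
  Mj <= wj -> wj <= (1 + om2) * Mj -> w <= 2 * M -> 1 <= Mj ->
  `|N - a * (w * wj)| <= 1 -> `|P / wj - (S - T)| <= eta' * w -> `|S - a * w| <= eta' * w ->
  `|T - L * Bj| <= tau * L -> `|L * Bj * Mj - Wc| <= kap * Mj ->
  `|N - P - Wc| <= (1 + 8 * eta' * M + 2 * tau * L + Om * L * om2 + kap) * Mj.
Proof.
move=> w0 wj0 L0 e0 t0 om1 /andP[Bj0 BjO] Mw wM wM2 M1 h1 h2 h3 h4 h5.
have -> : N - P - Wc = (N - a * (w * wj)) - (P - wj * (S - T)) - wj * (S - a * w)
   + wj * (T - L * Bj) + L * Bj * (wj - Mj) + (L * Bj * Mj - Wc) by ring.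
have Mj0 : 0 < Mj by apply: lt_le_trans M1.
have wj2 : wj <= 2 * Mj by nra.
have M0 : 0 <= M by nra.
have ew : eta' * w * wj <= 4 * eta' * M * Mj.
  have -> : 4 * eta' * M * Mj = eta' * (2 * M) * (2 * Mj) by ring.
  by rewrite ler_pM ?mulr_ge0 ?(ltW w0) ?(ltW wj0) // ler_wpM2l.
have h2' : `|P - wj * (S - T)| <= 4 * eta' * M * Mj.
  have -> : P - wj * (S - T) = (P / wj - (S - T)) * wj by field; exact: lt0r_neq0.
  rewrite normrM (gtr0_norm wj0); apply: le_trans ew; by rewrite ler_wpM2r // ltW.
have h3' : `|wj * (S - a * w)| <= 4 * eta' * M * Mj.
  rewrite normrM (gtr0_norm wj0) mulrC; apply: le_trans ew; by rewrite ler_wpM2r // ltW.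
have h4' : `|wj * (T - L * Bj)| <= 2 * tau * L * Mj.
  rewrite normrM (gtr0_norm wj0).
  apply: (@le_trans _ _ ((2 * Mj) * (tau * L))); last by rewrite le_eqVlt; apply/orP; left; apply/eqP; ring.
  by rewrite ler_pM // ltW.
have h6 : `|L * Bj * (wj - Mj)| <= Om * L * om2 * Mj.
  rewrite normrM !ger0_norm ?mulr_ge0 ?subr_ge0 //.
  have -> : Om * L * om2 * Mj = (L * Om) * (om2 * Mj) by ring.
  apply: ler_pM; rewrite ?mulr_ge0 ?subr_ge0 ?ler_wpM2l //; lra.
have -> : (1 + 8 * eta' * M + 2 * tau * L + Om * L * om2 + kap) * Mj =
  Mj + 4 * eta' * M * Mj + 4 * eta' * M * Mj + 2 * tau * L * Mj + Om * L * om2 * Mj + kap * Mj by ring.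
apply: le_trans (ler_normD _ _) _; apply: lerD => //.
apply: le_trans (ler_normD _ _) _; apply: lerD => //.
apply: le_trans (ler_normD _ _) _; apply: lerD => //.
apply: le_trans (ler_normB _ _) _; apply: lerD => //.
apply: le_trans (ler_normB _ _) _; apply: lerD => //.
exact: le_trans h1 M1.
Qed.

Lemma common_radius (P : nat -> R -> Prop) (m : nat) :
  (forall i, exists2 d, 0 < d & P i d) -> (forall i d d', d' <= d -> P i d -> P i d') ->
  exists2 d, 0 < d & forall i, (i < m)%N -> P i d.
Proof.
move=> HP Hmono; elim: m => [|m [d1 d10 H1]]; first by exists 1.
have [d2 d20 H2] := HP m; exists (Num.min d1 d2); first by rewrite lt_min d10 d20.
move=> i; rewrite ltnS leq_eqVlt => /orP[/eqP ->|im].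
  by apply: Hmono H2; rewrite ge_min lexx orbT.
by apply: Hmono (H1 i im); rewrite ge_min lexx.
Qed.

Variables (J : {fset nat}) (alpha beta : nat -> R).
Hypothesis JP : profile_set J.
Hypothesis HA : assumption1 J alpha beta.
Hypothesis alpha_pos : forall j, j \in J -> 0 < alpha j.
Local Notation root n := (Num.sqrt (n%:R : R)).
Local Notation bose := (bose J beta).

Lemma bose_uniform_near (D : nat) (om : R) : 0 < om -> exists2 d : R, 0 < d &
  forall i j (y : R), (i < D.+1)%N -> (j < D.+1)%N -> `|y - i.+1%:R| < d ->
    `|bose j y - bose j i.+1%:R| <= om.
Proof.
move=> om0.
have inner i : exists2 d : R, 0 < d & forall j, (j < D.+1)%N -> forall y : R, `|y - i.+1%:R| < d ->
    `|bose j y - bose j i.+1%:R| <= om.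
  apply: common_radius => [j|j d d' dd H y yd]; last by apply: H; apply: lt_le_trans dd.
  have i0 : 0 < i.+1%:R :> R by rewrite ltr0n.
  have [d d0 H] := continuous_dist _ _ _ (continuous_bose _ _ _ _ JP HA j _ i0) _ om0.
  by exists d => // y yd; apply/ltW/H.
have [d d0 H] := common_radius (fun i d => forall j, (j < D.+1)%N -> forall y : R, `|y - i.+1%:R| < d ->
    `|bose j y - bose j i.+1%:R| <= om) D.+1 inner
    (fun i d d' dd H j jD y yd => H j jD y (lt_le_trans yd dd)).
by exists d => // i j y iD jD; apply: H.
Qed.

Lemma Nvec_near n j : `|(Nvec alpha n j)%:~R - alpha j * (root n * root n ^+ j)| <= 1.
Proof.
rewrite /Nvec exprS distrC; set x := alpha j * _.
have H1 := floor_le x; have := floorD1_gt x; rewrite intrD => H2.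
by rewrite ger0_norm ?subr_ge0 //; lra.
Qed.

(** The deterministic half of the lower bound: power sums close to their means suffice for a
    completion. [C4] is fixed before [delta0], so short blocks make the cost C4 L an arbitrarily
    small multiple of sqrt n. *)
Lemma typical_completion (D : nat) : (forall j, j \in J -> (j <= D)%N) ->
  exists2 C4 : R, 0 <= C4 & forall delta0 : R, 0 < delta0 ->
  exists delta eta' : R, [/\ 0 < delta, delta <= delta0, 0 < eta' &
  exists n0 : nat, forall n X, (n0 <= n)%N -> (n <= X)%N ->
  exists M L : nat, [/\ (0 < M)%N && (L <= M)%N, (D.+2 * M <= X)%N,
     root n <= 2 * M%:R, L%:R <= delta * root n &
  forall K (f : {ffun 'I_X -> 'I_K.+1}),
    partitions J (Nvec alpha n) !=set0 ->
    (forall j, j \in J ->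
      `|linstat R n X K (fun s => s ^+ j) f -
        linmean R J beta n X (fun x => ~~ in_blocks D M L x) (fun s => s ^+ j)| <= eta' * root n) ->
    exists mu, [/\ all (fun a => 0 < a)%N mu,
      forall j, j \in J -> psum (part_of X K f) j + psum mu j = Nvec alpha n j
      & \sum_(l <- J) beta l * ((psum mu l)%:~R / root n ^+ l) <= C4 * L%:R]]].
Proof.
move=> JD.
have [C0 rep] := power_sum_rep D (fun j => j \in J).
have wi0 i : 0 < bose 0 i.+1%:R.
  have i0 : 0 < i.+1%:R :> R by rewrite ltr0n.
  rewrite /bose expr0 mul1r invr_gt0 subr_gt0 expR_gt1.
  exact: (energy_pos _ _ _ _ JP HA).
have wex i : exists2 d : R, 0 < d & d <= bose 0 i.+1%:R by exists (bose 0 i.+1%:R).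
have wmono i (d d' : R) : d' <= d -> d <= bose 0 i.+1%:R -> d' <= bose 0 i.+1%:R.
  exact: le_trans.
have [wm wm0 wmi] := common_radius (fun i d => d <= bose 0 i.+1%:R) D.+1 wex wmono.
pose Om := \sum_(i < D.+1) bose 0 i.+1%:R * i.+1%:R ^+ D.
have Om0 : 0 <= Om by apply: sumr_ge0 => i _; rewrite mulr_ge0 ?(ltW (wi0 i)) // exprn_ge0.
(* B = floor(eta L) will be the admissible distance to the center; this eta gives C0 B <= wm L / 4,
   which the w_i L copies available at each node can absorb. *)
pose eta := wm / (4 * C0.+1%:R).
have eta0 : 0 < eta by rewrite divr_gt0 // mulr_gt0 // ltr0n.
pose Sb := \sum_(l <- J) `|beta l|.
have Sb0 : 0 <= Sb by apply: sumr_ge0.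
exists (Sb * (Om + eta)); first by apply: mulr_ge0 => //; apply: addr_ge0 => //; exact: ltW.
move=> delta0 delta00.
pose om := eta / (16 * D.+1%:R).
have om0 : 0 < om by rewrite divr_gt0 // mulr_gt0 // ltr0n.
have [d d0 near] := bose_uniform_near D om om0.
(* After rescaling, each block lies within (D+1) delta of its node, where [bose] oscillates by at
   most [om]. *)
pose delta := Num.min (Num.min delta0 2^-1) (d / D.+2%:R).
have delta_gt0 : 0 < delta by rewrite !lt_min delta00 invr_gt0 ltr0n /= divr_gt0 // ltr0n.
have deltale0 : delta <= delta0 by rewrite /delta !ge_min lexx.
have delta2 : delta <= 2^-1 by rewrite /delta !ge_min lexx orbT.
have deltad : D.+1%:R * delta < d.
  have : delta <= d / D.+2%:R by rewrite /delta ge_min lexx orbT.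
  rewrite ler_pdivlMr ?ltr0n // => H; apply: lt_le_trans H.
  by rewrite mulrC ltr_pM2l // ltr_nat.
(* Error budget of [center_estimate]: the concentration error 8 eta' M, the oscillation 2(D+1) om L
   and the change of scale Om om2 L are each at most eta L / 8. *)
pose eta' := eta * delta / 128.
have eta'0 : 0 < eta' by apply: divr_gt0 => //; apply: mulr_gt0.
exists delta, eta'; split=> //.
pose om2 := Num.min 1 (eta / (8 * (Om + 1))).
have om20 : 0 < om2 by rewrite lt_min ltr01 divr_gt0 // mulr_gt0 // ltr_pwDr.
have om21 : om2 <= 1 by rewrite /om2 ge_min lexx.
have Omom2 : Om * om2 <= eta / 8.
  have : om2 <= eta / (8 * (Om + 1)) by rewrite /om2 ge_min lexx orbT.
  rewrite ler_pdivlMr ?mulr_gt0 ?ltr_pwDr // => H.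
  have := ltW om20; nra.
pose e := Num.min delta (om2 / (2 * D.+1%:R)).
have e0 : 0 < e by rewrite lt_min delta_gt0 divr_gt0 // mulr_gt0 // ltr0n.
have edelta : e <= delta by rewrite /e ge_min lexx.
have eD : D%:R * e <= om2 / 2.
  have : e <= om2 / (2 * D.+1%:R) by rewrite /e ge_min lexx orbT.
  rewrite ler_pdivlMr ?mulr_gt0 ?ltr0n // => H.
  have : D%:R * e <= D.+1%:R * e by rewrite ler_wpM2r ?(ltW e0) // ler_nat.
  lra.
pose kap : R := (D.+1 * D.+1 ^ D)%:R.
have kap0 : 0 <= kap by [].
(* Makes rounding negligible: eta L >= 2 + 8(1 + kap) and wm L >= 4. *)
pose Lmin := 2 / eta + 8 * (1 + kap) / eta + 4 / wm.
have Lmin0 : 0 < Lmin.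
  rewrite /Lmin addr_gt0 ?divr_gt0 // ltr_pwDl ?divr_gt0 // divr_ge0 ?(ltW eta0) //.
  by rewrite mulr_ge0 // addr_ge0.
(* The terms ensure, in this order, delta M >= 2, L >= Lmin and C0 H^D <= wm L / 4, the last because
   H^D = M/H. *)
pose Hb : R := 2 / delta + 2 * Lmin / delta + 8 * C0%:R / (delta * wm) + 1.
have [n1 Hn1] := power_scale R D (Num.bound `|Hb|) e e0.
have [n2 Hn2] := root_large R D.+2%:R.
have [n3 Hn3] := eventually_forall_lt (fun j n => j \in J -> forall X, (n <= X)%N ->
   `|\sum_(x < X) bose j (x.+1%:R / root n) / root n - alpha j| <= eta') D.+1
   (fun j => match boolP (j \in J) with
     | AltTrue jJ => let: ex_intro n0 H := riemann_bose _ _ _ _ JP HA j eta' jJ eta'0 in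
          ex_intro _ n0 (fun n h _ X => H n X h)
     | AltFalse nJ => ex_intro _ 0%N (fun n h jJ => False_ind _ (negP nJ jJ)) end).
exists (maxn 1 (maxn n1 (maxn n2 n3))) => n X.
rewrite !geq_max => /and4P[n_gt0 nn1 nn2 nn3] nX.
have w0 := root_gt0 R n n_gt0.
move: (Hn2 n nn2) => wD.
have [H [HHb HM MH]] := Hn1 n nn1.
move: HM MH w0 wD; set w := root n => HM MH w0 wD.
have HbH : Hb <= H%:R.
  apply: le_trans (ler_norm _) _; apply/ltW; apply: lt_le_trans (archi_boundP (normr_ge0 _)) _.
  by rewrite ler_nat.
have t1 : 0 < 2 / delta by rewrite divr_gt0.
have t2 : 0 < 2 * Lmin / delta by rewrite divr_gt0 // mulr_gt0.
have t3 : 0 <= 8 * C0%:R / (delta * wm) by rewrite divr_ge0 ?mulr_ge0 // ltW.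
have H1 : 1 <= H%:R :> R by move: HbH t1 t2 t3; rewrite /Hb; clear => *; lra.
have H0 : (0 < H)%N by rewrite -(ler_nat R).
pose M := (H ^ D.+1)%N.
have M0 : (0 < M)%N by rewrite expn_gt0 H0.
have M0R : 0 < M%:R :> R by rewrite ltr0n.
have HMle : H%:R <= M%:R :> R by rewrite ler_nat -{1}[H]expn1 leq_pexp2l.
pose L := Num.truncn (delta * M%:R).
have dM0 : 0 <= delta * M%:R by rewrite mulr_ge0 // ltW.
have /andP[Lle Lgt] : L%:R <= delta * M%:R < L.+1%:R by apply: truncn_itv.
have dM2 : 2 <= delta * M%:R.
  rewrite mulrC -ler_pdivrMr //; apply: le_trans HMle.
  by move: HbH t1 t2 t3; rewrite /Hb; clear => *; lra.
have L2 : delta * M%:R <= 2 * L%:R by move: Lgt dM2; rewrite -natr1; clear => *; lra.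
have LLmin : Lmin <= L%:R.
  have : 2 * Lmin / delta <= M%:R.
    by apply: le_trans HMle; move: HbH t1 t2 t3; rewrite /Hb; clear => *; lra.
  by rewrite ler_pdivrMr // mulrC; move: L2; clear => *; lra.
have L0 : 0 < L%:R :> R by apply: lt_le_trans LLmin.
have LM : (L <= M)%N.
  by rewrite -(ler_nat R) (le_trans Lle) // ler_piMl // (le_trans delta2) // invf_le1 // ler1n.
have wM : w <= 2 * M%:R by move: MH (le_trans edelta delta2) w0; rewrite -/M; clear => *; nra.
exists M, L; split=> //.
- by rewrite M0 LM.
- rewrite -(ler_nat R) natrM; apply: (@le_trans _ _ n%:R); last by rewrite ler_nat.
  rewrite -[n%:R]sqr_sqrtr // -/w expr2 ler_pM //.
- by apply: le_trans Lle _; rewrite ler_wpM2l // ltW.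
move=> K f [lam0 lam0P] ftyp.
pose W i := Num.truncn (bose 0 i.+1%:R * L%:R).
have Witv i : (W i)%:R <= bose 0 i.+1%:R * L%:R < (W i).+1%:R.
  by apply: truncn_itv; rewrite mulr_ge0 // ltW.
pose B := Num.truncn (eta * L%:R).
have /andP[Ble Bgt] : B%:R <= eta * L%:R < B.+1%:R.
  by apply: truncn_itv; rewrite mulr_ge0 // ltW.
have etaL : 2 + 8 * (1 + kap) <= eta * L%:R.
  have -> : 2 + 8 * (1 + kap) = eta * (2 / eta + 8 * (1 + kap) / eta) by field; exact: lt0r_neq0.
  rewrite ler_wpM2l ?(ltW eta0) //; apply: le_trans LLmin; rewrite /Lmin lerDl.
  by rewrite divr_ge0 // ltW.
have wmL : 4 <= wm * L%:R.
  have -> : 4 = wm * (4 / wm) by field; exact: lt0r_neq0.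
  rewrite ler_wpM2l ?(ltW wm0) //; apply: le_trans LLmin; rewrite /Lmin lerDr.
  by apply: addr_ge0; apply: divr_ge0; rewrite ?(ltW eta0) //; apply: mulr_ge0 => //; apply: addr_ge0.
have Wcond i : (i <= D)%N -> (C0 * (B + H ^ D) <= W i)%N.
  move=> iD; rewrite -(ler_nat R) natrM natrD.
  have wmiL : wm * L%:R <= bose 0 i.+1%:R * L%:R by rewrite ler_wpM2r // wmi.
  have /andP[_ Wgt] := Witv i; rewrite -[(W i).+1%:R]natr1 in Wgt.
  have c1 : C0%:R * B%:R <= wm * L%:R / 4.
    apply: (@le_trans _ _ (C0%:R * (eta * L%:R))); first by rewrite ler_wpM2l.
    rewrite mulrA [X in _ <= X]mulrAC ler_wpM2r //.
    apply: (@le_trans _ _ (C0.+1%:R * eta)); first by rewrite ler_wpM2r ?(ltW eta0) // ler_nat.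
    rewrite /eta le_eqVlt; apply/orP; left; apply/eqP.
    by field; rewrite /= addrC natr1 pnatr_eq0.
  have c2 : C0%:R * (H ^ D)%:R <= wm * L%:R / 4.
    have hd : 8 * C0%:R <= H%:R * (delta * wm).
      by rewrite -ler_pdivrMr ?mulr_gt0 //; move: HbH t1 t2; rewrite /Hb; clear => *; lra.
    have ME : M%:R = H%:R * (H ^ D)%:R :> R by rewrite /M expnS natrM.
    have h0 : 0 <= (H ^ D)%:R :> R by [].
    have : 8 * C0%:R * (H ^ D)%:R <= wm * (delta * M%:R).
      have -> : wm * (delta * M%:R) = H%:R * (delta * wm) * (H ^ D)%:R by rewrite ME; ring.
      by rewrite ler_wpM2r.
    have : wm * (delta * M%:R) <= wm * (2 * L%:R) by rewrite ler_wpM2l // ltW.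
    by clear => *; lra.
  by rewrite mulrDr; move: c1 c2 Wgt wmiL wmL; clear => *; lra.
pose m j := Nvec alpha n j - psum (part_of X K f) j.
(* Any one partition of N shows that the deficit [m] lies in the lattice. *)
have mE j : j \in J -> m j = psum lam0 j - psum (part_of X K f) j.
  by move=> jJ; rewrite /m -(lam0P.2 j jJ) sumn_psum.
pose Wc j : R := \sum_(i < D.+1) (W i)%:R * (i.+1 * M)%:R ^+ j.
have Mj1 j : 1 <= M%:R ^+ j :> R by rewrite exprn_ege1 // ler1n.
have Bjle j : j \in J -> 0 <= \sum_(i < D.+1) bose 0 i.+1%:R * i.+1%:R ^+ j <= Om.
  move=> jJ; apply/andP; split.
    by apply: sumr_ge0 => i _; rewrite mulr_ge0 ?(ltW (wi0 i)) // exprn_ge0.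
  apply: ler_sum => i _; rewrite ler_wpM2l ?(ltW (wi0 i)) // ler_weXn2l ?ler1n //.
  exact: JD.
(* The spare 1 pays for rounding eta L down to [B]. *)
have near_center j : j \in J -> `|(m j)%:~R - Wc j| <= (eta * L%:R - 1) * M%:R ^+ j.
  move=> jJ.
  pose S := \sum_(x < X) bose j (scaled R n X x).
  pose T := \sum_(x < X | in_blocks D M L x) bose j (scaled R n X x).
  have wj0 : 0 < w ^+ j by rewrite exprn_gt0.
  have wjle : w ^+ j <= (1 + om2) * M%:R ^+ j.
    have e1 : e <= 1 by move: edelta delta2; clear => *; lra.
    have jDe : 1 - D%:R * e <= (1 - e) ^+ j.
      apply: le_trans (bernoulli_sub R e j _); last by rewrite (ltW e0) e1.
      by rewrite lerD2l lerN2 ler_wpM2r ?(ltW e0) // ler_nat JD.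
    have : ((1 - e) * w) ^+ j <= M%:R ^+ j.
      by rewrite lerXn2r ?nnegrE ?mulr_ge0 ?subr_ge0 ?(ltW w0).
    rewrite exprMn => H3.
    have H4 : (1 - om2 / 2) * w ^+ j <= M%:R ^+ j.
      by apply: le_trans H3; rewrite ler_wpM2r ?(ltW wj0) //; move: jDe eD; clear => *; lra.
    apply: (@le_trans _ _ ((1 + om2) * ((1 - om2 / 2) * w ^+ j))); last first.
      by rewrite ler_wpM2l // addr_ge0 // ltW.
    by rewrite mulrA ler_peMl ?(ltW wj0) //; move: om20 om21; clear => *; nra.
  have est := @center_estimate (Nvec alpha n j)%:~R (psum (part_of X K f) j)%:~R (alpha j)
    w (w ^+ j) M%:R (M%:R ^+ j) L%:R eta' S T (\sum_(i < D.+1) bose 0 i.+1%:R * i.+1%:R ^+ j) Om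
    (Wc j) (D.+1%:R * om) om2 kap w0 wj0 (ltW L0) (ltW eta'0) _ om21 (Bjle j jJ) _ wjle wM (Mj1 j)
    (Nvec_near n j) _ _ _ _.
  rewrite /m rmorphB /=; apply: le_trans (est _ _ _ _ _ _) _.
  - by rewrite mulr_ge0 // ltW.
  - by rewrite lerXn2r ?nnegrE // ltW.
  - have := ftyp j jJ; rewrite linstat_pow.
    have -> : linmean R J beta n X (fun x => ~~ in_blocks D M L x) (fun s => s ^+ j) = S - T.
      rewrite /S (bigID (fun x : 'I_X => in_blocks D M L x)) /= -/T addrAC subrr add0r.
      by [].
    by [].
  - have := Hn3 j n (JD j jJ) nn3 jJ X nX; rewrite -mulr_suml.
    rewrite -[\sum_(x < X) _]/S => H3.
    have -> : S - alpha j * w = (S / w - alpha j) * w by field; exact: lt0r_neq0.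
    by rewrite normrM (gtr0_norm w0) ler_wpM2r // ltW.
  - have TE : T = \sum_(i < D.+1) \sum_(l < L) bose j ((i.+1 * M + l).+1%:R / w).
      rewrite /T -(sum_in_blocks _ D M L X (fun x => bose j (x.+1%:R / w))) //.
      rewrite -(ler_nat R) natrM; apply: (@le_trans _ _ n%:R); last by rewrite ler_nat.
      by rewrite -[n%:R]sqr_sqrtr // -/w expr2 ler_pM.
    rewrite TE mulr_sumr -sumrB; apply: le_trans (ler_norm_sum _ _ _) _.
    rewrite -mulrA mulr_natl -[D.+1 in X in _ <= X]card_ord -sumr_const.
    apply: ler_sum => i _.
    have -> : L%:R * (bose 0 i.+1%:R * i.+1%:R ^+ j) = \sum_(l < L) bose j i.+1%:R.
      rewrite sumr_const card_ord -[RHS]mulr_natl; congr (_ * _).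
      by rewrite /bose expr0 mul1r mulrC.
    rewrite -sumrB; apply: le_trans (ler_norm_sum _ _ _) _.
    rewrite mulrC mulr_natl -[L in X in _ <= X]card_ord -sumr_const.
    apply: ler_sum => l _; apply: near => //; first by rewrite ltnS JD.
    apply: le_lt_trans deltad.
    have lL : l.+1%:R <= delta * M%:R by apply: le_trans Lle; rewrite ler_nat.
    have -> : (i.+1 * M + l).+1%:R = i.+1%:R * M%:R + l.+1%:R :> R.
      by rewrite -addnS natrD natrM.
    have iD : i.+1%:R <= D.+1%:R :> R by rewrite ler_nat.
    have i1 : 1 <= i.+1%:R :> R by rewrite ler1n.
    have dw : delta * M%:R <= delta * w by rewrite ler_wpM2l // ltW.
    rewrite ler_norml; apply/andP; split.
      rewrite lerBrDl ler_pdivlMr //.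
      have : i.+1%:R * ((1 - e) * w) <= i.+1%:R * M%:R by rewrite ler_wpM2l.
      have : i.+1%:R * e * w <= D.+1%:R * delta * w.
        by rewrite ler_wpM2r ?(ltW w0) // ler_pM ?(ltW e0).
      have : 0 <= l.+1%:R :> R by [].
      by clear => *; lra.
    rewrite lerBlDl ler_pdivrMr //.
    have : i.+1%:R * M%:R <= i.+1%:R * w by rewrite ler_wpM2l.
    have : delta * w <= D.+1%:R * delta * w.
      by rewrite ler_wpM2r ?(ltW w0) // ler_peMl ?(ltW delta_gt0) // ler1n.
    by move: lL dw; clear => *; lra.
  - rewrite /Wc mulr_sumr mulr_suml -sumrB; apply: le_trans (ler_norm_sum _ _ _) _.
    have -> : kap * M%:R ^+ j = \sum_(i < D.+1) (D.+1 ^ D)%:R * M%:R ^+ j.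
      by rewrite sumr_const card_ord -[RHS]mulr_natl /kap natrM mulrA.
    apply: ler_sum => i _.
    have -> : L%:R * (bose 0 i.+1%:R * i.+1%:R ^+ j) * M%:R ^+ j - (W i)%:R * (i.+1 * M)%:R ^+ j
      = (bose 0 i.+1%:R * L%:R - (W i)%:R) * (i.+1%:R ^+ j * M%:R ^+ j).
      by rewrite natrM exprMn; ring.
    have /andP[W1 W2] := Witv i; rewrite -[(W i).+1%:R]natr1 in W2.
    rewrite normrM !ger0_norm ?mulr_ge0 ?exprn_ge0 ?subr_ge0 //.
    rewrite -[X in _ <= X]mul1r ler_pM ?mulr_ge0 ?exprn_ge0 ?subr_ge0 //; first by move: W2; clear => *; lra.
    rewrite ler_wpM2r ?exprn_ge0 // -natrX ler_nat.
    apply: (@leq_trans (D.+1 ^ j)%N); last by rewrite leq_pexp2l // JD.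
    by have [->//|j0] := posnP j; rewrite leq_exp2r.
  rewrite ler_wpM2r ?exprn_ge0 //.
  have p1 : 8 * eta' * M%:R <= eta / 8 * L%:R.
    have -> : 8 * eta' * M%:R = eta / 16 * (delta * M%:R) by rewrite /eta'; field.
    have : eta / 16 * (delta * M%:R) <= eta / 16 * (2 * L%:R) by rewrite ler_wpM2l // divr_ge0 // ltW.
    by clear => *; lra.
  have p2 : 2 * (D.+1%:R * om) * L%:R = eta / 8 * L%:R.
    by rewrite /om; field; rewrite /= addrC natr1 pnatr_eq0.
  have p3 : Om * L%:R * om2 <= eta / 8 * L%:R.
    by rewrite mulrAC ler_wpM2r.
  by move: p1 p2 p3 etaL kap0; clear => *; lra.
have nearB j : j \in J -> `|m j - \sum_(i < D.+1) (W i)%:Z * ((i.+1 * H ^ D.+1)%N%:Z) ^+ j|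
       <= B%:Z * ((H ^ D.+1)%N%:Z) ^+ j.
  move=> jJ; rewrite -(ler_int R) intr_norm rmorphB rmorph_sum rmorphM rmorphXn /= -/M.
  under eq_bigr do rewrite rmorphM rmorphXn /=.
  apply: le_trans (near_center j jJ) _; rewrite ler_wpM2r ?exprn_ge0 //.
  by rewrite lerBlDr natr1 ltW.
have [mu mu0 muE] := rep H B W m lam0 (part_of X K f) H0 JD Wcond mE nearB.
exists mu; split=> // [j jJ|]; first by rewrite muE // /m addrC subrK.
(* The power sums of the completion are at most center plus radius, (Om + eta) L M^l, and M <= sqrt
   n. *)
rewrite -mulrA mulr_suml big_seq [X in _ <= X]big_seq; apply: ler_sum => l lJ.
apply: le_trans (ler_norm _) _; rewrite normrM ler_wpM2l // normrM normfV.
have wl0 : 0 < w ^+ l by rewrite exprn_gt0.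
rewrite (gtr0_norm wl0) ler_pdivrMr // muE //.
have Wc0 : 0 <= Wc l by apply: sumr_ge0 => i _; rewrite mulr_ge0 ?exprn_ge0.
have WcO : Wc l <= Om * L%:R * M%:R ^+ l.
  apply: (@le_trans _ _ ((\sum_(i < D.+1) bose 0 i.+1%:R * i.+1%:R ^+ l) * L%:R * M%:R ^+ l)).
    rewrite /Wc !mulr_suml; apply: ler_sum => i _; rewrite natrM exprMn mulrA.
    rewrite ler_wpM2r ?exprn_ge0 // mulrAC ler_wpM2r ?exprn_ge0 //.
    by have /andP[] := Witv i.
  by rewrite ler_wpM2r ?exprn_ge0 // ler_wpM2r // ; case/andP: (Bjle l lJ).
have Mw : M%:R ^+ l <= w ^+ l by rewrite lerXn2r ?nnegrE // ltW.
apply: (@le_trans _ _ ((Om + eta) * L%:R * M%:R ^+ l)); last first.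
  by rewrite ler_wpM2l // mulr_ge0 // addr_ge0 // ltW.
have := near_center l lJ; rewrite ler_distl => /andP[h1 h2].
have := Mj1 l; rewrite ler_norml; move: h1 h2 Wc0 WcO; clear => *; apply/andP; split; lra.
Qed.

Local Notation cost := (cost R J beta).
Local Notation partfun X t := (\prod_(x < X) (1 - t x)^-1).

(** Allowing a part of cost q again multiplies the normalisation by 1/(1 - e^(-q)). Parts in the
    blocks exceed M >= sqrt n / 2, so q >= q0 = c/2^D0 and each of the (D+1)L factors is at most K3
    <= e^K3. *)
Lemma partfun_blocks (D : nat) : exists2 K3 : R, 0 < K3 & forall n X M L : nat, (0 < n)%N ->
  (0 < M)%N -> (L <= M)%N -> (D.+2 * M <= X)%N -> root n <= 2 * M%:R ->
  partfun X (tilt R X predT (cost n X)) <=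
  partfun X (tilt R X (fun x => ~~ in_blocks D M L x) (cost n X)) * expR (K3 * D.+1%:R * L%:R).
Proof.
have [c c0 [cJ _]] := energy_lower _ _ _ _ JP HA.
have [D0 [_ DJ _]] := max_degree _ JP.
pose q0 := c * 2^-1 ^+ D0.
have q00 : 0 < q0 by apply: mulr_gt0 => //; apply: exprn_gt0; rewrite invr_gt0.
have e0 : 0 < 1 - expR (- q0) by rewrite subr_gt0 expR_lt1 oppr_lt0.
exists (1 - expR (- q0))^-1; first by rewrite invr_gt0.
set K3 := _^-1 => n X M L n0 M0 LM MX wM.
have w0 := root_gt0 R n n0.
have -> : expR (K3 * D.+1%:R * L%:R) = \prod_(x < X) (if in_blocks D M L x then expR K3 else 1).
  rewrite -big_mkcond -expR_sum; congr expR.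
  rewrite (sum_in_blocks _ D M L X (fun _ => K3)) // !sumr_const !card_ord -mulrnA -[RHS]mulr_natr natrM.
  by ring.
rewrite -big_split /=; apply: ler_prod => x _.
have q1 := tilt_lt1 R X predT (cost n X) (fun x => cost_gt0 R J alpha beta JP HA n X x n0) x.
rewrite invr_ge0 subr_ge0 (ltW q1) /=; rewrite /tilt /=.
case: (boolP (in_blocks D M L x)) => [Bx|_] /=; last by rewrite mulr1.
rewrite subr0 invr1 mul1r; apply: (@le_trans _ _ K3); last by have := expR_ge1Dx K3; lra.
move: q1; rewrite /tilt /= => q1.
rewrite lef_pV2 ?posrE // ?subr_gt0 //  lerD2l lerN2 ler_expR lerN2.
have s0 := scaled_gt0 R n X x n0.
apply: le_trans (cJ _ D0 (ltW s0) DJ); rewrite ler_wpM2l ?(ltW c0) //.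
rewrite lerXn2r ?nnegrE ?invr_ge0 ?(ltW s0) //.
rewrite ler_pdivlMr // ler_pdivrMl //; apply: le_trans wM _; rewrite ler_wpM2l // ler_nat.
move: Bx => /andP[/andP[q _] _]; rewrite -[M]mul1n.
by rewrite (@leq_trans (x %/ M * M)%N) ?leq_mul // (leq_trans (leq_trunc_div _ _)).
Qed.

Lemma Nvec_bound (D n j Y : nat) : 1 <= root n -> (j <= D)%N -> j \in J ->
  (\sum_(i <- J) alpha i) * root n ^+ D.+1 < Y.+1%:R -> (absz (Nvec alpha n j) <= Y)%N.
Proof.
move=> w1 jD jJ HY; rewrite -ltnS -(ltr_nat R); apply: le_lt_trans HY.
have aj0 := ltW (alpha_pos j jJ).
have w0 : 0 <= root n by apply: le_trans w1.
have N0 : 0 <= Nvec alpha n j by rewrite floor_ge0 mulr_ge0 // exprn_ge0.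
have -> : (absz (Nvec alpha n j))%:R = (Nvec alpha n j)%:~R :> R.
  by rewrite -[X in X%:~R]gez0_abs.
apply: le_trans (floor_le _) _; apply: ler_pM => //; rewrite ?exprn_ge0 //.
  rewrite (big_rem j jJ) /= lerDl big_seq; apply: sumr_ge0 => i /mem_rem iJ.
  exact/ltW/alpha_pos.
by apply: ler_weXn2l.
Qed.

(** Forbidding the blocks costs exp(K3 (D+1) L) and completing costs exp(C4 L), with L <= delta sqrt
    n: for delta <= rho/(2E) they use half of the budget rho. The other half absorbs the polynomial
    number of classes of [typical_mass]. *)
Lemma partition_mass_lower (rho : R) : 0 < rho -> exists n0 : nat, forall n X K j1,
  (n0 <= n)%N -> (n <= X)%N -> 2 * \sum_(x < X) (cost n X x)^-1 <= K.+1%:R ->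
  j1 \in J -> (0 < j1)%N ->
  (absz (Nvec alpha n j1) <= X)%N -> (absz (Nvec alpha n j1) <= K)%N ->
  partitions J (Nvec alpha n) !=set0 ->
  partfun X (tilt R X predT (cost n X)) * expR (- (rho * root n)) <=
  partition_mass R J beta n X K (Nvec alpha n).
Proof.
move=> rho0.
have [D [_ DJ Dmax]] := max_degree _ JP.
have [c c0 [cJ _]] := energy_lower _ _ _ _ JP HA.
have [K3 K30 HK3] := partfun_blocks D.
have [C4 C40 HC4] := typical_completion D Dmax.
pose E := K3 * D.+1%:R + C4 + 1.
have E0 : 0 < E by rewrite ltr_pwDr // addr_ge0 // mulr_ge0 // ltW.
have d00 : 0 < rho / (2 * E) by rewrite divr_gt0 // mulr_gt0.
have [delta [eta' [delta_gt0 deltale eta'0 [n1 Hn1]]]] := HC4 _ d00.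
have [c' c'0 conc] := concentration R J alpha beta JP HA c eta' c0 eta'0.
pose a := \sum_(i <- J) alpha i.
have a0 : 0 <= a by rewrite /a big_seq; apply: sumr_ge0 => i iJ; exact/ltW/alpha_pos.
have rho20 : 0 < rho / 2 by rewrite divr_gt0.
have [n2 Hn2] := poly_le_expR R (4 * (a + 1) ^+ D.+1) (rho / 2) (D.+1 * D.+1) rho20.
have [n3 Hn3] := poly_le_expR R (8 * D.+1%:R) c' 0 c'0.
have [n4 Hn4] := root_large R 1.
exists (maxn 1 (maxn n1 (maxn n2 (maxn n3 n4)))) => n X K j1.
rewrite !geq_max => /and5P[n_gt0 nn1 nn2 nn3 nn4] nX HK j1J j10 NX NK Pne.
have w1 := Hn4 n nn4; have w0 := root_gt0 R n n_gt0.
have [M [L [/andP[M0 LM] MX wM Lw compl]]] := Hn1 n X nn1 nX.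
set A := fun x : 'I_X => ~~ in_blocks D M L x in compl.
pose ZA := partfun X (tilt R X A (cost n X)).
have ZA0 : 0 <= ZA by exact: (partfun_ge0 R J alpha beta JP HA).
pose W f := weight R X K (tilt R X A (cost n X)) f.
have W0 f : 0 <= W f by exact: weight_ge0.
pose dev j (f : {ffun 'I_X -> 'I_K.+1}) :=
  `|linstat R n X K (fun s => s ^+ j) f - linmean R J beta n X A (fun s => s ^+ j)|.
pose T f := all (fun j => dev j f <= eta' * root n) J.
pose Bi j f := (j \in J) && (eta' * root n <= dev j f).
have atyp : \sum_(f | ~~ T f) W f <= D.+1%:R * (2 * ZA * expR (- (c' * root n))).
  have HB f : ~~ T f -> exists2 j, (j < D.+1)%N & Bi j f.
    move=> /allPn[j jJ]; rewrite -ltNge => /ltW dj.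
    by exists j; [rewrite ltnS Dmax|rewrite /Bi jJ].
  apply: le_trans (union_bound _ _ _ _ D.+1 Bi W0 HB) _.
  rewrite mulr_natl -[D.+1 in X in _ <= X]card_ord -sumr_const; apply: ler_sum => j _.
  have [jJ|nJ] := boolP ((j : nat) \in J); last first.
    rewrite big_pred0 => [|f]; last by rewrite /Bi (negbTE nJ).
    by rewrite !mulr_ge0 ?expR_ge0.
  rewrite /Bi jJ /=; apply: conc => // s s0.
  by rewrite ger0_norm ?exprn_ge0 ?(ltW s0) // ler_pdivlMr // mulrC cJ // ltW.
have cost0 x : 0 < cost n X x by exact: (cost_gt0 R J alpha beta JP HA).
have tot := total_weight_ge R X K A (cost n X) cost0 HK.
have expsmall : 8 * D.+1%:R * expR (- (c' * root n)) <= 1.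
  by rewrite expRN ler_pdivrMr ?expR_gt0 // mul1r; have := Hn3 n nn3; rewrite expr0 mulr1.
(* Truncation at K keeps half of [ZA], and atypical configurations take at most a quarter of it. *)
have typ : ZA / 4 <= \sum_(f | T f) W f.
  move: tot; rewrite (bigID T) /= -/ZA -/W => tot.
  have : D.+1%:R * (2 * ZA * expR (- (c' * root n))) <= ZA / 4.
    have -> : D.+1%:R * (2 * ZA * expR (- (c' * root n))) =
       (ZA / 4) * (8 * D.+1%:R * expR (- (c' * root n))) by field.
    by rewrite ler_piMr // divr_ge0.
  by move: tot atyp; clear => *; lra.
pose Y := Num.truncn (a * root n ^+ D.+1).
have aw0 : 0 <= a * root n ^+ D.+1 by rewrite mulr_ge0 // exprn_ge0 // ltW.
have /andP[Yle Ygt] : Y%:R <= a * root n ^+ D.+1 < Y.+1%:R by apply: truncn_itv.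
have YP : (Y.+1 ^ D.+1)%:R <= (a + 1) ^+ D.+1 * root n ^+ (D.+1 * D.+1) :> R.
  rewrite exprM -exprMn natrX lerXn2r ?nnegrE ?mulr_ge0 ?addr_ge0 ?exprn_ge0 ?(ltW w0) //.
  by rewrite -natr1 mulrDl mul1r lerD // exprn_ege1.
have := typical_mass R J beta n X K A T (Nvec alpha n) (C4 * L%:R) j1 D Y Dmax
  (fun j jJ => Nvec_bound D n j Y w1 (Dmax j jJ) jJ Ygt) _ j1J j10 NX NK.
set mass := partition_mass _ _ _ _ _ _ _ => Htyp.
have mass0 : 0 <= mass by apply: sumr_ge0 => f _; exact: weight_ge0.
have ZAle : ZA / 4 <= (Y.+1 ^ D.+1)%:R * expR (C4 * L%:R) * mass.
  apply: le_trans typ _; apply: Htyp => f Tf.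
  have [mu [m1 m2 m3]] := compl K f Pne (fun j jJ => allP Tf j jJ).
  by exists mu; split.
have Zle := HK3 n X M L n_gt0 M0 LM MX wM; rewrite -/A -/ZA in Zle.
rewrite expRN ler_pdivrMr ?expR_gt0 //; apply: le_trans Zle _.
apply: (@le_trans _ _ (4 * ((Y.+1 ^ D.+1)%:R * expR (C4 * L%:R) * mass) * expR (K3 * D.+1%:R * L%:R))).
  by rewrite ler_wpM2r ?expR_ge0 //; move: ZAle; clear => *; lra.
have -> : 4 * ((Y.+1 ^ D.+1)%:R * expR (C4 * L%:R) * mass) * expR (K3 * D.+1%:R * L%:R) =
  mass * ((4 * (Y.+1 ^ D.+1)%:R) * expR (K3 * D.+1%:R * L%:R + C4 * L%:R)).
  by rewrite expRD; ring.
rewrite ler_wpM2l //.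
have -> : rho * root n = rho / 2 * root n + rho / 2 * root n by field.
rewrite [X in _ <= X]expRD; apply: ler_pM; rewrite ?mulr_ge0 ?expR_ge0 //.
  by apply: le_trans (Hn2 n nn2); rewrite -mulrA ler_wpM2l.
rewrite ler_expR -mulrDl.
have dE : delta * E <= rho / 2.
  move: deltale; rewrite ler_pdivlMr ?mulr_gt0 //; clear => *; lra.
apply: (@le_trans _ _ (E * (delta * root n))); last first.
  by rewrite mulrA ler_wpM2r ?(ltW w0) // mulrC.
by apply: ler_pM => //; [rewrite addr_ge0 // mulr_ge0 // ltW|rewrite /E lerDl].
Qed.

End Completion.

(** * Conclusion *)

(* All partitions of N have the same Boltzmann weight, so the uniform law on them
   is the conditioned Boltzmann law. *)
Lemma unif_prob_mass (R : realType) (J : {fset nat}) (beta : nat -> R) (n X K j1 : nat)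
  (N : nat -> int) (E : set (seq nat)) : j1 \in J -> (0 < j1)%N ->
  (absz (N j1) <= X)%N -> (absz (N j1) <= K)%N ->
  unif_prob R (partitions J N) E * partition_mass R J beta n X K N <=
  \sum_(f : {ffun 'I_X -> 'I_K.+1} | part_of X K f \in E)
     weight R X K (tilt R X predT (cost R J beta n X)) f.
Proof.
move=> j1J j10 NX NK; pose P := partitions J N.
have surj := partitions_part_of J X K N j1 _ j1J j10 NX NK.
pose W f := weight R X K (tilt R X predT (cost R J beta n X)) f.
pose p := expR (- \sum_(l <- J) beta l * ((N l)%:~R / Num.sqrt n%:R ^+ l)).
have W0 f : 0 <= W f by exact: weight_ge0.
have Wp f : part_of X K f \in P -> W f = p.
  move=> /part_of_in_partitions fP; rewrite /W weight_predT /p; congr (expR (- _)).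
  by rewrite big_seq [RHS]big_seq; apply: eq_bigr => l lJ; rewrite fP.
have sum_card (Q : set (seq nat)) : Q `<=` P ->
    \sum_(f : {ffun 'I_X -> 'I_K.+1} | part_of X K f \in Q) W f = (#|` fset_set Q|)%:R * p.
  move=> QP; rewrite (card_partitions X K) => [|s /QP /surj //].
  rewrite (eq_bigr (fun _ => p)) => [|f fQ]; last by rewrite Wp //; apply/mem_set/QP/set_mem.
  by rewrite sumr_const mulr_natl.
have massE : partition_mass R J beta n X K N = (#|` fset_set P|)%:R * p by exact: sum_card.
have PE : P `&` E `<=` P by move=> s [].
apply: (@le_trans _ _ (\sum_(f : {ffun 'I_X -> 'I_K.+1} | part_of X K f \in P `&` E) W f)).
  rewrite sum_card // massE /unif_prob -/P mulrA ler_wpM2r ?expR_ge0 //.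
  have [->|nz] := eqVneq (#|` fset_set P|) 0%N; first by rewrite mulr0.
  by rewrite divfK // pnatr_eq0.
rewrite big_mkcond [X in _ <= X]big_mkcond; apply: ler_sum => f _.
case: ifP => [|_]; last by case: ifP.
by rewrite inE => -[_ fE]; rewrite ifT // inE.
Qed.

Theorem mainTheorem2 (R : realType) (J : {fset nat}) (alpha beta : nat -> R) :
  profile_set J ->
  (forall j, j \in J -> 0 < alpha j) ->
  assumption1 J alpha beta ->
  forall (t1 t2 eps : R), 0 < t1 -> t1 < t2 -> 0 < eps ->
  forall delta : R, 0 < delta ->
  exists n0 : nat, forall n : nat, (n0 <= n)%N -> feasible J alpha n ->
    unif_prob R (partitions J (Nvec alpha n))
              [set s | eps <= sup_dev J beta t1 t2 s n] < delta.
Proof.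
move=> JP alpha_pos HA t1 t2 eps t10 t12 eps0 delta delta0.
have [j1 j1J j10] := JP.
have [c1 c10 [G [n1 upper]]] := deviation_mass R J alpha beta JP HA t1 t2 eps t10 t12 eps0.
(* The lower bound is asked at half the deviation rate, so the quotient of the two bounds still
   decays like exp(- (c1/2) sqrt n). *)
have c120 : 0 < c1 / 2 by rewrite divr_gt0.
have [n2 lower] := partition_mass_lower R J alpha beta JP HA alpha_pos (c1 / 2) c120.
(* Turns the decay into G exp(- (c1/2) sqrt n) < delta; the added 1 makes the inequality strict. *)
have [n3 Hn3] := poly_le_expR R (G%:R / delta + 1) (c1 / 2) 0 c120.
exists (maxn 1 (maxn n1 (maxn n2 n3))) => n.
rewrite !geq_max => /and4P[n0 nn1 nn2 nn3] _.
set N := Nvec alpha n; set E := [set s | _].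
(* For an empty set of partitions the quotient of cardinals is 0/0 = 0. *)
have [/eqP P0|/set0P Pne] := boolP (partitions J N == set0).
  by rewrite /unif_prob P0 set0I fset_set0 cardfs0 mul0r.
(* Parts and multiplicities of a partition of N are at most [N j1], so all of them are encoded; K is
   enlarged further so that truncation keeps half of the mass. *)
pose X := maxn n (absz (N j1)).
pose K := maxn (absz (N j1)) (Num.bound `|2 * \sum_(x < X) (cost R J beta n X x)^-1|).
have nX : (n <= X)%N := leq_maxl _ _.
have NX : (absz (N j1) <= X)%N := leq_maxr _ _.
have NK : (absz (N j1) <= K)%N := leq_maxl _ _.
have KE : 2 * \sum_(x < X) (cost R J beta n X x)^-1 <= K.+1%:R.
  apply: le_trans (ler_norm _) _; apply/ltW/(lt_le_trans (archi_boundP (normr_ge0 _))).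
  by rewrite ler_nat; apply: leqW; apply: leq_maxr.
pose Z := \prod_(x < X) (1 - tilt R X predT (cost R J beta n X) x)^-1.
have Z0 : 0 < Z.
  apply: prodr_gt0 => x _; rewrite invr_gt0 subr_gt0 tilt_lt1 // => y.
  exact: (cost_gt0 R J alpha beta JP HA).
have low := lower n X K j1 nn2 nX KE j1J j10 NX NK Pne.
have up := upper n X K nn1 nX.
have := unif_prob_mass R J beta n X K j1 N E j1J j10 NX NK; move/le_trans => /(_ _ up).
move: low; rewrite -/Z -/N; set mass := partition_mass _ _ _ _ _ _ _; set w := Num.sqrt n%:R.
set u := unif_prob _ _ _ => low H.
have e0 := expR_gt0 (c1 / 2 * w).
have mass0 : 0 < mass by apply: lt_le_trans low; rewrite mulr_gt0 ?expR_gt0.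
rewrite -(ltr_pM2r mass0); apply: le_lt_trans H _.
apply: lt_le_trans (_ : _ < delta * (Z * expR (- (c1 / 2 * w)))) _; last by rewrite ler_wpM2l // ltW.
have -> : c1 * w = c1 / 2 * w + c1 / 2 * w by field.
rewrite opprD expRD [G%:R * Z]mulrC -[Z * G%:R * _]mulrA [delta * _]mulrCA.
rewrite ltr_pM2l // mulrA ltr_pM2r ?expR_gt0 //.
rewrite expRN ltr_pdivrMr // -ltr_pdivrMl // mulrC.
by have := Hn3 n nn3; rewrite expr0 mulr1 -/w; lra.
Qed.
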